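(* Let $c_0\in\{1,2\}$. Then, as $Q\to+\infty$, for integers $r\geqslant 0$ with $r=o\bigl((Q/\ln Q)^{1/3}\bigr)$, the asymptotic formula \[ \nu(Q;r,3,c_0)=\nu(r;3,c_0)+O\Bigl(\frac{\ln Q}{Q}\Bigr) \] holds, where the implied constant is absolute and the quantities $\nu(r;3,c_0)$ are given by \begin{align*} \nu(0;3,c_0)&=\tfrac13=0.3333333333\ldots,\\ \nu(1;3,c_0)&=\tfrac23\Bigl(\tfrac{\pi}{\sqrt3}-\ln 3-\tfrac12\Bigr)=0.1434580504\ldots,\\ \nu(2;3,c_0)&=\tfrac83(\ln 3-1)=0.2629661031\ldots,\\ \nu(3;3,c_0)&=\tfrac{626}{105}-\tfrac{2\pi}{\sqrt3}-2\ln 3=0.1370814561\ldots,\\ \nu(4;3,c_0)&=\tfrac43\Bigl(\tfrac{\pi}{\sqrt3}-\tfrac{23}{35}-\ln 3\Bigr)=0.0773922912\ldots,\\ \nu(5;3,c_0)&=\tfrac43\ln 3-\tfrac{193}{135}=0.0351867552\ldots,\\ \nu(r;3,c_0)&=\frac{8}{3(2r-5)(2r-3)(2r-1)}\qquad (r\geqslant 6). \end{align*}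
   Context: $\Phi_Q$ denotes the Farey series of order $Q$: the set of all irreducible fractions in $[0,1]$ with denominators not exceeding $Q$, arranged in ascending order. For integers $r\geqslant 0$, $D\geqslant 2$, $0\leqslant c_0\leqslant D-1$, let $N(Q;r,D,c_0)$ be the number of tuples of $r+2$ consecutive fractions $\frac{a_0}{q_0}<\frac{a_1}{q_1}<\dots<\frac{a_{r+1}}{q_{r+1}}$ of $\Phi_Q$ (written in lowest terms) such that $q_0\equiv q_{r+1}\equiv c_0 \pmod D$ and $q_i\not\equiv c_0\pmod D$ for $i=1,\dots,r$. Let $N(Q;D,c_0)$ be the number of fractions of $\Phi_Q$ whose denominators are congruent to $c_0$ modulo $D$, and put \[ \nu(Q;r,D,c_0)=\frac{N(Q;r,D,c_0)}{N(Q;D,c_0)}. \] *)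

(* Defs.v *)
From HB Require Import structures.
From mathcomp Require Import all_boot all_order all_algebra.
From mathcomp Require Import all_classical all_reals all_analysis.
Set Implicit Arguments.
Unset Strict Implicit.
Unset Printing Implicit Defensive.
Import Order.TTheory GRing.Theory Num.Theory.
Import numFieldNormedType.Exports.
Local Open Scope ring_scope.

(* [coprime 0 q] holds only for [q = 1], so 0 occurs once, as 0/1. *)
Definition farey (Q : nat) : seq rat :=
  sort <=%R [seq x.1%:R / x.2%:R |
    x <- [seq (a, q) | q <- iota 1 Q, a <- iota 0 q.+1] & coprime x.1 x.2].

Definition farey_denoms (Q : nat) : seq nat :=
  [seq `|denq x|%N | x <- farey Q].

(* A tuple of r + 2 consecutive fractions is represented by the position i of
   its first element, which forces i + r + 1 < size (farey Q). *)
Definition farey_gap_count (Q r D c0 : nat) : nat :=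
  let q := nth 0%N (farey_denoms Q) in
  #|[set i : 'I_(size (farey Q) - r.+1) |
      [&& q i == c0 %[mod D], q (i + r.+1)%N == c0 %[mod D]
        & [forall j : 'I_r, q (i + j.+1)%N != c0 %[mod D]]]]|.

Definition farey_class_count (Q D c0 : nat) : nat :=
  count (fun q => q == c0 %[mod D]) (farey_denoms Q).

Definition gap_freq (R : realType) (Q r D c0 : nat) : R :=
  (farey_gap_count Q r D c0)%:R / (farey_class_count Q D c0)%:R.

(* The limit frequencies for D = 3; they are the same for c0 = 1 and c0 = 2. *)
Definition gap_freq_lim3 (R : realType) (r : nat) : R :=
  match r with
  | 0 => 1 / 3
  | 1 => 2 / 3 * (pi / Num.sqrt 3 - ln 3 - 1 / 2)
  | 2 => 8 / 3 * (ln 3 - 1)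
  | 3 => 626 / 105 - 2 * pi / Num.sqrt 3 - 2 * ln 3
  | 4 => 4 / 3 * (pi / Num.sqrt 3 - 23 / 35 - ln 3)
  | 5 => 4 / 3 * ln 3 - 193 / 135
  | _ => 8 / (3 * (2 * r%:R - 5) * (2 * r%:R - 3) * (2 * r%:R - 1))
  end.

(* [decimal R [:: d1; d2; ...; dn]] is the number 0.d1d2...dn. *)
Definition decimal (R : realType) (s : seq nat) : R :=
  \sum_(i < size s) (nth 0%N s i)%:R / 10 ^+ i.+1.

(* x = 0.d1d2...dn... up to less than one unit of the last displayed digit, so
   that the last digit may be either truncated or rounded. *)
Definition has_decimals (R : realType) (x : R) (s : seq nat) : Prop :=
  `|x - decimal R s| < 10 ^- size s.

(* Main.v *)
Require Import Defs.
From HB Require Import structures.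
From mathcomp Require Import all_boot all_order all_algebra.
From mathcomp Require Import all_classical all_reals all_analysis.
From mathcomp Require Import zify ring lra.
Set Implicit Arguments.
Unset Strict Implicit.
Unset Printing Implicit Defensive.

(** The pairs of consecutive denominators are the coprime pairs (x, y) with
    x, y <= Q < x + y, and the pair after (x, y) is (y, k y - x) where
    k = (Q + x) / y. Modulo 3, a window that leaves the class c can only meet 0
    and -c before returning; it stays at -c for long only along an arithmetic
    progression whose difference d is divisible by 3 and is itself a denominator
    of the window. So, for every r, the windows are described by a few linear
    regions in (d, n), n being a term of the progression, and by the residue of a
    single index k modulo 3. The number of lattice points of such a region in
    fixed residue classes mod 3 is (area) N^2 / 9 + O(N): slices have length a
    combination of ramps (B - c y)_+, and in the sum over k the second difference
    of the ramps cancels all terms linear in k. Moebius inversion over the common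
    divisor e, prime to 3, turns this into (area) Z(Q) Q^2 / 9 + O(Q ln Q) with
    Z(Q) = sum of mu(e) / e^2. The factor Z(Q) is the same for all regions and
    bounded below, so it disappears from the quotient and zeta(2) never has to be
    evaluated. All errors are uniform in r. *)

(** * Consecutive denominators *)

(** The obstacle is uniformity. The index k runs up to 2 Q, so a rounding error O(N) for each k
    would be useless. For a fixed height y only two values of k have a nonempty slice, and all
    rounding is charged to them. The main terms are evaluated up to O(k) for k below sqrt N and
    bounded trivially beyond. For long windows the only region is a kite with parameter j: it has no
    lattice point once j > N, and for j <= N its ramps have slopes O(N). Index 1 is exceptional: its
    region is cut off by y <= N, and the area 4 / (k (k + 1) (k + 2)), valid for k >= 2, fails.
    Pairs of index 1 are therefore counted by complement for r = 1, and otherwise through the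
    progressions that they start or by reversal and shift of the window. The constants pi / sqrt 3
    and ln 3 come from splitting 4 / (k (k + 1) (k + 2)) into partial fractions over a residue class
    mod 3: the resulting series are those of the integrals over [0, 1] of 1 / (1 + x + x^2) and (1 +
    2 x) / (1 + x + x^2). *)

(* x and y are the denominators of two consecutive fractions of Phi_Q. *)
Definition nbr (Q x y : nat) : bool :=
  [&& 0 < x, 0 < y, x <= Q, y <= Q, Q < x + y & coprime x y].

Definition idx (Q x y : nat) : nat := (Q + x) %/ y.

Definition nxt (Q x y : nat) : nat := idx Q x y * y - x.

(* Exactly r denominators, counted from y on, precede the first one in the class c;
   x itself is not tested. *)
Fixpoint run (Q c r x y : nat) : bool :=
  if r is r'.+1 then (y %% 3 != c) && run Q c r' y (nxt Q x y)
  else y %% 3 == c.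

Lemma nbrP Q x y : nbr Q x y ->
  [/\ 0 < x <= Q, 0 < y <= Q, Q < x + y & coprime x y].
Proof. by case/and5P=> ? ? ? ? /andP[? ?]; split=> //; apply/andP. Qed.

(** The interval from Q - y + 1 to Q contains one integer in each class mod y, so any candidate z in
    it with x + z = k y settles both the index and the next denominator. *)
Lemma idxE Q x y k z : 0 < y -> x + z = k * y -> z <= Q -> Q < y + z ->
  idx Q x y = k.
Proof.
move=> y0 E zQ Qz; rewrite /idx.
have -> : Q + x = k * y + (Q - z) by lia.
rewrite divnMDl // divn_small ?addn0 //; lia.
Qed.

Lemma nxtE Q x y k z : 0 < y -> x + z = k * y -> z <= Q -> Q < y + z ->
  nxt Q x y = z.
Proof. by move=> y0 E zQ Qz; rewrite /nxt (idxE y0 E zQ Qz); lia. Qed.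

Lemma nxt_spec Q x y : nbr Q x y ->
  [/\ x + nxt Q x y = idx Q x y * y, nxt Q x y <= Q, Q < y + nxt Q x y &
      0 < idx Q x y].
Proof.
case/nbrP=> x0 y0 xy _; rewrite /nxt /idx.
have := divn_eq (Q + x) y; have : (Q + x) %% y < y by rewrite ltn_mod; lia.
set m := (_ %% _); set k := (_ %/ _) => mlt E.
have k0 : 0 < k by case: k E => [|//]; rewrite mul0n; lia.
by split; lia.
Qed.

Lemma coprime_step x y z k : x + z = k * y -> coprime x y -> coprime z y.
Proof.
move=> E; rewrite /coprime => /eqP cop; rewrite -dvdn1 -cop dvdn_gcd dvdn_gcdr andbT.
by rewrite -(dvdn_addl _ (dvdn_gcdl z y)) E dvdn_mull // dvdn_gcdr.
Qed.

Lemma nxt_nbr Q x y : nbr Q x y -> nbr Q y (nxt Q x y).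
Proof.
move=> n; have [E zQ Qz _] := nxt_spec n; case/nbrP: n => x0 y0 xy cop.
have z0 : 0 < nxt Q x y by lia.
case/andP: y0 => y0 yQ.
by apply/and5P; split=> //; rewrite Qz coprime_sym (coprime_step E).
Qed.

(** The relation x + z = k y is symmetric in x and z: this is the reflection of the Farey series at
    1/2, which reads windows backwards. *)
Lemma nxt_rev Q x y : nbr Q x y ->
  [/\ nbr Q (nxt Q x y) y, idx Q (nxt Q x y) y = idx Q x y & nxt Q (nxt Q x y) y = x].
Proof.
move=> n; have [E zQ Qz _] := nxt_spec n.
have := nxt_nbr n; case/nbrP: n => x0 y0 xy cop /nbrP[_ z0 _ cop'].
have E' : nxt Q x y + x = idx Q x y * y by lia.
split; last 2 first.
- by apply: idxE E' _ _; lia.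
- by apply: nxtE E' _ _; lia.
case/andP: y0 => y0 yQ; case/andP: z0 => z0 _.
by apply/and5P; split=> //; rewrite addnC Qz coprime_sym.
Qed.

Lemma nbr_sym Q x y : nbr Q x y = nbr Q y x.
Proof.
by apply/and5P/and5P => -[? ? ? ? /andP[? ?]]; split=> //; rewrite addnC coprime_sym; apply/andP.
Qed.

Lemma mod3_step x y z k : x + z = k * y ->
  (x %% 3 + z %% 3) %% 3 = (k %% 3 * (y %% 3)) %% 3.
Proof. by move=> E; rewrite modnMm modnDm E. Qed.

(** Turns conditions on the index into linear inequalities, so that the regions below are bounded by
    straight lines. *)
Lemma idx_ge Q x y m : nbr Q x y -> (m <= idx Q x y) = (m * y <= Q + x).
Proof. by case/nbrP=> _ /andP[y0 _] _ _; rewrite /idx leq_divRL. Qed.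

Lemma nxt_mod3 Q x y : nbr Q x y ->
  (x %% 3 + nxt Q x y %% 3) %% 3 = (idx Q x y %% 3 * (y %% 3)) %% 3.
Proof. by case/nxt_spec=> E _ _ _; apply: mod3_step. Qed.

(** With z the next denominator, the point is 2 z > Q + y. If 3 y <= Q it follows from z > Q - y,
    otherwise from z >= 5 y - Q. *)
Lemma idx_after_ge5 Q x y : nbr Q x y -> 5 <= idx Q x y ->
  idx Q y (nxt Q x y) = 1.
Proof.
move=> n k5; have n' := nxt_nbr n; have [E zQ Qz k0] := nxt_spec n.
have [_ _ _ k0'] := nxt_spec n'.
have : 5 * y <= idx Q x y * y by rewrite leq_mul2r k5 orbT.
have := idx_ge 2 n'; case/nbrP: n => x0 y0 xy cop; lia.
Qed.

(** The same dichotomy at 2 y <= Q: the inequality 3 z > Q + y follows from z > Q - y or from z >= 3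
    y - Q. *)
Lemma idx_after_ge3 Q x y : nbr Q x y -> 3 <= idx Q x y ->
  idx Q y (nxt Q x y) <= 2.
Proof.
move=> n k3; have n' := nxt_nbr n; have [E zQ Qz k0] := nxt_spec n.
have : 3 * y <= idx Q x y * y by rewrite leq_mul2r k3 orbT.
have := idx_ge 3 n'; case/nbrP: n => x0 y0 xy cop; lia.
Qed.

Lemma run_step Q c t x y : (y %% 3 == c) = false ->
  run Q c t x y = (0 < t) && run Q c t.-1 y (nxt Q x y).
Proof. by case: t => [|t] /= ->. Qed.

Lemma run_stop Q c t x y : y %% 3 = c -> run Q c t x y = (t == 0).
Proof. by move=> e; case: t => [|t]; rewrite /= e eqxx. Qed.

Lemma pred_eqS t a : (0 < t) && (t.-1 == a) = (t == a.+1).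
Proof. by case: t. Qed.

Lemma modnB3 y d : d %% 3 = 0 -> d <= y -> (y - d) %% 3 = y %% 3.
Proof. by lia. Qed.

(** * Exit times of windows that have reached the class -c *)

Section ExitTimes.
Variables (Q c : nat).
Hypothesis c12 : c = 1 \/ c = 2.

Lemma run_to0 t x y : nbr Q x y -> x %% 3 = 3 - c -> y %% 3 = 0 ->
  run Q c t x y = (t == 1).
Proof.
move=> n xc y0; rewrite run_step; last by rewrite y0; case: c12 => ->.
rewrite run_stop ?pred_eqS //.
have := nxt_mod3 n; rewrite xc y0 muln0; case: c12 => ->; lia.
Qed.

Lemma run_c'c'_idx1 t x y : nbr Q x y -> x %% 3 = 3 - c -> y %% 3 = 3 - c ->
  idx Q x y %% 3 = 1 -> run Q c t x y = (t == 2).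
Proof.
move=> n xc yc k1; rewrite run_step; last by rewrite yc; case: c12 => ->.
rewrite (run_to0 _ (nxt_nbr n)) ?pred_eqS //.
have := nxt_mod3 n; rewrite xc yc k1; case: c12 => ->; lia.
Qed.

(* The value of r in [run] for a pair of classes (-c, -c) with index k >= 3. *)
Definition exitE (k : nat) := nth 0 [:: 1; 2; 3] (k %% 3).

(** For k = 0, 1, 2 mod 3 the next denominator has class c, 0, -c. In the last case k >= 3 forces k
    >= 5, so the next index is 1 and the class after that is 0. *)
Lemma run_c'c' t x y : nbr Q x y -> x %% 3 = 3 - c -> y %% 3 = 3 - c ->
  3 <= idx Q x y -> run Q c t x y = (t == exitE (idx Q x y)).
Proof.
move=> n xc yc k3; have : idx Q x y %% 3 < 3 by rewrite ltn_mod.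
have := nxt_mod3 n; rewrite xc yc /exitE.
case k : (idx Q x y %% 3) => [|[|[|?]]] //= zc _.
- rewrite run_step; last by rewrite yc; case: c12 => ->.
  by rewrite run_stop ?pred_eqS //; case: c12 zc => ->; lia.
- exact: run_c'c'_idx1.
- rewrite run_step; last by rewrite yc; case: c12 => ->.
  rewrite (run_c'c'_idx1 _ (nxt_nbr n)) ?pred_eqS //.
  + by case: c12 zc => ->; lia.
  + by rewrite idx_after_ge5 //; case: (idx Q x y) k3 k => [|[|[|[|[|?]]]]].
Qed.

(* Descending progression of step d below the neighbour y of d. *)
Lemma run_descent t d y j : nbr Q d y -> d %% 3 = 0 -> y %% 3 = 3 - c ->
  0 < j -> Q + (2 * j - 1) * d < 2 * y ->
  [/\ nbr Q (y - (j - 1) * d) (y - j * d), (y - (j - 1) * d) %% 3 = 3 - c,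
      (y - j * d) %% 3 = 3 - c &
      run Q c t d y = (j <= t) && run Q c (t - j) (y - (j - 1) * d) (y - j * d)].
Proof.
move=> n d0 yc; elim: j t => [//|j IH] t _ H.
case: (posnP j) => [j0|jpos].
  rewrite j0 in H *.
  have [E zQ Qz k0] := nxt_spec n.
  have Ez : nxt Q d y = y - d.
    by case/nbrP: n => ? /andP[? ?] ? _; apply: (@nxtE _ _ _ 1); lia.
  have n' := nxt_nbr n; rewrite Ez in n'.
  have ydc : (y - d) %% 3 = 3 - c.
    by rewrite modnB3 //; case/nbrP: n' => _; lia.
  rewrite subnn mul0n subn0 mul1n; split=> //.
  rewrite run_step; last by rewrite yc; case: c12 => ->.
  by rewrite Ez subn1.
have H' : Q + (2 * j - 1) * d < 2 * y.
  apply: leq_ltn_trans H; rewrite leq_add2l leq_mul2r; apply/orP; right; lia.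
have [nj a1 a2 _] := IH t jpos H'.
have -> : j.+1 - 1 = j by lia.
have Ej : (2 * j.+1 - 1) * d = 2 * (j * d) + d by nia.
rewrite Ej in H.
have Ej' : (y - (j - 1) * d) = y - j * d + d.
  have : (j - 1) * d + d = j * d by nia.
  case/nbrP: nj => _; lia.
(* The hypothesis for j + 1 says exactly that y - j d and y - (j + 1) d add up to more than Q, so
   the progression goes on with index 2. *)
have Ez : nxt Q (y - (j - 1) * d) (y - j * d) = y - j.+1 * d.
  case/nbrP: nj => ? /andP[? ?] ? _; apply: (@nxtE _ _ _ 2) => //; rewrite ?mulSn; lia.
have n' := nxt_nbr nj; rewrite Ez in n'.
have yjc : (y - j.+1 * d) %% 3 = 3 - c.
  rewrite -a2 mulSn addnC subnDA modnB3 //; case/nbrP: n' => _; lia.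
split=> //.
have [_ _ _ ->] := IH t jpos H'.
rewrite run_step; last by rewrite a2; case: c12 => ->.
by rewrite Ez andbA subn_gt0 -subnS; congr (_ && _); lia.
Qed.

End ExitTimes.

(** When one more step of length d would exceed Q, the index drops from 2 to 1 and the next
    denominator is d itself, of class 0, followed by the class c. *)
Lemma run_ascent Q c d i t m : c = 1 \/ c = 2 ->
  nbr Q m (m + d) -> m %% 3 = 3 - c -> d %% 3 = 0 ->
  m + i.+1 * d <= Q < m + i.+2 * d -> run Q c t m (m + d) = (t == i.+2).
Proof.
move=> c12; elim: i t m => [|i IH] t m n mc d0 H.
  have mdc : (m + d) %% 3 = 3 - c by lia.
  apply: run_c'c'_idx1 => //; rewrite (@idxE _ _ _ 1 d) //; lia.
have mdc : (m + d) %% 3 = 3 - c by lia.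
rewrite run_step; last by rewrite mdc; case: c12 => ->.
rewrite !mulSn in H; have n' := nxt_nbr n.
have Ez : nxt Q m (m + d) = m + d + d.
  by case/nbrP: n => ? ? ? _; apply: (@nxtE _ _ _ 2); rewrite ?mulSn; lia.
rewrite Ez in n' *; rewrite (IH t.-1) //; first by rewrite pred_eqS.
by rewrite !mulSn; lia.
Qed.

(** * Counting pairs, and transport of counts along injections *)

Definition pair_count (Q : nat) (P : nat -> nat -> bool) : nat :=
  \sum_(p : 'I_Q.+1 * 'I_Q.+1) P p.1 p.2.

Lemma pair_count_card Q P : pair_count Q P = #|[pred p : 'I_Q.+1 * 'I_Q.+1 | P p.1 p.2]|.
Proof. by rewrite -sum1_card /pair_count [RHS]big_mkcond. Qed.

Lemma eq_pair_count Q (P P' : nat -> nat -> bool) : (forall x y, x <= Q -> y <= Q -> P x y = P' x y) ->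
  pair_count Q P = pair_count Q P'.
Proof. by move=> H; apply: eq_bigr => -[x y] _ /=; rewrite H // -ltnS. Qed.

Lemma pair_count0 Q (P : nat -> nat -> bool) : (forall x y, P x y = false) -> pair_count Q P = 0.
Proof. by move=> H; apply: big1 => p _; rewrite H. Qed.

Lemma pair_countD Q (P P1 P2 : nat -> nat -> bool) :
  (forall x y, x <= Q -> y <= Q -> P x y = P1 x y + P2 x y :> nat) ->
  pair_count Q P = pair_count Q P1 + pair_count Q P2.
Proof.
by move=> H; rewrite /pair_count -big_split; apply: eq_bigr => -[x y] _ /=; rewrite H // -ltnS.
Qed.

(** Injectivity of f is supplied by a left inverse g, which leaves purely arithmetic goals. An
    equality of counts below is a pair of such injections in opposite directions. *)
Lemma leq_pair_count Q Q' (P P' : nat -> nat -> bool) (f g : nat -> nat -> nat * nat) :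
  (forall x y, P x y -> x <= Q -> y <= Q -> let p := f x y in
     [/\ P' p.1 p.2, p.1 <= Q', p.2 <= Q' & g p.1 p.2 = (x, y)]) ->
  pair_count Q P <= pair_count Q' P'.
Proof.
move=> H; rewrite !pair_count_card.
pose F (p : 'I_Q.+1 * 'I_Q.+1) : 'I_Q'.+1 * 'I_Q'.+1 :=
  let q := f p.1 p.2 in (inord q.1, inord q.2).
rewrite -(@card_in_image _ _ F).
  apply/subset_leq_card/fintype.subsetP => q /fintype.imageP[p /= Pp ->].
  have [h1 h2 h3 _] := H _ _ (Pp : P p.1 p.2) (leq_ord _) (leq_ord _).
  by rewrite unfold_in /= !inordK ?ltnS.
move=> [x y] [x' y'] /= Pp Pp' [] /(congr1 val) /= e1 /(congr1 val) /= e2.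
have [_ l1 l2 E] := H _ _ (Pp : P x y) (leq_ord _) (leq_ord _).
have [_ l1' l2' E'] := H _ _ (Pp' : P x' y') (leq_ord _) (leq_ord _).
rewrite /= in l1 l2 l1' l2' E E'.
rewrite !inordK ?ltnS // in e1; rewrite !inordK ?ltnS // in e2.
by move: E; rewrite e1 e2 E' => -[/val_inj -> /val_inj ->].
Qed.

Lemma pair_count_bij_le Q Q' (P P' : nat -> nat -> bool) (f g f' g' : nat -> nat -> nat * nat) :
  (forall x y, P x y -> x <= Q -> y <= Q -> let p := f x y in
     [/\ P' p.1 p.2, p.1 <= Q', p.2 <= Q' & g p.1 p.2 = (x, y)]) ->
  (forall x y, P' x y -> x <= Q' -> y <= Q' -> let p := f' x y in
     [/\ P p.1 p.2, p.1 <= Q, p.2 <= Q & g' p.1 p.2 = (x, y)]) ->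
  pair_count Q P = pair_count Q' P'.
Proof.
by move=> H H'; apply/eqP; rewrite eqn_leq (@leq_pair_count _ _ _ _ _ _ H) (@leq_pair_count _ _ _ _ _ _ H').
Qed.

Lemma pair_count_bij Q Q' (P P' : nat -> nat -> bool) (f g f' g' : nat -> nat -> nat * nat) :
  (forall x y, P x y -> let p := f x y in
     [/\ P' p.1 p.2, p.1 <= Q', p.2 <= Q' & g p.1 p.2 = (x, y)]) ->
  (forall x y, P' x y -> let p := f' x y in
     [/\ P p.1 p.2, p.1 <= Q, p.2 <= Q & g' p.1 p.2 = (x, y)]) ->
  pair_count Q P = pair_count Q' P'.
Proof.
by move=> H H'; apply: (@pair_count_bij_le _ _ _ _ f g f' g') => x y Pxy _ _; [exact: H|exact: H'].
Qed.

Definition nbr_count Q u v (P : nat -> nat -> bool) :=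
  pair_count Q (fun x y => [&& nbr Q x y, x %% 3 == u, y %% 3 == v & P x y]).

(** The region H receives Q as an argument because Moebius inversion evaluates it at the quotients Q
    / e. *)
Definition reg_count Q u v (H : nat -> nat -> nat -> bool) :=
  pair_count Q (fun x y => [&& 0 < x, 0 < y, coprime x y, x %% 3 == u, y %% 3 == v & H Q x y]).

Definition reg_triangle N x y := [&& x <= N, y <= N & N < x + y].
Definition reg_index a m N x y := [&& reg_triangle N x y, m * y <= N + x & ((N + x) %/ y) %% 3 == a].
(* In the next three regions d is the difference of a descending progression
   n + j d, ..., n + d, n of denominators. *)
Definition reg_kite j N d n :=
  [&& n + j * d <= N, N < n + j.+1 * d, 2 * n <= N + d & N < 2 * n + d].
Definition reg_wedge N d n := [&& n + 2 * d <= N, 2 * n <= N + d & N < 2 * n + d].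
Definition reg_corner N d n := [&& n + 2 * d <= N, 3 * n <= N + d & N < 2 * n + d].

Lemma nbr_count_triangle Q u v : nbr_count Q u v (fun _ _ => true) = reg_count Q u v reg_triangle.
Proof.
apply: eq_pair_count => x y _ _; rewrite /nbr /reg_triangle.
by case: (0 < x); case: (0 < y); case: (x <= Q); case: (y <= Q); case: (Q < x + y);
  case: (coprime x y) => //=; case: (_ == u); case: (_ == v).
Qed.

Lemma nbr_count_index Q u v a m :
  nbr_count Q u v (fun x y => (m <= idx Q x y) && (idx Q x y %% 3 == a)) = reg_count Q u v (reg_index a m).
Proof.
apply: eq_pair_count => x y _ _; rewrite /reg_index /reg_triangle.
case n : (nbr Q x y) => /=.
  rewrite (idx_ge _ n); case/and5P: n => -> -> -> -> /andP[-> ->] /=.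
  by [].
apply/esym/negP => /and5P[x0 y0 cop xu /and4P[yv /and3P[xQ yQ xy] _ _]].
by move: n; rewrite /nbr x0 y0 xQ yQ xy cop.
Qed.

Lemma coprimeDmul j x y : coprime x (y + j * x) = coprime x y.
Proof. by rewrite /coprime addnC gcdnMDl. Qed.

Section Bijections.
Variables (Q c : nat).
Hypothesis c12 : c = 1 \/ c = 2.

(* j is the integer nearest to (y - Q / 2) / x. *)
Definition descent j (x y : nat) :=
  (Q + (2 * j - 1) * x < 2 * y) && (2 * y <= Q + (2 * j + 1) * x).

(** The substitution d = x, n = y - j x is unimodular, hence keeps coprimality, and it keeps the
    class of the second coordinate because 3 divides x. Two sides of the kite are y <= Q and Q < x +
    y, the other two are the bounds in [descent]. *)
Lemma descent_count j (phi : nat -> nat -> bool) : 0 < j ->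
  nbr_count Q 0 (3 - c) (fun x y => descent j x y && phi x (y - j * x)) =
  reg_count Q 0 (3 - c) (fun N d n => reg_kite j N d n && phi d n).
Proof.
move=> j0.
apply: (@pair_count_bij _ _ _ _ (fun x y => (x, y - j * x)) (fun x y => (x, y + j * x))
  (fun x y => (x, y + j * x)) (fun x y => (x, y - j * x))) => x y /=.
- case/and5P=> n /eqP x3 /eqP y3 /andP[k1 k2] ph.
  have [/andP[x0 xQ] /andP[y0 yQ] xy cop] := nbrP n.
  have Ej : (2 * j - 1) * x + x = 2 * (j * x) by nia.
  have Ej' : (2 * j + 1) * x = 2 * (j * x) + x by nia.
  have jy : j * x < y by lia.
  have Ey : y = (y - j * x) + j * x by lia.
  split; [|lia|lia|by rewrite subnK // ltnW].
  rewrite x0 subn_gt0 jy x3 /= ph andbT /reg_kite.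
  have -> : coprime x (y - j * x).
    by rewrite Ey coprimeDmul in cop.
  rewrite modnB3 ?y3 ?eqxx /=; [|lia|lia].
  by rewrite mulSn; apply/and4P; split; lia.
- case/and5P=> x0 y0 cop /eqP x3 /and3P[/eqP y3 /and4P[k1 k2 k3 k4] ph].
  have Ej : (2 * j - 1) * x + x = 2 * (j * x) by nia.
  have Ej' : (2 * j + 1) * x = 2 * (j * x) + x by nia.
  rewrite mulSn in k2.
  have jx : x <= j * x by rewrite leq_pmull.
  split; [|lia|lia|by rewrite addnK].
  have nb : nbr Q x (y + j * x).
    by apply/and5P; split; [lia..|rewrite coprimeDmul cop andbT; lia].
  have y3' : (y + j * x) %% 3 = y %% 3 by rewrite -modnDm -modnMm x3 muln0 mod0n addn0 modn_mod.
  rewrite nb addnK ph /descent y3' y3 x3 eqxx andbT /=; apply/andP; split; lia.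
Qed.
End Bijections.

Lemma descent_inj Q i j x y : 0 < x -> 0 < i -> 0 < j ->
  descent Q i x y -> descent Q j x y -> i = j.
Proof.
move=> x0 i0 j0 /andP[a1 a2] /andP[b1 b2].
have H1 : (2 * i - 1) * x < (2 * j + 1) * x by lia.
have H2 : (2 * j - 1) * x < (2 * i + 1) * x by lia.
by rewrite !ltn_mul2r x0 /= in H1 H2; lia.
Qed.

(** For fixed x the intervals for y given by [descent] with j > 0 tile the range 2 y > Q + x, which
    for neighbours means index 1. *)
Lemma descent_cases Q x y : 0 < x ->
  (2 * y <= Q + x /\ forall j, 0 < j -> descent Q j x y = false) \/
  exists j, [/\ 0 < j, descent Q j x y, (2 * y <= Q + x) = false &
                forall i, 0 < i -> descent Q i x y = (i == j)].
Proof.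
move=> x0; case: (leqP (2 * y) (Q + x)) => H; [left|right].
  split=> // j j0; apply/negP => /andP[k1 _].
  have : x <= (2 * j - 1) * x by rewrite leq_pmull //; lia.
  lia.
(* The -1 makes the lower bound (2 j - 1) x < 2 y - Q strict. *)
pose j := (2 * y - Q - 1 + x) %/ (2 * x).
have E := divn_eq (2 * y - Q - 1 + x) (2 * x).
have l : (2 * y - Q - 1 + x) %% (2 * x) < 2 * x by rewrite ltn_mod; lia.
have j0 : 0 < j by rewrite divn_gt0; lia.
rewrite -/j in E.
have Ej : (2 * j - 1) * x + x = 2 * (j * x) by nia.
have Ej' : (2 * j + 1) * x = 2 * (j * x) + x by nia.
have Ej2 : j * (2 * x) = 2 * (j * x) by nia.
have kj : descent Q j x y by apply/andP; split; lia.
exists j; split=> // i i0; apply/idP/eqP => [ki|->//].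
exact: descent_inj ki kj.
Qed.

(* The value of r in [run] for a pair of classes (0, -c) with index k >= 2; k' is
   the index of the next pair. *)
Definition exit0 k k' := nth 0 [:: 2; if k' == 1 then 3 else 4; 1] (k %% 3).

Section BExit.
Variables (Q c : nat).
Hypothesis c12 : c = 1 \/ c = 2.

(** As 3 divides x, the next denominator has the class of k y, and only k = 1 mod 3 stays at -c.
    Then k >= 4, so the next index is 1 or 2; if it is 2, then k = 4 and the window goes y, y + d, y
    + 2 d, d with d = 3 y - x divisible by 3. *)
Lemma run_0c_idx_ge2 s x y : nbr Q x y -> x %% 3 = 0 -> y %% 3 = 3 - c ->
  2 <= idx Q x y ->
  run Q c s x y = (s == exit0 (idx Q x y) (idx Q y (nxt Q x y))).
Proof.
move=> n x3 yc k2; have : idx Q x y %% 3 < 3 by rewrite ltn_mod.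
have := nxt_mod3 n; rewrite x3 yc /exit0 => zc.
rewrite run_step; last by rewrite yc; case: c12 => ->.
case k : (idx Q x y %% 3) zc => [|[|[|?]]] //= zc _.
- rewrite (run_to0 c12 _ (nxt_nbr n)) ?pred_eqS //; case: c12 zc => ->; lia.
- have zc' : nxt Q x y %% 3 = 3 - c by case: c12 zc => ->; lia.
  case: (idx Q y (nxt Q x y) =P 1) => k1.
    by rewrite (run_c'c'_idx1 c12 _ (nxt_nbr n) yc zc') ?pred_eqS // k1.
  have k'2 := idx_after_ge3 n; have k'5 := idx_after_ge5 n.
  have [_ _ _ k'0] := nxt_spec (nxt_nbr n).
  have k3 : 3 <= idx Q x y by case: (idx Q x y) k2 k => [|[|[|?]]].
  have {k'2}k'2 := k'2 k3.
  have k'E : idx Q y (nxt Q x y) = 2 by lia.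
  have k4 : idx Q x y = 4 by lia.
  have n' := nxt_nbr n.
  have {}zc := nxt_mod3 n'.
  rewrite run_step ?pred_eqS; last by rewrite zc'; case: c12 => ->.
  rewrite (run_c'c'_idx1 c12 _ (nxt_nbr n')).
  + by case: s => [|[|]].
  + by [].
  + by rewrite k'E zc' yc in zc; case: c12 zc => ->; lia.
  + have [E1 E2 E3 _] := nxt_spec n; have [E1' E2' E3' _] := nxt_spec n'.
    have [_ /andP[E0' _] _ _] := nbrP (nxt_nbr n').
    rewrite k4 in E1; rewrite k'E in E1'.
    rewrite (@idxE _ _ _ 1 (nxt Q y (nxt Q x y) - nxt Q x y)) //; case/nbrP: n => *; lia.
- rewrite run_stop ?pred_eqS //; case: c12 zc => ->; lia.
Qed.

(** Put d = x and n = y - j x. From n + j d <= Q < 2 n + d follows n > (j - 1) d. The last pair has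
    index at least m only if (m - 1) n <= Q + d, hence (m - 3) n < 2 d. So j >= 2 excludes index 5
    and j >= 3 excludes index 4. *)
Lemma run_0c_descent s j x y : nbr Q x y -> x %% 3 = 0 -> y %% 3 = 3 - c ->
  0 < j -> descent Q j x y ->
  let k := idx Q (y - (j - 1) * x) (y - j * x) in
  [/\ 3 <= k, run Q c s x y = (s == j + exitE k),
      1 < j -> k = if 3 * (y - j * x) <= Q + x then 4 else 3 &
      2 < j -> k = 3].
Proof.
move=> n x3 yc j0 /andP[k1 k2] k.
have [nj a1 a2 ->] := run_descent c12 s n x3 yc j0 k1.
have Ej' : (2 * j + 1) * x = 2 * (j * x) + x by nia.
have Ej'' : (2 * j - 1) * x + x = 2 * (j * x) by nia.
have Ej : (y - (j - 1) * x) = y - j * x + x.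
  have : (j - 1) * x + x = j * x by nia.
  case/nbrP: nj => *; lia.
have k3 : 3 <= k by rewrite (idx_ge _ nj) Ej; lia.
split=> //.
- rewrite (run_c'c' c12 _ nj) // -/k; lia.
- move=> j1; have : (5 <= k) = false.
    rewrite (idx_ge _ nj) Ej; have : 2 * x <= j * x by rewrite leq_mul2r j1 orbT.
    case/nbrP: n; case/nbrP: nj; lia.
  have -> : (3 * (y - j * x) <= Q + x) = (4 <= k) by rewrite (idx_ge _ nj) Ej; lia.
  by case: ifP; lia.
- move=> j2; have : (4 <= k) = false.
    rewrite (idx_ge _ nj) Ej; have : 3 * x <= j * x by rewrite leq_mul2r j2 orbT.
    case/nbrP: n; case/nbrP: nj; lia.
  lia.
Qed.

End BExit.

Lemma eq_nbr_count Q u v (P P' : nat -> nat -> bool) :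
  (forall x y, nbr Q x y -> x %% 3 = u -> y %% 3 = v -> P x y = P' x y) ->
  nbr_count Q u v P = nbr_count Q u v P'.
Proof.
move=> H; apply: eq_pair_count => x y _ _; case n : (nbr Q x y) => //=.
by case: eqP => // xu; case: eqP => // yv; rewrite H.
Qed.

Lemma nbr_countD Q u v (P P1 P2 : nat -> nat -> bool) :
  (forall x y, nbr Q x y -> x %% 3 = u -> y %% 3 = v ->
    P x y = P1 x y + P2 x y :> nat) ->
  nbr_count Q u v P = nbr_count Q u v P1 + nbr_count Q u v P2.
Proof.
move=> H; apply: pair_countD => x y _ _; case n : (nbr Q x y) => //=.
by case: eqP => // xu; case: eqP => // yv; rewrite H.
Qed.

Lemma nbr_countD3 Q u v (P P1 P2 P3 : nat -> nat -> bool) :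
  (forall x y, nbr Q x y -> x %% 3 = u -> y %% 3 = v ->
    P x y = P1 x y + P2 x y + P3 x y :> nat) ->
  nbr_count Q u v P = nbr_count Q u v P1 + nbr_count Q u v P2 + nbr_count Q u v P3.
Proof.
move=> H; rewrite -(@nbr_countD _ _ _ (fun x y => P1 x y || P2 x y)).
  by apply: nbr_countD => x y n xu yv; have := H x y n xu yv; do !case: (_ x y).
by move=> x y n xu yv; have := H x y n xu yv; do !case: (_ x y).
Qed.

Lemma nbr_countD4 Q u v (P P1 P2 P3 P4 : nat -> nat -> bool) :
  (forall x y, nbr Q x y -> x %% 3 = u -> y %% 3 = v ->
    P x y = P1 x y + P2 x y + P3 x y + P4 x y :> nat) ->
  nbr_count Q u v P = nbr_count Q u v P1 + nbr_count Q u v P2 + nbr_count Q u v P3 + nbr_count Q u v P4.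
Proof.
move=> H; rewrite -(@nbr_countD3 _ _ _ (fun x y => [|| P1 x y, P2 x y | P3 x y])).
  by apply: nbr_countD => x y n xu yv; have := H x y n xu yv; do !case: (_ x y).
by move=> x y n xu yv; have := H x y n xu yv; do !case: (_ x y).
Qed.

Definition next_idx Q x y := idx Q y (nxt Q x y).

(** In terms of two successive indices, a descent of length one becomes accessible to reversal and
    shift of the window. *)
Lemma descent1E Q x y : nbr Q x y ->
  descent Q 1 x y = (idx Q x y == 1) && (3 <= next_idx Q x y).
Proof.
move=> n; have n' := nxt_nbr n; have [E zQ Qz k0] := nxt_spec n.
rewrite /descent /next_idx (idx_ge 3 n').
have -> : (idx Q x y == 1) = ~~ (2 * y <= Q + x) by rewrite -(idx_ge 2 n); lia.
case H : (2 * y <= Q + x) => /=; first by lia.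
have k1 : idx Q x y = 1 by have := idx_ge 2 n; lia.
by rewrite k1 in E; lia.
Qed.

Section Counts.
Variables (Q c : nat).
Hypothesis c12 : c = 1 \/ c = 2.
Let c' := 3 - c.

(* Reversal of the window x, y, z, w. *)
Lemma mirror a v : v = ((a + 2) * c') %% 3 -> a < 3 ->
  nbr_count Q 0 c' (fun x y => descent Q 1 x y && (next_idx Q x y %% 3 == a)) =
  nbr_count Q v c' (fun x y => [&& 3 <= idx Q x y, idx Q x y %% 3 == a & next_idx Q x y == 1]).
Proof.
move=> hv a3; pose f x y := (nxt Q y (nxt Q x y), nxt Q x y).
apply: (@pair_count_bij _ _ _ _ f f f f) => x y /=;
    case/and4P=> n /eqP x3 /eqP y3.
- rewrite descent1E //= => /andP[/andP[/eqP k1 k3] /eqP ka].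
  have n' := nxt_nbr n.
  have [rn rk rz] := nxt_rev n; have [rn' rk' rz'] := nxt_rev n'.
  have := nxt_mod3 n; have := nxt_mod3 n'; rewrite /f.
  rewrite x3 y3 k1 -/(next_idx Q x y) ka /next_idx rk' rz' => zw yz.
  split; [|by case/nbrP: rn' => /andP[]|by case/nbrP: n' => _ /andP[]|by rewrite rz].
  rewrite rn' rk -/(next_idx Q x y) k1 k3 ka !eqxx !andbT /=.
  move: hv zw yz a3; rewrite /c'; case: c12 => -> /=.
    by case: a {ka} => [|[|[|?]]] //= -> /= zw yz _; apply/andP; split; apply/eqP; clear -zw yz; lia.
  by case: a {ka} => [|[|[|?]]] //= -> /= zw yz _; apply/andP; split; apply/eqP; clear -zw yz; lia.
- case/and3P=> k3 /eqP ka /eqP k1.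
  have n' := nxt_nbr n.
  have [rn rk rz] := nxt_rev n; have [rn' rk' rz'] := nxt_rev n'.
  have := nxt_mod3 n; have := nxt_mod3 n'; rewrite /f.
  rewrite x3 y3 -/(next_idx Q x y) k1 ka => zw yz.
  split; [|by case/nbrP: rn' => /andP[]|by case/nbrP: n' => _ /andP[]|by rewrite rz' rz].
  rewrite rn' descent1E //= /next_idx rk' rz' rk -/(next_idx Q x y) k1 k3 ka !eqxx !andbT /=.
  move: hv zw yz a3; rewrite /c'; case: c12 => -> /=.
    by case: a {ka} => [|[|[|?]]] //= -> /= zw yz _; apply/andP; split; apply/eqP; clear -zw yz; lia.
  by case: a {ka} => [|[|[|?]]] //= -> /= zw yz _; apply/andP; split; apply/eqP; clear -zw yz; lia.
Qed.

(** The first denominator is dropped. An index that is at least 3 and 2 mod 3 is at least 5;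
    conversely, by reversal, a pair of index at least 5 is preceded by a pair of index 1, which
    restores it. *)
Lemma descent1_shift :
  nbr_count Q 0 c' (fun x y => descent Q 1 x y && (next_idx Q x y %% 3 == 2)) =
  nbr_count Q c' c' (fun x y => (5 <= idx Q x y) && (idx Q x y %% 3 == 2)).
Proof.
apply: (@pair_count_bij _ _ _ _ (fun x y => (y, nxt Q x y)) (fun y z => (nxt Q z y, y))
  (fun y z => (nxt Q z y, y)) (fun x y => (y, nxt Q x y))) => x y /=;
    case/and4P=> n /eqP x3 /eqP y3.
- rewrite descent1E //= => /andP[/andP[/eqP k1 k3] /eqP ka].
  have n' := nxt_nbr n; have [rn rk rz] := nxt_rev n.
  have := nxt_mod3 n; rewrite x3 y3 k1 => yz.
  split; [|by case/nbrP: n => ? /andP[]|by case/nbrP: n' => _ /andP[]|by rewrite rz].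
  rewrite n' -/(next_idx Q x y) ka !eqxx !andbT /=.
  apply/andP; split; first by apply/eqP; rewrite /c' in yz *; case: c12 yz => ->; lia.
  lia.
- case/andP=> k5 /eqP ka.
  have n' := nxt_nbr n; have [rn rk rz] := nxt_rev n.
  have k1 := idx_after_ge5 rn; rewrite rk rz in k1; have {}k1 := k1 k5.
  have ns : nbr Q y x by rewrite nbr_sym.
  have [sn sk sz] := nxt_rev ns.
  have := nxt_mod3 ns; rewrite x3 y3 k1 => yz.
  split; [|by case/nbrP: sn => /andP[]|by case/nbrP: n => /andP[]|by rewrite sz].
  rewrite sn descent1E //= /next_idx sk sz k1 ka !eqxx /= !andbT.
  apply/andP; split; first by apply/eqP; rewrite /c' in yz *; case: c12 yz => ->; lia.
  lia.
Qed.

(** With n = y and d = 3 y - x the four denominators are 3 n - d, n, n + d, n + 2 d. The sides of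
    the corner say that the first and the last are at most Q and that n and n + d add up to more
    than Q. *)
Lemma corner_count :
  nbr_count Q 0 c' (fun x y => (idx Q x y == 4) && (next_idx Q x y == 2)) = reg_count Q 0 c' reg_corner.
Proof.
apply: (@pair_count_bij _ _ _ _ (fun x y => (3 * y - x, y)) (fun x y => (3 * y - x, y))
  (fun x y => (3 * y - x, y)) (fun x y => (3 * y - x, y))) => x y /=.
- case/and5P=> n /eqP x3 /eqP y3 /eqP k4 /eqP k2.
  have n' := nxt_nbr n; have [E zQ Qz k0] := nxt_spec n.
  have [E' zQ' Qz' k0'] := nxt_spec n'.
  rewrite -/(next_idx Q x y) k2 in E'; rewrite k4 in E.
  have [/andP[x0 xQ] /andP[y0 yQ] xy cop] := nbrP n.
  have xy3 : x + (3 * y - x) = 3 * y by lia.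
  split; [|lia|lia|by congr pair; lia].
  rewrite y3 y0 (coprime_step xy3 cop) ?eqxx /=.
  rewrite /reg_corner; apply/and3P; split; [lia|apply/eqP|apply/and3P; split; lia].
  by lia.
- case/and5P=> x0 y0 cop /eqP x3 /andP[/eqP y3 /and3P[a1 a2 a3]].
  have xy3 : x + (3 * y - x) = 3 * y by lia.
  have n : nbr Q (3 * y - x) y.
    by apply/and5P; split; [lia..|rewrite (coprime_step xy3 cop) andbT; lia].
  have z : (3 * y - x) + (y + x) = 4 * y by lia.
  have k4 : idx Q (3 * y - x) y = 4 by apply: idxE z _ _; lia.
  have nz : nxt Q (3 * y - x) y = y + x by apply: nxtE z _ _; lia.
  have w : y + (y + 2 * x) = 2 * (y + x) by lia.
  split; [|lia|lia|by congr pair; lia].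
  rewrite n k4 /next_idx nz (idxE _ w) ?y3 ?eqxx //=; [|lia..].
  by rewrite !andbT; apply/eqP; lia.
Qed.

(** These pairs open an ascending progression: with n = y and d = 2 y - x the denominators are 2 n -
    d, n, n + d. The side n + 2 d <= Q is the condition on the second index, and Q + d < 3 n is Q <
    x + y. *)
Lemma wedge_count (phi : nat -> nat -> bool) :
  nbr_count Q c c' (fun x y => [&& idx Q x y == 3, 2 <= next_idx Q x y & phi (2 * y - x) y]) =
  reg_count Q 0 c' (fun N d n => [&& reg_wedge N d n, N + d < 3 * n & phi d n]).
Proof.
apply: (@pair_count_bij _ _ _ _ (fun x y => (2 * y - x, y)) (fun x y => (2 * y - x, y))
  (fun x y => (2 * y - x, y)) (fun x y => (2 * y - x, y))) => x y /=.
- case/and5P=> n /eqP x3 /eqP y3 /eqP k3 /andP[k2 ph].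
  have n' := nxt_nbr n; have [E zQ Qz k0] := nxt_spec n.
  have [E' zQ' Qz' k0'] := nxt_spec n'.
  rewrite /next_idx (idx_ge 2 n') in k2; rewrite k3 in E.
  have [/andP[x0 xQ] /andP[y0 yQ] xy cop] := nbrP n.
  have xy2 : x + (2 * y - x) = 2 * y by lia.
  split; [|lia|lia|by congr pair; lia].
  rewrite y3 y0 (coprime_step xy2 cop) ?eqxx /= /reg_wedge ph andbT.
  apply/and3P; split; [lia|apply/eqP; rewrite /c' in y3 *; case: c12 x3 y3 => ->; lia|].
  apply/andP; split; [apply/and3P; split; lia|lia].
- case/and5P=> x0 y0 cop /eqP x3 /and3P[/eqP y3 /and3P[a1 a2 a3] /andP[a4 ph]].
  have xy2 : x + (2 * y - x) = 2 * y by lia.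
  have n : nbr Q (2 * y - x) y.
    by apply/and5P; split; [lia..|rewrite (coprime_step xy2 cop) andbT; lia].
  have z : (2 * y - x) + (y + x) = 3 * y by lia.
  have k3 : idx Q (2 * y - x) y = 3 by apply: idxE z _ _; lia.
  have nz : nxt Q (2 * y - x) y = y + x by apply: nxtE z _ _; lia.
  have n' := nxt_nbr n; rewrite nz in n'.
  split; [|lia|lia|by congr pair; lia].
  have -> : 2 * y - (2 * y - x) = x by lia.
  rewrite n k3 /next_idx nz (idx_ge 2 n') y3 ph !eqxx /= andbT.
  apply/andP; split; [apply/eqP; rewrite /c' in y3 *; case: c12 y3 => ->; lia|lia].
Qed.

End Counts.

(** * First returns by residue class *)

Lemma idx_eq4 Q x y : nbr Q x y -> 2 <= idx Q x y -> idx Q x y %% 3 = 1 ->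
  (next_idx Q x y != 1) = (idx Q x y == 4) && (next_idx Q x y == 2).
Proof.
move=> n k2 k1; have k'2 := idx_after_ge3 n; have k'5 := idx_after_ge5 n.
have [_ _ _ k'0] := nxt_spec (nxt_nbr n).
have k3 : 3 <= idx Q x y by case: (idx Q x y) k2 k1 => [|[|[|?]]].
have {k'2}k'2 := k'2 k3; rewrite -/(next_idx Q x y) in k'0 k'2 k'5.
case: (leqP 5 (idx Q x y)) => k5; first by rewrite k'5 //= andbF.
have k4 : idx Q x y = 4 by lia.
rewrite k4 eqxx /=; lia.
Qed.

Lemma exitE_ge1 k : 1 <= exitE k.
Proof. by rewrite /exitE; have := @ltn_pmod (k) 3 isT; case: (k %% 3) => [|[|[|?]]]. Qed.

Lemma descent_excl Q i j x y : nbr Q x y -> 0 < i -> 0 < j -> i != j ->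
  descent Q i x y && descent Q j x y = false.
Proof.
move=> n i0 j0 ij; apply/negP => /andP[ki kj].
by case/eqP: ij; apply: (descent_inj _ i0 j0 ki kj); case/nbrP: n => /andP[].
Qed.

Lemma descent_excl0 Q j x y : nbr Q x y -> 0 < j ->
  (2 <= idx Q x y) && descent Q j x y = false.
Proof.
move=> n j0; apply/negP => /andP[]; rewrite (idx_ge 2 n) => k2 /andP[kj _].
have : x <= (2 * j - 1) * x by rewrite leq_pmull //; lia.
lia.
Qed.

Lemma kite2_corner N d n : reg_kite 2 N d n && (3 * n <= N + d) = reg_corner N d n.
Proof.
rewrite /reg_kite /reg_corner; apply/idP/idP.
  by case/andP=> /and4P[? ? ? ?] ?; apply/and3P; split; lia.
by case/and3P=> ? ? ?; apply/andP; split; [apply/and4P; split|]; lia.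
Qed.

Section Totals.
Variables (Q c : nat).
Hypothesis c12 : c = 1 \/ c = 2.
Let c' := 3 - c.

(** One disjunct for index at least 2 and one each for descents of length 1, 2 and at least 3. A
    descent of length j >= 3 ends with index 3, which adds exactly one step, so that s = j + 1. *)
Lemma run_0c x y : nbr Q x y -> x %% 3 = 0 -> y %% 3 = c' -> forall s, 0 < s ->
  run Q c s x y =
  [|| (2 <= idx Q x y) && (s == exit0 (idx Q x y) (next_idx Q x y)),
      descent Q 1 x y && (s == 1 + exitE (next_idx Q x y)),
      descent Q 2 x y && (s == if 3 * (y - 2 * x) <= Q + x then 4 else 3)
    | [&& 3 < s & descent Q s.-1 x y]].
Proof.
move=> n x3 yc s s0; have x0 : 0 < x by case/nbrP: n => /andP[].
have i2 := idx_ge 2 n.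
case: (descent_cases Q y x0) => [[H K]|[j [j0 kj H K]]].
  rewrite i2 H (run_0c_idx_ge2 c12) ?i2 // -/(next_idx Q x y) (K 1) // (K 2) //= ?orbF.
  case: (ltnP 3 s) => s3 /=; last by rewrite orbF.
  by rewrite K ?orbF //; lia.
have := run_0c_descent c12 s n x3 yc j0 kj; rewrite /= => -[_ -> e4 e3].
rewrite i2 H /= (K 1) // (K 2) //.
case: j j0 kj K e4 e3 => [//|[|[|j]]] _ kj K e4 e3.
- have k1 : idx Q x y = 1 by have [_ _ _] := nxt_spec n; lia.
  have nz : nxt Q x y = y - x by rewrite /nxt k1 mul1n.
  rewrite subnn mul0n subn0 mul1n -nz -/(next_idx Q x y) /=.
  case: (ltnP 3 s) => s3 /=; last by rewrite orbF.
  by rewrite K; lia.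
- rewrite e4 //=; case: (ltnP 3 s) => s3 /=; last by rewrite orbF; case: ifP.
  by rewrite K; [case: ifP => _; rewrite /exitE /=|]; lia.
- rewrite e3 // /exitE /=.
  case: (ltnP 3 s) => s3 /=; last by lia.
  by rewrite K; lia.
Qed.

Lemma count_run1_0c : nbr_count Q 0 c' (run Q c 1) = reg_count Q 0 c' (reg_index 2 2).
Proof.
rewrite -nbr_count_index; apply: eq_nbr_count => x y n x3 yc; rewrite run_0c //.
have -> : (1 == 1 + exitE (next_idx Q x y)) = false by have := exitE_ge1 (next_idx Q x y); lia.
have -> : (1 == (if 3 * (y - 2 * x) <= Q + x then 4 else 3)) = false by case: ifP.
rewrite /exit0 !andbF !orbF; congr (_ && _); have := @ltn_pmod (idx Q x y) 3 isT.
by case: (idx Q x y %% 3) => [|[|[|?]]] //= _; case: ifP.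
Qed.

Lemma count_run2_0c : nbr_count Q 0 c' (run Q c 2) = reg_count Q 0 c' (reg_index 0 2) +
  nbr_count Q c c' (fun x y => [&& 3 <= idx Q x y, idx Q x y %% 3 == 0 & next_idx Q x y == 1]).
Proof.
rewrite -(@mirror Q c c12 0 c) //; last by case: c12 => ->.
rewrite -nbr_count_index; apply: nbr_countD => x y n x3 yc; rewrite run_0c // /exit0 /exitE.
have e1 := descent_excl0 n (isT : 0 < 1).
have := @ltn_pmod (idx Q x y) 3 isT; have := @ltn_pmod (next_idx Q x y) 3 isT.
have -> : (2 == (if 3 * (y - 2 * x) <= Q + x then 4 else 3)) = false by case: ifP.
move: e1; case: (1 < _); case: (descent Q 1 x y) => //= _;
case: (idx Q x y %% 3) => [|[|[|?]]] //=; case: (next_idx Q x y %% 3) => [|[|[|?]]] //= _ _;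
 rewrite ?andbF //; by case: ifP.
Qed.

(** Windows with an index 1 mod 3 followed by index 1, and their reversals, are equally many: each
    kind is the index region without the corner, where index 4 is followed by 2. The kite loses the
    part where the descent ends with index 4 and takes one step more. Terms are moved across so that
    no truncated subtraction occurs. *)
Lemma count_run3_0c : nbr_count Q 0 c' (run Q c 3) + 2 * reg_count Q 0 c' reg_corner +
    nbr_count Q 0 c' (fun x y => descent Q 2 x y && (3 * (y - 2 * x) <= Q + x)) =
  2 * reg_count Q 0 c' (reg_index 1 2) + reg_count Q 0 c' (reg_kite 2).
Proof.
have -> : nbr_count Q 0 c' (run Q c 3) =
    nbr_count Q 0 c' (fun x y => [&& 3 <= idx Q x y, idx Q x y %% 3 == 1 & next_idx Q x y == 1]) +
    nbr_count Q 0 c' (fun x y => descent Q 1 x y && (next_idx Q x y %% 3 == 1)) +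
    nbr_count Q 0 c' (fun x y => descent Q 2 x y && (Q + x < 3 * (y - 2 * x))).
  apply: nbr_countD3 => x y n x3 yc; rewrite run_0c // /exit0 /exitE.
  have e1 := descent_excl0 n (isT : 0 < 1); have e2 := descent_excl0 n (isT : 0 < 2).
  have e3 := @descent_excl Q 1 2 _ _ n isT isT isT.
  have := @ltn_pmod (idx Q x y) 3 isT; have := @ltn_pmod (next_idx Q x y) 3 isT.
  have -> : (3 == (if 3 * (y - 2 * x) <= Q + x then 4 else 3)) =
    (Q + x < 3 * (y - 2 * x)) by rewrite ltnNge; case: ifP.
  have -> : [&& 2 < idx Q x y, idx Q x y %% 3 == 1 & next_idx Q x y == 1] =
    [&& 1 < idx Q x y, idx Q x y %% 3 == 1 & next_idx Q x y == 1].
    by case: (idx Q x y) => [|[|[|?]]].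
  move: e1 e2 e3; case: (1 < _); case: (descent Q 1 x y); case: (descent Q 2 x y) => //= _ _ _;
  case: (idx Q x y %% 3) => [|[|[|?]]] //=; case: (next_idx Q x y %% 3) => [|[|[|?]]] //= _ _;
   rewrite ?andbF ?addn0 ?orbF //; by case: (next_idx _ _ _ == 1).
rewrite (@mirror Q c c12 1 0) -/c' //; last by rewrite /c'; case: c12 => ->.
have -> : reg_count Q 0 c' (reg_index 1 2) =
   nbr_count Q 0 c' (fun x y => [&& 3 <= idx Q x y, idx Q x y %% 3 == 1 & next_idx Q x y == 1]) +
   reg_count Q 0 c' reg_corner.
  rewrite -(corner_count Q c12) -nbr_count_index; apply: nbr_countD => x y n x3 yc.
  have K := idx_eq4 n; case: (ltnP 1 (idx Q x y)) => i1 /=; last first.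
    by case: (idx Q x y) i1 => [|[|?]].
  case: (idx Q x y %% 3 =P 1) => k1 /=.
    rewrite -K //; case: (next_idx _ _ _ == 1) => /=; rewrite ?andbF // andbT.
    by case: (idx Q x y) i1 k1 => [|[|[|?]]].
  by rewrite andbF; case: (idx Q x y =P 4) => // k4; rewrite k4 in k1.
have -> : reg_count Q 0 c' (reg_kite 2) =
   nbr_count Q 0 c' (fun x y => descent Q 2 x y && (Q + x < 3 * (y - 2 * x))) +
   nbr_count Q 0 c' (fun x y => descent Q 2 x y && (3 * (y - 2 * x) <= Q + x)).
  rewrite -[LHS](_ : nbr_count Q 0 c' (fun x y => descent Q 2 x y && true) = _).
    apply: nbr_countD => x y n x3 yc; rewrite ltnNge.
    by case: (descent _ _ _ _) => //; case: (_ <= _).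
  rewrite (descent_count Q c12 (fun _ _ => true)) //.
  by apply: eq_pair_count => x y _ _; rewrite andbT.
lia.
Qed.

(** Four sources: index 4 followed by 2; a descent of length 1 ending with an index 2 mod 3; one of
    length 2 ending with index 4; one of length 3, which ends with index 3. *)
Lemma count_run4_0c : nbr_count Q 0 c' (run Q c 4) = reg_count Q 0 c' reg_corner +
  reg_count Q c' c' (reg_index 2 5) +
  nbr_count Q 0 c' (fun x y => descent Q 2 x y && (3 * (y - 2 * x) <= Q + x)) +
  reg_count Q 0 c' (reg_kite 3).
Proof.
rewrite -nbr_count_index -(descent1_shift Q c12) -(corner_count Q c12).
rewrite -[X in _ = _ + X](_ : nbr_count Q 0 c' (fun x y => descent Q 3 x y && true) = _); last first.
  rewrite (descent_count Q c12 (fun _ _ => true)) //.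
  by apply: eq_pair_count => x y _ _; rewrite andbT.
apply: nbr_countD4 => x y n x3 yc; rewrite run_0c // /exit0 /exitE.
have e1 := descent_excl0 n (isT : 0 < 1); have e2 := descent_excl0 n (isT : 0 < 2).
have e4 := descent_excl0 n (isT : 0 < 3).
have e3 := @descent_excl Q 1 2 _ _ n isT isT isT.
have e5 := @descent_excl Q 1 3 _ _ n isT isT isT.
have e6 := @descent_excl Q 2 3 _ _ n isT isT isT.
have k4 := idx_eq4 n.
have := @ltn_pmod (idx Q x y) 3 isT; have := @ltn_pmod (next_idx Q x y) 3 isT.
have -> : (4 == (if 3 * (y - 2 * x) <= Q + x then 4 else 3)) =
  (3 * (y - 2 * x) <= Q + x) by case: ifP.
have E4 : (idx Q x y == 4) && (next_idx Q x y == 2) =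
  [&& 1 < idx Q x y, idx Q x y %% 3 == 1 & next_idx Q x y != 1].
  case: (ltnP 1 (idx Q x y)) => i1 /=; last by case: (idx Q x y) i1 => [|[|?]].
  case: (idx Q x y %% 3 =P 1) => i3 /=; first by rewrite k4.
  by case: (idx Q x y =P 4) => // i4; rewrite i4 in i3.
rewrite E4 {E4}.
move: e1 e2 e3 e4 e5 e6; case: (1 < _); case: (descent Q 1 x y); case: (descent Q 2 x y);
 case: (descent Q 3 x y) => //= _ _ _ _ _ _;
case: (idx Q x y %% 3) => [|[|[|?]]] //=; case: (next_idx Q x y %% 3) => [|[|[|?]]] //= _ _;
  rewrite ?andbF ?addn0 ?orbF //; by case: (next_idx _ _ _ == 1).
Qed.

Lemma count_run_ge5_0c s : 5 <= s -> nbr_count Q 0 c' (run Q c s) = reg_count Q 0 c' (reg_kite s.-1).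
Proof.
move=> s5; rewrite -[RHS](_ : nbr_count Q 0 c' (fun x y => descent Q s.-1 x y && true) = _).
  apply: eq_nbr_count => x y n x3 yc; rewrite run_0c //; last by lia.
  rewrite andbT /exit0 /exitE (_ : 3 < s = true); last by lia.
  have := @ltn_pmod (idx Q x y) 3 isT; have := @ltn_pmod (next_idx Q x y) 3 isT.
  have -> : (s == (if 3 * (y - 2 * x) <= Q + x then 4 else 3)) = false by case: ifP; lia.
  case: s s5 => [|[|[|[|[|s]]]]] // _.
  case: (idx Q x y %% 3) => [|[|[|?]]] //=; case: (next_idx Q x y %% 3) => [|[|[|?]]] //= _ _;
    rewrite ?andbF ?addn0 ?orbF //; by case: (next_idx _ _ _ == 1); rewrite /= ?andbF.
rewrite (descent_count Q c12 (fun _ _ => true)) //; last by lia.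
by apply: eq_pair_count => x y _ _; rewrite andbT.
Qed.

Lemma descent2_corner : nbr_count Q 0 c' (fun x y => descent Q 2 x y && (3 * (y - 2 * x) <= Q + x)) =
  reg_count Q 0 c' reg_corner.
Proof.
rewrite (descent_count Q c12 (fun d n => 3 * n <= Q + d)) //.
by apply: eq_pair_count => x y _ _; rewrite kite2_corner.
Qed.

(** The next denominator z has the class of -(k + 1) c. For k = 0 mod 3 this is -c; then either the
    next index is 1 and leads to 0, or k < 5, so that k = 3 and y, z begin an ascent of difference 2
    y - x. *)
Lemma run_cc' s x y : nbr Q x y -> x %% 3 = c -> y %% 3 = c' ->
  [/\ idx Q x y %% 3 = 1 -> run Q c s x y = (s == 1),
      idx Q x y %% 3 = 2 -> run Q c s x y = (s == 2),
      idx Q x y %% 3 = 0 -> next_idx Q x y = 1 -> run Q c s x y = (s == 3) &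
      idx Q x y %% 3 = 0 -> 2 <= next_idx Q x y -> idx Q x y = 3 /\
        forall i, y + i.+2 * (2 * y - x) <= Q < y + i.+3 * (2 * y - x) ->
        run Q c s x y = (s == i.+4)].
Proof.
move=> n xc yc; have zc := nxt_mod3 n; rewrite xc yc in zc.
have yn : (y %% 3 == c) = false by rewrite yc /c'; case: c12 => ->.
have n' := nxt_nbr n.
have zE : idx Q x y %% 3 = 0 -> nxt Q x y %% 3 = c'.
  by move=> k0; rewrite k0 in zc; move: zc; rewrite /c'; case: c12 => ->; lia.
split.
- move=> k1; rewrite run_step // run_stop ?pred_eqS //.
  by rewrite k1 in zc; move: zc; rewrite /c'; case: c12 => ->; lia.
- move=> k2; rewrite run_step // (run_to0 c12 _ n') ?pred_eqS //.
  by rewrite k2 in zc; move: zc; rewrite /c'; case: c12 => ->; lia.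
- move=> k0 k1; rewrite run_step // (run_c'c'_idx1 c12 _ n') ?zE ?pred_eqS //.
  by rewrite -/(next_idx Q x y) k1.
- move=> k0 k2; have k5 := idx_after_ge5 n.
  have [E zQ Qz kpos] := nxt_spec n.
  have k3 : idx Q x y = 3.
    rewrite -/(next_idx Q x y) in k5; move: (idx Q x y) k0 kpos k5 => k k0 kpos k5.
    by case: (ltnP k 5) => [|/k5]; lia.
  split=> // i; rewrite k3 in E; set d := 2 * y - x => H.
  have xyQ : Q < x + y by case/nbrP: n.
  have k2' : 2 * nxt Q x y <= Q + y by rewrite -(idx_ge 2 n').
  have Ed : nxt Q x y = y + d by rewrite /d; lia.
  have dc : d %% 3 = 0.
    by rewrite Ed in zc; have := zE k0; rewrite Ed /c' => ?; move: yc; rewrite /c'; lia.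
  rewrite run_step // Ed (@run_ascent _ _ _ i.+1) ?pred_eqS //.
  by rewrite -Ed.
Qed.

Lemma run_cc'_exit s x y : nbr Q x y -> x %% 3 = c -> y %% 3 = c' ->
  exists i, run Q c s x y = (s == nth i.+4 [:: if next_idx Q x y == 1 then 3 else i.+4; 1; 2] (idx Q x y %% 3)) /\
  (idx Q x y %% 3 = 0 -> 2 <= next_idx Q x y -> idx Q x y = 3 /\
    forall j, (y + j.+2 * (2 * y - x) <= Q < y + j.+3 * (2 * y - x)) = (j == i)).
Proof.
move=> n xc yc.
have [_ _ _ kpos'] := nxt_spec (nxt_nbr n).
have [H1 H2 H3 H4] := run_cc' s n xc yc; have := @ltn_pmod (idx Q x y) 3 isT.
case k : (idx Q x y %% 3) H1 H2 H3 H4 => [|[|[|?]]] //= H1 H2 H3 H4 _.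
- case: (next_idx Q x y =P 1) => k'; first by exists 0; rewrite H3 // k'.
  have k'2 : 2 <= next_idx Q x y by rewrite /next_idx in k' *; lia.
  have [k3 H] := H4 erefl k'2.
  have n' := nxt_nbr n; have [E zQ Qz _] := nxt_spec n.
  rewrite /next_idx (idx_ge 2 n') in k'2; rewrite k3 in E.
  set d := 2 * y - x in H *; have xyQ : x <= Q < x + y by case/nbrP: n => /andP[_ ->].
  have d0 : 0 < d by rewrite /d; lia.
  have l2 : 2 * d <= Q - y by rewrite /d; lia.
  have yQ : y <= Q by case/nbrP: n => _ /andP[].
  (* The number of steps d that fit between y and Q; at least two because the next index is at least
     2. *)
  pose m := (Q - y) %/ d.
  have m2 : 2 <= m by rewrite leq_divRL.
  have E' := divn_eq (Q - y) d; have lt' := @ltn_pmod (Q - y) d d0; rewrite -/m in E'.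
  have m2' : m.-2.+2 = m by lia.
  exists m.-2; have Hm : y + m.-2.+2 * d <= Q < y + m.-2.+3 * d.
    by rewrite m2' mulSn; apply/andP; split; lia.
  split; first exact: H.
  split=> // j; apply/idP/eqP => [/andP[j1 j2]|->//].
  case/andP: Hm => m3 m4.
  have a1 : j.+2 * d < m.-2.+3 * d by lia.
  have a2 : m.-2.+2 * d < j.+3 * d by lia.
  by rewrite !ltn_mul2r d0 /= in a1 a2; lia.
- by exists 0; rewrite H1.
- by exists 0; rewrite H2.
Qed.

Lemma count_run1_cc' : nbr_count Q c c' (run Q c 1) + reg_count Q c c' (reg_index 0 2) +
  reg_count Q c c' (reg_index 2 2) = reg_count Q c c' reg_triangle.
Proof.
rewrite -nbr_count_triangle -!nbr_count_index; apply/esym/nbr_countD3 => x y n xc yc.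
have [_ _ _ kpos] := nxt_spec n.
have [i [-> _]] := run_cc'_exit 1 n xc yc; have := @ltn_pmod (idx Q x y) 3 isT.
have : (2 <= idx Q x y) || (idx Q x y %% 3 == 1).
  by case: (idx Q x y) kpos => [|[|?]].
case: (idx Q x y %% 3) => [|[|[|?]]] //=; rewrite ?orbF => k _; rewrite ?k ?andbF //.
by case: ifP.
Qed.

Lemma count_run2_cc' : nbr_count Q c c' (run Q c 2) = reg_count Q c c' (reg_index 2 2).
Proof.
rewrite -!nbr_count_index; apply: eq_nbr_count => x y n xc yc.
have [_ _ _ kpos] := nxt_spec n.
have [i [-> _]] := run_cc'_exit 2 n xc yc; have := @ltn_pmod (idx Q x y) 3 isT.
have : (2 <= idx Q x y) || (idx Q x y %% 3 == 1).
  by case: (idx Q x y) kpos => [|[|?]].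
case: (idx Q x y %% 3) => [|[|[|?]]] //=; rewrite ?orbF => k _; rewrite ?k ?andbF //.
by case: ifP.
Qed.

Lemma count_run3_cc'E : nbr_count Q c c' (run Q c 3) =
  nbr_count Q c c' (fun x y => [&& 3 <= idx Q x y, idx Q x y %% 3 == 0 & next_idx Q x y == 1]).
Proof.
apply: eq_nbr_count => x y n xc yc.
have [_ _ _ kpos] := nxt_spec n.
have [i [-> _]] := run_cc'_exit 3 n xc yc; have := @ltn_pmod (idx Q x y) 3 isT.
have : (3 <= idx Q x y) || (idx Q x y %% 3 != 0).
  by case: (idx Q x y) kpos => [|[|[|?]]].
case: (idx Q x y %% 3) => [|[|[|?]]] //=; rewrite ?orbF => k _; rewrite ?k ?andbF //.
by case: ifP.
Qed.

(** Among the pairs of index 0 mod 3, those not followed by index 1 begin an ascent. They fill the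
    wedge outside the corner, the corner being the part of the wedge with 3 n <= Q + d. *)
Lemma count_run3_cc' : nbr_count Q c c' (run Q c 3) + reg_count Q 0 c' reg_wedge =
  reg_count Q c c' (reg_index 0 2) + reg_count Q 0 c' reg_corner.
Proof.
have -> : reg_count Q 0 c' reg_wedge =
    nbr_count Q c c' (fun x y => [&& idx Q x y == 3, 2 <= next_idx Q x y & true]) +
    reg_count Q 0 c' reg_corner.
  rewrite (wedge_count Q c12 (fun _ _ => true)); apply: pair_countD => x y _ _.
  have -> : reg_corner Q x y = reg_wedge Q x y && ~~ (Q + x < 3 * y).
    rewrite /reg_corner /reg_wedge; apply/and3P/andP; first by case=> *; split; [apply/and3P; split|]; lia.
    by case=> /and3P[*]; split; lia.
  by rewrite andbT; case: (reg_wedge _ _ _) => /=; rewrite ?andbF //; case: (Q + x < _);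
    rewrite /= ?andbF ?andbT ?addn0.
rewrite addnA; congr (_ + _); rewrite count_run3_cc'E -nbr_count_index; apply/esym/nbr_countD => x y n xc yc.
have [_ _ _ kpos] := nxt_spec n; have [_ _ _ kpos'] := nxt_spec (nxt_nbr n).
have [i [_ H]] := run_cc'_exit 3 n xc yc.
case: (idx Q x y %% 3 =P 0) => k0; last first.
  by rewrite !andbF; case: (idx Q x y =P 3) => // k3; rewrite k3 in k0.
have -> : 1 < idx Q x y by case: (idx Q x y) kpos k0 => [|[|?]].
have -> : 2 < idx Q x y by case: (idx Q x y) kpos k0 => [|[|[|?]]].
rewrite /= andbT; case: (ltnP 1 (next_idx Q x y)) => k'.
  by have [-> _] := H k0 k'; rewrite eqxx; case: (next_idx Q x y) k' => [|[|?]].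
by rewrite andbF; rewrite /next_idx in k' *; have -> : idx Q y (nxt Q x y) = 1 by lia.
Qed.

(** Fixing the length of the ascent cuts the wedge down to a kite. For i > 0 the kite lies in n > 2
    d, whence Q + d < 3 n holds automatically; for i = 0 that inequality removes the corner. *)
Lemma count_run_ge4_cc' i : nbr_count Q c c' (run Q c i.+4) + (i == 0) * reg_count Q 0 c' reg_corner =
  reg_count Q 0 c' (reg_kite i.+2).
Proof.
rewrite (_ : nbr_count Q c c' (run Q c i.+4) = nbr_count Q c c' (fun x y =>
   [&& idx Q x y == 3, 2 <= next_idx Q x y &
     y + i.+2 * (2 * y - x) <= Q < y + i.+3 * (2 * y - x)])).
  rewrite (wedge_count Q c12 (fun d n => n + i.+2 * d <= Q < n + i.+3 * d)).
  case: i => [|i].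
    rewrite mul1n; apply/esym/pair_countD => x y _ _.
    have -> : [&& reg_wedge Q x y, Q + x < 3 * y & y + 2 * x <= Q < y + 3 * x] =
        reg_kite 2 Q x y && ~~ reg_corner Q x y.
      rewrite -kite2_corner /reg_kite /reg_wedge; apply/idP/idP.
        case/and3P=> /and3P[? ? ?] ? /andP[? ?].
        by apply/andP; split; [apply/and4P; split|rewrite negb_and -!ltnNge; apply/orP; right]; lia.
      by case/andP=> /and4P[h1 h2 h3 h4]; rewrite h1 h2 h3 h4 /= -ltnNge => ->.
    rewrite -kite2_corner; case: (0 < x) => //; case: (0 < y) => //.
    case: (coprime x y) => //; case: (x %% 3 == 0) => //; case: (y %% 3 == c') => //.
    by case: (reg_kite 2 Q x y) => //; case: (3 * y <= Q + x).
  rewrite mul0n addn0; apply: eq_pair_count => x y _ _.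
  case: (ltnP 0 x) => //= x0; do 4 congr (_ && _); rewrite /reg_wedge /reg_kite.
  have : 3 * x <= i.+3 * x by rewrite leq_mul2r orbT.
  rewrite !mulSn; set t := i * x => l; apply/idP/idP.
    by case/and3P=> /and3P[? ? ?] ? /andP[? ?]; apply/and4P; split; lia.
  by case/and4P=> *; apply/and3P; split; [apply/and3P; split|..]; lia.
apply: eq_nbr_count => x y n xc yc.
have [_ _ _ kpos] := nxt_spec n; have [_ _ _ kpos'] := nxt_spec (nxt_nbr n).
have [j [-> H]] := run_cc'_exit i.+4 n xc yc; have := @ltn_pmod (idx Q x y) 3 isT.
case k : (idx Q x y %% 3) H => [|[|[|?]]] //= H _.
- case: (next_idx Q x y =P 1) => k'; first by rewrite k' andbF.
  have k'2 : 2 <= next_idx Q x y by rewrite /next_idx in k' *; lia.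
  by have [-> H'] := H erefl k'2; rewrite eqxx k'2 H' !eqSS.
- by case: (idx Q x y =P 3) => // k3; rewrite k3 in k.
- by case: (idx Q x y =P 3) => // k3; rewrite k3 in k.
Qed.

Definition window_count r := pair_count Q (fun x y => [&& nbr Q x y, x %% 3 == c & run Q c r x y]).

Lemma window_count_r0 : window_count 0 = reg_count Q c c reg_triangle.
Proof. by rewrite -nbr_count_triangle; apply: eq_pair_count => x y _ _ /=; rewrite andbT. Qed.

(** If the second denominator has class 0, the third has class -c whatever the index is; dropping
    the first then gives a pair of classes (0, -c) with one step less to go. *)
Lemma window_countS r : window_count r.+1 = nbr_count Q 0 c' (run Q c r) + nbr_count Q c c' (run Q c r.+1).
Proof.
have -> : window_count r.+1 = nbr_count Q c 0 (run Q c r.+1) + nbr_count Q c c' (run Q c r.+1).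
  apply: pair_countD => x y _ _; case: (nbr Q x y) => //=; case: (x %% 3 == c) => //=.
  have := @ltn_pmod y 3 isT; rewrite /c'; case: c12 => ->;
  by case: (y %% 3) => [|[|[|?]]] //= _; rewrite addn0.
congr (_ + _).
apply: (@pair_count_bij _ _ _ _ (fun x y => (y, nxt Q x y)) (fun y z => (nxt Q z y, y))
  (fun y z => (nxt Q z y, y)) (fun x y => (y, nxt Q x y))) => x y /=;
    case/and4P=> n /eqP x3 /eqP y3.
- case/andP=> _ rn'; have n' := nxt_nbr n; have [rn rk rz] := nxt_rev n.
  have := nxt_mod3 n; rewrite x3 y3 => yz.
  split; [|by case/nbrP: n => ? /andP[]|by case/nbrP: n' => _ /andP[]|by rewrite rz].
  by rewrite n' rn' /= andbT; apply/eqP; rewrite /c'; case: c12 yz => ->; lia.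
- move=> rn'; have ns : nbr Q y x by rewrite nbr_sym.
  have [sn sk sz] := nxt_rev ns.
  have := nxt_mod3 ns; rewrite x3 y3 => yz.
  split; [|by case/nbrP: sn => /andP[]|by case/nbrP: n => /andP[]|by rewrite sz].
  rewrite sn sz rn' /= andbT; rewrite /c' in yz; case: c12 yz => ->; lia.
Qed.

(** The windows c, -c, c are the pairs of index 1 mod 3. The complement is used because index 1
    itself is among them. *)
Lemma window_count_r1 : window_count 1 + reg_count Q c c' (reg_index 0 2) + reg_count Q c c' (reg_index 2 2) =
  reg_count Q c c' reg_triangle.
Proof.
rewrite -count_run1_cc' window_countS (_ : nbr_count Q 0 c' _ = 0) //; apply: pair_count0 => x y /=.
case: (y %% 3 =P c') => [->|]; last by rewrite !andbF.
by rewrite /c'; case: c12 => ->; rewrite !andbF.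
Qed.

Lemma window_count_r2 : window_count 2 = reg_count Q 0 c' (reg_index 2 2) + reg_count Q c c' (reg_index 2 2).
Proof. by rewrite window_countS count_run1_0c count_run2_cc'. Qed.

Lemma window_count_r3 : window_count 3 + 2 * reg_count Q 0 c' reg_wedge =
  reg_count Q 0 c' (reg_index 0 2) + 2 * reg_count Q c c' (reg_index 0 2) + 2 * reg_count Q 0 c' reg_corner.
Proof.
rewrite window_countS count_run2_0c -count_run3_cc'E; have := count_run3_cc'; lia.
Qed.

Lemma window_count_r4 : window_count 4 + 4 * reg_count Q 0 c' reg_corner =
  2 * reg_count Q 0 c' (reg_kite 2) + 2 * reg_count Q 0 c' (reg_index 1 2).
Proof.
rewrite window_countS; have := count_run3_0c; have := count_run_ge4_cc' 0; rewrite descent2_corner; lia.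
Qed.

Lemma window_count_r5 : window_count 5 = 2 * reg_count Q 0 c' (reg_kite 3) + reg_count Q c' c' (reg_index 2 5) +
  2 * reg_count Q 0 c' reg_corner.
Proof.
rewrite window_countS count_run4_0c descent2_corner; have := count_run_ge4_cc' 1; lia.
Qed.

(** A long window either descends right after the denominator d or ascends until it meets d. The two
    kinds are reversals of each other and fill the same kite. *)
Lemma window_count_ge6 r : 6 <= r -> window_count r = 2 * reg_count Q 0 c' (reg_kite (r - 2)).
Proof.
case: r => [|[|[|[|[|[|r]]]]]] // _.
rewrite window_countS count_run_ge5_0c //; have := count_run_ge4_cc' r.+2; rewrite mul0n addn0 => ->.
by rewrite subn2 /= addnn mul2n.
Qed.

End Totals.

(** * Lattice points of the regions *)

Lemma sum_mod3_run s u n : u < 3 ->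
  let g := \sum_(i < n) ((s + i) %% 3 == u : nat) in n <= 3 * g + 2 /\ 3 * g <= n + 2.
Proof.
move=> u3 /=; have [k ->] : exists k, n = 3 * k + n %% 3.
  by exists (n %/ 3); rewrite mulnC -divn_eq.
have : n %% 3 < 3 by rewrite ltn_mod.
move: (n %% 3) => m m3; elim: k s => [|k IH] s.
  case: m m3 => [|[|[|//]]] _; rewrite ?big_ord0 ?big_ord_recr ?big_ord0 /=; lia.
have -> : 3 * k.+1 + m = (3 * k + m).+3 by lia.
rewrite !big_ord_recl /= !addn0.
have -> : \sum_(i < 3 * k + m) ((s + bump 0 (bump 0 (bump 0 i))) %% 3 == u : nat) =
          \sum_(i < 3 * k + m) ((s + 3 + i) %% 3 == u : nat).
  by apply: eq_bigr => i _; congr (nat_of_bool (_ %% 3 == u)); rewrite /bump /=; lia.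
by have := IH (s + 3); rewrite /bump /=; lia.
Qed.

Lemma slice_bound N u l h (P : nat -> bool) : u < 3 -> h <= N ->
  (forall x, 0 < x <= N -> P x = (l < x <= h)) ->
  let g := \sum_(x < N.+1) ([&& 0 < x, x %% 3 == u & P x] : nat) in
  h - l <= 3 * g + 2 /\ 3 * g <= h - l + 2.
Proof.
move=> u3 hN HP /=.
have -> : \sum_(x < N.+1) ([&& 0 < x, x %% 3 == u & P x] : nat) =
          \sum_(i < h - l) ((l.+1 + i) %% 3 == u : nat).
  rewrite -(big_mkord xpredT (fun x => ([&& 0 < x, x %% 3 == u & P x] : nat))).
  case: (leqP h l) => hl.
    have -> : h - l = 0 by lia.
    rewrite big_ord0 big_nat big1 // => x xN; case: (posnP x) => //= x0.
    rewrite HP; last by lia.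
    by rewrite (_ : l < x <= h = false) ?andbF //; lia.
  rewrite (@big_cat_nat _ _ _ l.+1) //=; [|lia].
  rewrite [X in X + _]big_nat [X in X + _]big1 ?add0n; last first.
    move=> x xl; case: (posnP x) => //= x0; rewrite HP; last by lia.
    by rewrite (_ : l < x <= h = false) ?andbF //; lia.
  rewrite (@big_cat_nat _ _ _ h.+1) //=; [|lia].
  rewrite [X in _ + X]big_nat [X in _ + X]big1 ?addn0; last first.
    move=> x xl; case: (posnP x) => //= x0; rewrite HP; last by lia.
    by rewrite (_ : l < x <= h = false) ?andbF //; lia.
  rewrite -{1}(add0n l.+1) big_addn subSS big_mkord; apply: eq_bigr => i _.
  have il := ltn_ord i.
  have h1 : 0 < i + l.+1 <= N by apply/andP; split; lia.
  have h2 : l < i + l.+1 <= h by apply/andP; split; lia.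
  by rewrite HP // h2 andbT [l.+1 + i]addnC; case/andP: h1 => ->.
exact: sum_mod3_run.
Qed.

Definition lattice_count N u v (H : nat -> nat -> nat -> bool) :=
  pair_count N (fun x y => [&& 0 < x, 0 < y, x %% 3 == u, y %% 3 == v & H N x y]).

Definition sum3 N v (f : nat -> nat) :=
  \sum_(y < N.+1) (if (0 < y) && (y %% 3 == v) then f y else 0).

Lemma lattice_slice2 N u v H : lattice_count N u v H =
  sum3 N v (fun y => \sum_(x < N.+1) ([&& 0 < x, x %% 3 == u & H N x y] : nat)).
Proof.
rewrite /lattice_count /pair_count -(pair_bigA _ (fun x y : 'I_N.+1 =>
  ([&& 0 < x, 0 < y, x %% 3 == u, y %% 3 == v & H N x y] : nat))) /= exchange_big.
apply: eq_bigr => y _ /=; case: ifP => [/andP[-> ->]|E] //=.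
by rewrite big1 // => x _; move: E; case: (0 < x); case: (0 < y); case: (_ == v) => //=; rewrite ?andbF.
Qed.

Lemma lattice_slice1 N u v H : lattice_count N u v H =
  sum3 N u (fun x => \sum_(y < N.+1) ([&& 0 < y, y %% 3 == v & H N x y] : nat)).
Proof.
rewrite /lattice_count /pair_count -(pair_bigA _ (fun x y : 'I_N.+1 =>
  ([&& 0 < x, 0 < y, x %% 3 == u, y %% 3 == v & H N x y] : nat))) /=.
apply: eq_bigr => x _ /=; case: ifP => [/andP[-> ->]|E] //=.
by rewrite big1 // => y _; move: E; case: (0 < x); case: (0 < y); case: (_ == u) => //=; rewrite ?andbF.
Qed.

Lemma sum3_le N v f g : (forall y, 0 < y <= N -> y %% 3 = v -> f y <= g y) -> sum3 N v f <= sum3 N v g.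
Proof.
move=> H; apply: leq_sum => y _; case: ifP => // /andP[y0 /eqP yv].
by apply: H => //; rewrite y0 -ltnS ltn_ord.
Qed.

Lemma sum3D N v f g : sum3 N v (fun y => f y + g y) = sum3 N v f + sum3 N v g.
Proof. by rewrite /sum3 -big_split; apply: eq_bigr => y _ /=; case: ifP. Qed.

Lemma sum3M N v k f : sum3 N v (fun y => k * f y) = k * sum3 N v f.
Proof.
by rewrite /sum3 big_distrr; apply: eq_bigr => y _ /=; case: ifP; rewrite ?muln0.
Qed.

Lemma sum3_const N v k : sum3 N v (fun _ => k) <= k * N.
Proof.
rewrite /sum3 big_ord_recl /= add0n.
have -> : k * N = \sum_(i < N) k by rewrite sum_nat_const card_ord mulnC.
by apply: leq_sum => i _; case: ifP.
Qed.

(* Truncated subtraction: the summand is the positive part of B - c y. *)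
Definition ramp_count N v B c := sum3 N v (fun y => B - c * y).

Section Regions.
Variables (N u v : nat).
Hypotheses (u3 : u < 3) (v3 : v < 3).

Lemma lattice_triangle : 3 * lattice_count N u v reg_triangle <= sum3 N v (fun y => y) + 2 * N /\
  sum3 N v (fun y => y) <= 3 * lattice_count N u v reg_triangle + 2 * N.
Proof.
rewrite lattice_slice2 -sum3M; split.
- apply: leq_trans (_ : sum3 N v (fun y => y + 2) <= _); last first.
    by rewrite sum3D leq_add2l sum3_const.
  apply: sum3_le => y y0 _; have [|||_] := @slice_bound N u (N - y) N (fun x => reg_triangle N x y) => //.
  + by move=> x x0; rewrite /reg_triangle; lia.
  + by lia.
- apply: leq_trans (_ : sum3 N v (fun y => 3 * (\sum_(x < N.+1) ([&& 0 < x, x %% 3 == u & reg_triangle N x y] : nat)) + 2) <= _); last first.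
    by rewrite sum3D leq_add2l sum3_const.
  apply: sum3_le => y y0 _; have [||| h _] := @slice_bound N u (N - y) N (fun x => reg_triangle N x y) => //.
  + by move=> x x0; rewrite /reg_triangle; lia.
  + by lia.
Qed.

(** For fixed d, n ranges from max(N - (j + 1) d, (N - d) / 2) to min(N - j d, (N + d) / 2). Twice
    that length is the second difference of the positive parts of N - (2 j - 1) d, N - (2 j + 1) d
    and N - (2 j + 3) d. The factor 6 combines this 2 with the density 1/3; 7 per slice absorbs the
    rounding. *)
Lemma lattice_kite j : 0 < j ->
  6 * lattice_count N u v (reg_kite j) + 2 * ramp_count N u N (2 * j + 1) <=
    ramp_count N u N (2 * j - 1) + ramp_count N u N (2 * j + 3) + 7 * N /\
  ramp_count N u N (2 * j - 1) + ramp_count N u N (2 * j + 3) <=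
  6 * lattice_count N u v (reg_kite j) + 2 * ramp_count N u N (2 * j + 1) + 7 * N.
Proof.
move=> j0; rewrite lattice_slice1 -!sum3M -!sum3D.
have key d : 0 < d <= N -> let g := \sum_(n < N.+1) ([&& 0 < n, n %% 3 == v & reg_kite j N d n] : nat) in
   6 * g + 2 * (N - (2 * j + 1) * d) <= N - (2 * j - 1) * d + (N - (2 * j + 3) * d) + 7 /\
   N - (2 * j - 1) * d + (N - (2 * j + 3) * d) <= 6 * g + 2 * (N - (2 * j + 1) * d) + 7.
  move=> /andP[d0 dN] /=.
  have E1 : (2 * j - 1) * d + d = 2 * (j * d) by nia.
  have E2 : (2 * j + 1) * d = 2 * (j * d) + d by nia.
  have E3 : (2 * j + 3) * d = 2 * (j * d) + 3 * d by nia.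
  have E4 : d <= j * d by rewrite leq_pmull.
  have [||] := @slice_bound N v (maxn (N - j.+1 * d) ((N - d) %/ 2))
     (minn (N - j * d) ((N + d) %/ 2)) (fun n => reg_kite j N d n) v3.
  - by lia.
  - move=> n n0; rewrite /reg_kite mulSn; lia.
  - rewrite mulSn; set g := \sum_(_ < _) _.
    move: g ((2 * j - 1) * d) ((2 * j + 1) * d) ((2 * j + 3) * d) (j * d) E1 E2 E3 E4.
    clear -d0 dN => g A B C t E1 E2 E3 E4 h1 h2; lia.
split.
- apply: leq_trans (_ : sum3 N u (fun d => N - (2 * j - 1) * d + (N - (2 * j + 3) * d) + 7) <= _).
    by apply: sum3_le => d dN _; have [] := key d dN.
  by rewrite sum3D leq_add2l sum3_const.
- apply: leq_trans (_ : sum3 N u (fun d => 6 * \sum_(n < N.+1) ([&& 0 < n, n %% 3 == v & reg_kite j N d n] : nat) + 2 * (N - (2 * j + 1) * d) + 7) <= _).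
    by apply: sum3_le => d dN _; have [] := key d dN.
  by rewrite sum3D leq_add2l sum3_const.
Qed.

Lemma lattice_wedge :
  6 * lattice_count N u v reg_wedge + ramp_count N u N 5 <= ramp_count N u N 3 + 7 * N /\
  ramp_count N u N 3 <= 6 * lattice_count N u v reg_wedge + ramp_count N u N 5 + 7 * N.
Proof.
rewrite lattice_slice1 -!sum3M -!sum3D.
have key d : 0 < d <= N -> let g := \sum_(n < N.+1) ([&& 0 < n, n %% 3 == v & reg_wedge N d n] : nat) in
   6 * g + (N - 5 * d) <= N - 3 * d + 7 /\
   N - 3 * d <= 6 * g + (N - 5 * d) + 7.
  move=> /andP[d0 dN] /=.
  have [||] := @slice_bound N v ((N - d) %/ 2)
     (minn (N - 2 * d) ((N + d) %/ 2)) (fun n => reg_wedge N d n) v3.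
  - by lia.
  - move=> n n0; rewrite /reg_wedge; lia.
  - set g := \sum_(_ < _) _; move: g; clear -d0 dN => g; lia.
split.
- apply: leq_trans (_ : sum3 N u (fun d => N - 3 * d + 7) <= _).
    by apply: sum3_le => d dN _; have [] := key d dN.
  by rewrite sum3D leq_add2l sum3_const.
- apply: leq_trans (_ : sum3 N u (fun d => 6 * \sum_(n < N.+1) ([&& 0 < n, n %% 3 == v & reg_wedge N d n] : nat) + (N - 5 * d) + 7) <= _).
    by apply: sum3_le => d dN _; have [] := key d dN.
  by rewrite sum3D leq_add2l sum3_const.
Qed.

(** Six times the slice length is a combination of ramps that break where two of the sides n = N - 2
    d, n = (N - d) / 2, n = (N + d) / 3 meet, that is, at 3 d = N, 5 d = N and 7 d = 2 N. *)
Lemma lattice_corner :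
  18 * lattice_count N u v reg_corner + 2 * ramp_count N u (2 * N) 7 <= 3 * ramp_count N u N 3 + ramp_count N u N 5 + 30 * N /\
  3 * ramp_count N u N 3 + ramp_count N u N 5 <= 18 * lattice_count N u v reg_corner + 2 * ramp_count N u (2 * N) 7 + 30 * N.
Proof.
rewrite lattice_slice1 -!sum3M -!sum3D.
have key d : 0 < d <= N -> let g := \sum_(n < N.+1) ([&& 0 < n, n %% 3 == v & reg_corner N d n] : nat) in
   18 * g + 2 * (2 * N - 7 * d) <= 3 * (N - 3 * d) + (N - 5 * d) + 30 /\
   3 * (N - 3 * d) + (N - 5 * d) <= 18 * g + 2 * (2 * N - 7 * d) + 30.
  move=> /andP[d0 dN] /=.
  have [||] := @slice_bound N v ((N - d) %/ 2)
     (minn (N - 2 * d) ((N + d) %/ 3)) (fun n => reg_corner N d n) v3.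
  - by lia.
  - move=> n n0; rewrite /reg_corner; lia.
  - set g := \sum_(_ < _) _; move: g; clear -d0 dN => g; lia.
split.
- apply: leq_trans (_ : sum3 N u (fun d => 3 * (N - 3 * d) + (N - 5 * d) + 30) <= _).
    by apply: sum3_le => d dN _; have [] := key d dN.
  by rewrite sum3D leq_add2l sum3_const.
- apply: leq_trans (_ : sum3 N u (fun d => 18 * \sum_(n < N.+1) ([&& 0 < n, n %% 3 == v & reg_corner N d n] : nat) + 2 * (2 * N - 7 * d) + 30) <= _).
    by apply: sum3_le => d dN _; have [] := key d dN.
  by rewrite sum3D leq_add2l sum3_const.
Qed.

End Regions.

(** Up to one unit, the length of the slice at height y of the region of index k. Truncated
    subtraction makes it vanish unless y lies between 2 N / (k + 2) and 2 N / k. *)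
Definition tent N k y := minn ((k + 2) * y - 2 * N) (2 * N - k * y).

Lemma tent_diff2 N k y :
  tent N k y + 2 * (2 * N - (k + 1) * y) = 2 * N - k * y + (2 * N - (k + 2) * y).
Proof.
rewrite /tent !mulnDl mul1n; move: (k * y) => t; lia.
Qed.

Definition tentsum N v k := sum3 N v (tent N k).

Lemma tentsum_ramp N v k : tentsum N v k + 2 * ramp_count N v (2 * N) (k + 1) =
  ramp_count N v (2 * N) k + ramp_count N v (2 * N) (k + 2).
Proof.
rewrite /tentsum /ramp_count -sum3M -!sum3D; apply: eq_bigr => y _.
by case: ifP => // _; rewrite tent_diff2.
Qed.

Definition near_idx N y k : bool := (2 * N < (k + 2) * y) && (k * y <= 2 * N).

(** Only the quotient M of 2 N by y and M - 1 can be near. This keeps the rounding errors of all k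
    together at O(1) for each y. *)
Lemma sum_near_idx N y n : 0 < y -> \sum_(k < n) (near_idx N y k : nat) <= 2.
Proof.
move=> y0; have one M : \sum_(k < n) ((k : nat) == M : nat) <= 1.
  case: (ltnP M n) => Mn; last first.
    rewrite big1 // => i _; case: eqP => // e; have := ltn_ord i; lia.
  rewrite (bigD1 (Ordinal Mn)) //= eqxx big1 ?addn0 // => i ne.
  by case: eqP => // e; case/eqP: ne; apply: val_inj.
pose M := (2 * N) %/ y.
have onep : \sum_(k < n) ((k : nat).+1 == M : nat) <= 1.
  case: M => [|M]; last exact: (one M).
  by rewrite big1.
apply: (@leq_trans (\sum_(k < n) (((k : nat) == M) + ((k : nat).+1 == M)))); last first.
  by rewrite big_split /= -[2]/(1 + 1) leq_add.
apply: leq_sum => k _; rewrite /near_idx.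
case: andP => // -[h1 h2].
have a1 : k <= M by rewrite leq_divRL.
have a2 : M < k + 2 by rewrite ltn_divLR.
lia.
Qed.

Lemma tent_le N k y : tent N k y <= near_idx N y k * y.
Proof.
rewrite /near_idx /tent !mulnDl; move: (k * y) => t.
by case: andP => h; lia.
Qed.

Lemma HK_split a m N x y : 0 < x <= N -> 0 < y -> (reg_index a m N x y : nat) =
  \sum_(k < 2 * N + 1 | (m <= k) && (k %% 3 == a))
    ([&& reg_triangle N x y, k * y <= N + x & N + x < k.+1 * y] : nat).
Proof.
move=> xN y0; pose q := (N + x) %/ y.
have qN : q < 2 * N + 1.
  have : 2 * N + 1 <= (2 * N + 1) * y by exact: leq_pmulr.
  rewrite /q ltn_divLR //; lia.
have qE k : (k * y <= N + x) && (N + x < k.+1 * y) = (k == q).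
  by rewrite -leq_divRL // -ltn_divLR // eqn_leq.
rewrite /reg_index -leq_divRL // -/q; case: (reg_triangle N x y) => /=; last by rewrite big1.
case H : ((m <= q) && (q %% 3 == a)).
  rewrite (bigD1 (Ordinal qN)) //= qE eqxx big1 // => k /andP[_ ne].
  by rewrite qE; case: eqP => // e; case/eqP: ne; apply: val_inj.
rewrite big1 // => k H'; rewrite qE; case: eqP => // e.
by rewrite -e H' in H.
Qed.

(** Where [near_idx] fails, slice and tent are both empty, so the error can be charged to [near_idx]
    instead of being a constant for every k. *)
Lemma slice_tent N u k y : u < 3 -> 0 < k -> 0 < y <= N ->
  let g := \sum_(x < N.+1) ([&& 0 < x, x %% 3 == u &
              [&& reg_triangle N x y, k * y <= N + x & N + x < k.+1 * y]] : nat) in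
  3 * g <= tent N k y + 4 * near_idx N y k /\ tent N k y <= 3 * g + 4 * near_idx N y k.
Proof.
move=> u3 k0 yN /=.
case nr : (near_idx N y k); last first.
  have : tent N k y = 0 by apply/eqP; rewrite -leqn0; have := tent_le N k y; rewrite nr.
  move=> ->; rewrite big1 // => x _; apply/eqP; rewrite eqb0; apply/negP => /and3P[x0 _ /and3P[ht k1 k2]].
  move: nr; rewrite /near_idx; move: ht k1 k2; rewrite /reg_triangle mulSn !mulnDl; move: (k * y) => t; lia.
have [||] := @slice_bound N u (maxn (N - y) (k * y - N - 1)) (minn N (k.+1 * y - N - 1))
   (fun x => [&& reg_triangle N x y, k * y <= N + x & N + x < k.+1 * y]) u3.
- lia.
- move=> x x0; rewrite /reg_triangle mulSn; move: (k * y) => t; lia.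
- set g := \sum_(_ < _) _; rewrite /tent mulSn mulnDl; move: g (k * y).
  by clear -yN => g t; lia.
Qed.

Lemma lattice_index N u v a m : u < 3 -> 0 < m ->
  let T := \sum_(k < 2 * N + 1 | (m <= k) && (k %% 3 == a)) tentsum N v k in
  3 * lattice_count N u v (reg_index a m) <= T + 8 * N /\ T <= 3 * lattice_count N u v (reg_index a m) + 8 * N.
Proof.
move=> u3 m0 /=; rewrite lattice_slice2 -!sum3M.
pose g y k := \sum_(x < N.+1) ([&& 0 < x, x %% 3 == u &
              [&& reg_triangle N x y, k * y <= N + x & N + x < k.+1 * y]] : nat).
have E y : 0 < y <= N -> \sum_(x < N.+1) ([&& 0 < x, x %% 3 == u & reg_index a m N x y] : nat) =
    \sum_(k < 2 * N + 1 | (m <= k) && (k %% 3 == a)) g y k.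
  case/andP=> y0 yN; rewrite /g exchange_big; apply: eq_bigr => x _ /=.
  case: (posnP x) => x0 /=; first by rewrite big1.
  case: (x %% 3 == u) => /=; last by rewrite big1.
  by rewrite (HK_split _ _ _ y0) // x0 -ltnS ltn_ord.
have -> : \sum_(k < 2 * N + 1 | (m <= k) && (k %% 3 == a)) tentsum N v k =
   sum3 N v (fun y => \sum_(k < 2 * N + 1 | (m <= k) && (k %% 3 == a)) tent N k y).
  rewrite /tentsum /sum3 exchange_big; apply: eq_bigr => y _ /=; case: ifP => // _.
  by rewrite big1.
have near_le y : 0 < y ->
    \sum_(k < 2 * N + 1 | (m <= k) && (k %% 3 == a)) 4 * near_idx N y k <= 8.
  move=> y0; rewrite -big_distrr /= -[8]/(4 * 2) leq_mul2l /=.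
  apply: leq_trans (sum_near_idx N (2 * N + 1) y0).
  by rewrite [X in _ <= X](bigID (fun k : 'I_(2 * N + 1) => (m <= k) && (k %% 3 == a))) leq_addr.
split.
- apply: leq_trans (_ : sum3 N v (fun y =>
     \sum_(k < 2 * N + 1 | (m <= k) && (k %% 3 == a)) tent N k y + 8) <= _); last first.
    by rewrite sum3D leq_add2l sum3_const.
  apply: sum3_le => y yN _; rewrite E // big_distrr /=.
  apply: leq_trans (leq_add (leqnn _) (near_le y _)); last by case/andP: yN.
  rewrite -big_split; apply: leq_sum => k /andP[mk _] /=.
  by have [] := @slice_tent N u k y u3 (leq_trans m0 mk) yN.
- apply: leq_trans (_ : sum3 N v (fun y => 3 * (\sum_(x < N.+1)
     ([&& 0 < x, x %% 3 == u & reg_index a m N x y] : nat)) + 8) <= _); last first.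
    by rewrite sum3D leq_add2l sum3_const.
  apply: sum3_le => y yN _; rewrite E // big_distrr /=.
  apply: leq_trans (leq_add (leqnn _) (near_le y _)); last by case/andP: yN.
  rewrite -big_split; apply: leq_sum => k /andP[mk _] /=.
  by have [] := @slice_tent N u k y u3 (leq_trans m0 mk) yN.
Qed.

(** A tent with k > K lives on y <= Y = 2 N / (K + 1), and each such y carries at most two tents of
    height at most y. The total is at most 2 Y^2, and Y^2 <= 4 N. *)
Lemma tentsum_tail N v K (P : pred nat) : N <= K.+1 ^ 2 ->
  \sum_(k < 2 * N + 1 | P k && (K < k)) tentsum N v k <= 8 * N.
Proof.
move=> NK; pose Y := (2 * N) %/ K.+1.
have YN : Y ^ 2 <= 4 * N.
  case: (posnP N) => [N0|N0]; first by rewrite /Y N0 muln0 div0n.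
  rewrite -(leq_pmul2r N0); apply: (@leq_trans (Y ^ 2 * K.+1 ^ 2)).
    by rewrite leq_mul2l NK orbT.
  rewrite -expnMn (_ : 4 * N * N = (2 * N) ^ 2); last by rewrite !expnS; lia.
  by rewrite leq_exp2r // leq_trunc_div.
have -> : \sum_(k < 2 * N + 1 | P k && (K < k)) tentsum N v k =
   sum3 N v (fun y => \sum_(k < 2 * N + 1 | P k && (K < k)) tent N k y).
  rewrite /tentsum /sum3 exchange_big; apply: eq_bigr => y _ /=; case: ifP => // _.
  by rewrite big1.
apply: (@leq_trans (sum3 N v (fun y => (y <= Y) * (2 * Y)))).
  apply: sum3_le => y /andP[y0 yN] _; case: (leqP y Y) => yY; last first.
    rewrite mul0n leqn0; apply/eqP; apply: big1 => k /andP[_ Kk].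
    apply/eqP; rewrite -leqn0; apply: leq_trans (tent_le _ _ _) _; rewrite /near_idx.
    rewrite /Y ltn_divLR // in yY.
    have : K.+1 * y <= k * y by rewrite leq_mul2r Kk orbT.
    rewrite (mulnC K.+1); case: (leqP (k * y) (2 * N)) => h; last by rewrite andbF.
    lia.
  rewrite mul1n; apply: (@leq_trans (\sum_(k < 2 * N + 1 ) near_idx N y k * y)).
    rewrite [X in _ <= X](bigID (fun k : 'I_(2 * N + 1) => P k && (K < k))) /=.
    by apply: leq_trans (leq_addr _ _); apply: leq_sum => k _; exact: tent_le.
  by rewrite -big_distrl /= leq_mul // sum_near_idx.
apply: (@leq_trans (Y * (2 * Y))); last by rewrite expnS in YN; lia.
rewrite /sum3 big_ord_recl /= add0n -(big_mkord xpredT (fun i =>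
  if (bump 0 i) %% 3 == v then (bump 0 i <= Y) * (2 * Y) else 0)).
apply: (@leq_trans (\sum_(0 <= i < N) (i < Y) * (2 * Y))).
  by apply: leq_sum => i _; case: ifP; rewrite /bump.
rewrite -big_distrl /= leq_mul2r; apply/orP; right.
rewrite -[X in _ <= X]card_ord -sum1_card.
case: (leqP N Y) => NY.
  apply: (@leq_trans (\sum_(0 <= i < N) 1)); first by apply: leq_sum => i _; case: (_ < _).
  by rewrite sum_nat_const_nat sum1_card card_ord; lia.
rewrite (@big_cat_nat _ _ _ Y) //=; last exact: ltnW.
rewrite [X in _ + X]big_nat [X in _ + X]big1 ?addn0; last by move=> i; case: (ltnP i Y); lia.
rewrite big_mkord; apply: leq_sum => i _; by case: (_ < _).
Qed.

Import Order.TTheory GRing.Theory Num.Theory.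
Import numFieldNormedType.Exports.

(** * Enumeration of the Farey series *)

Lemma Posz_inj : injective Posz.
Proof. by move=> m n []. Qed.

Lemma modn_cancel m k x y : coprime m k -> x < m -> y < m ->
  k * x = k * y %[mod m] -> x = y.
Proof.
move=> cop; wlog xy : x y / x <= y => [W|] xm ym H.
  by case: (leqP x y) => [|/ltnW] l; [apply: W|apply/esym/W].
have : m %| k * (y - x).
  by rewrite mulnBr -eqn_mod_dvd ?leq_mul2l ?xy ?orbT // H.
rewrite Gauss_dvdr // => /dvdn_leq; lia.
Qed.

Section FareyEnum.
Variable Q : nat.
Hypothesis Q0 : 0 < Q.

Let F := farey Q.
Let d i := nth 0 (farey_denoms Q) i.
Let a i := `|numq (nth 0%R F i)|%N.

Lemma frac_num_den (n q : nat) : 0 < q -> coprime n q ->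
  numq (n%:R / q%:R)%R = n /\ denq (n%:R / q%:R)%R = q.
Proof.
move=> q0 cop; have q0' : (Posz q != 0)%R by rewrite eqz_nat -lt0n.
have := @coprimeq_num n q; have := @coprimeq_den n q.
rewrite !absz_nat cop (negPf q0') !pmulrn => -> // -> //; split => //.
by rewrite gtr0_sg ?mul1r // ltz_nat.
Qed.

Lemma mem_farey x : (x \in F) =
  [&& (0 <= x)%R, (x <= 1)%R & (`|denq x| <= Q)%N].
Proof.
rewrite mem_sort; apply/mapP/idP.
  case=> -[n q]; rewrite mem_filter => /andP[cop /allpairsPdep[q' [n' [h1 h2 [e1 e2]]]]] ->.
  subst n' q'; rewrite mem_iota in h1; rewrite mem_iota in h2.
  have q0 : 0 < q by lia.
  have [_ ->] := frac_num_den q0 cop.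
  rewrite divr_ge0 //= ler_pdivrMr ?ltr0n // mul1r ler_nat; lia.
case/and3P=> x0 x1 xQ; exists (`|numq x|%N, `|denq x|%N); last first.
  rewrite /= -[LHS]divq_num_den; have nx : (0 <= numq x)%R by rewrite numq_ge0.
  by rewrite -[in LHS](gez0_abs nx) -[in LHS](gez0_abs (denq_ge0 x)) !pmulrn.
rewrite mem_filter; apply/andP; split; first exact: coprime_num_den.
apply/allpairsPdep.
exists `|denq x|%N, `|numq x|%N; split=> //.
  by rewrite mem_iota; have := denq_gt0 x; lia.
rewrite mem_iota /=; move: x1; rewrite -[x in (x <= 1)%R]divq_num_den.
rewrite ler_pdivrMr ?ltr0z // mul1r ler_int => h.
have : (0 <= numq x)%R by rewrite numq_ge0.
move: h; have := denq_gt0 x; lia.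
Qed.

Lemma farey_sorted : sorted <%R F.
Proof.
rewrite lt_sorted_uniq_le sort_le_sorted andbT sort_uniq map_inj_in_uniq.
  rewrite filter_uniq //; apply: allpairs_uniq_dep.
  - exact: iota_uniq.
  - by move=> x _; exact: iota_uniq.
  - by move=> [x1 y1] [x2 y2] _ _ /= [-> ->].
move=> [n q] [n' q']; rewrite !mem_filter => /andP[c1 /allpairsPdep[? [? [h1 _ [_ ?]]]]].
move=> /andP[c2 /allpairsPdep[? [? [h2 _ [_ ?]]]]]; subst.
rewrite !mem_iota in h1 h2 => /= E; rewrite /= in c1 c2.
have [|n1 d1] := @frac_num_den _ _ _ c1; first by lia.
have [|n2 d2] := @frac_num_den _ _ _ c2; first by lia.
by congr pair; apply: Posz_inj; [rewrite -n1 -n2 E|rewrite -d1 -d2 E].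
Qed.

Lemma dE i : i < size F -> d i = `|denq (nth 0%R F i)|%N.
Proof. by move=> iF; rewrite /d /farey_denoms (nth_map 0%R). Qed.

Lemma enum_spec i : i < size F ->
  [/\ 0 < d i, d i <= Q, a i <= d i & coprime (a i) (d i)].
Proof.
move=> iF; have := mem_nth 0%R iF; rewrite mem_farey dE //.
set x := nth _ _ _ => /and3P[x0 x1 xQ]; have := denq_gt0 x.
split=> //; [lia| |exact: coprime_num_den].
rewrite /a -/x; move: x1; rewrite -[x in (x <= 1)%R]divq_num_den.
rewrite ler_pdivrMr ?ltr0z // mul1r ler_int => h.
have : (0 <= numq x)%R by rewrite numq_ge0.
lia.
Qed.

Lemma enum_frac i : i < size F -> nth 0%R F i = ((a i)%:R / (d i)%:R)%R.
Proof.
move=> iF; have := mem_nth 0%R iF; rewrite mem_farey dE //.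
rewrite /a; set x := nth _ _ _ => /and3P[x0 x1 xQ].
have nx : (0 <= numq x)%R by rewrite numq_ge0.
rewrite -[LHS]divq_num_den -[in LHS](gez0_abs nx) -[in LHS](gez0_abs (denq_ge0 x)).
by rewrite !pmulrn.
Qed.

Lemma enum_lt i j : i < size F -> j < size F -> (a i * d j < a j * d i) = (i < j).
Proof.
move=> iF jF; have [di _ _ _] := enum_spec iF; have [dj _ _ _] := enum_spec jF.
have <- : (nth 0%R F i < nth 0%R F j)%R = (i < j).
  by apply: (lt_sorted_ltn_nth 0%R farey_sorted); rewrite inE.
rewrite !enum_frac //.
rewrite ltr_pdivrMr ?ltr0n // mulrAC ltr_pdivlMr ?ltr0n //.
by rewrite -!natrM ltr_nat.
Qed.

Lemma enum_surj n q : 0 < q <= Q -> n <= q -> coprime n q ->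
  exists i, [/\ i < size F, a i = n & d i = q].
Proof.
case/andP=> q0 qQ nq cop; have [n1 d1] := frac_num_den q0 cop.
pose x : rat := (n%:R / q%:R)%R.
have xF : x \in F.
  rewrite mem_farey d1 /= qQ divr_ge0 //= ler_pdivrMr ?ltr0n //.
  by rewrite mul1r ler_nat nq.
exists (index x F); rewrite index_mem xF dE ?index_mem // /a nth_index //.
by rewrite n1 d1.
Qed.

(** Solving the linear system of determinant 1 writes q'' as a combination of q and q' with positive
    integer coefficients. *)
Lemma between_den n q n' q' n'' q'' : n' * q = n * q' + 1 ->
  n * q'' < n'' * q -> n'' * q' < n' * q'' -> q + q' <= q''.
Proof.
move=> E H1 H2.
have -> : q'' = q' * (n'' * q - n * q'') + q * (n' * q'' - n'' * q').
  apply: Posz_inj; rewrite PoszD !PoszM -!subzn ?(ltnW H1) ?(ltnW H2) // !PoszM.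
  have {}E : (n'%:Z * q%:Z = n%:Z * q'%:Z + 1)%R by rewrite -!PoszM -PoszD E.
  apply: (@eq_trans _ _ (q''%:Z * (n'%:Z * q%:Z - n%:Z * q'%:Z))%R); last by ring.
  by rewrite E; ring.
rewrite addnC leq_add // leq_pmulr // subn_gt0 //.
Qed.

Lemma enum_next_det n q n' q' i : i < size F -> a i = n -> d i = q ->
  0 < q' <= Q -> n' <= q' -> n' * q = n * q' + 1 -> Q < q + q' ->
  [/\ i.+1 < size F, a i.+1 = n' & d i.+1 = q'].
Proof.
move=> iF an dq q'Q nq' E Qq.
have cop : coprime n' q'.
  rewrite /coprime -dvdn1 -(@dvdn_addr (n * q') _ 1) ?dvdn_mull ?dvdn_gcdr //.
  by rewrite -E dvdn_mulr // dvdn_gcdl.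
have [j [jF aj dj]] := enum_surj q'Q nq' cop.
have ij : i < j by rewrite -(enum_lt iF jF) an dq aj dj; lia.
have i1F : i.+1 < size F by apply: leq_ltn_trans jF.
have [_ dQ _ _] := enum_spec i1F.
suff -> : i.+1 = j by [].
apply/eqP; rewrite eqn_leq ij /= leqNgt; apply/negP => ij'.
have := enum_lt iF i1F; rewrite ltnSn an dq => H1.
have := enum_lt i1F jF; rewrite ij' aj dj => H2.
have := between_den E H1 H2; lia.
Qed.

Lemma enum_last i : i.+1 < size F -> a i < d i.
Proof.
move=> iF; have iF' : i < size F by exact: ltnW.
have [d0 _ l _] := enum_spec iF'; have [d1 _ l1 _] := enum_spec iF.
rewrite ltn_neqAle l andbT; apply/eqP => e.
have := enum_lt iF' iF; rewrite ltnSn e mulnC ltn_mul2r d0 /=; lia.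
Qed.

Lemma enum_step i : i.+1 < size F ->
  a i.+1 * d i = a i * d i.+1 + 1 /\ Q < d i + d i.+1.
Proof.
move=> iF; have iF' : i < size F by exact: ltnW.
have [d0 dQ _ cop] := enum_spec iF'; have ad := enum_last iF.
set n := a i in ad cop *; set q := d i in d0 dQ ad cop *.
have [u uq] := Bezoutl n d0; rewrite gcdnC (eqP cop) => qu.
(* Here q divides 1 + u n, and s = Q - t is the largest integer up to Q congruent to u mod q: the
   denominator of the successor of n / q. *)
pose t := (Q + (q - u)) %% q; have tq : t < q by rewrite ltn_mod.
pose s := Q - t.
have sE : s + q = (Q + (q - u)) %/ q * q + u.
  have := divn_eq (Q + (q - u)) q; rewrite /s -/t; lia.
have qs : q %| n * s + 1.
  rewrite -(dvdn_addl (n := n * q)) ?dvdn_mull //.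
  have -> : n * s + 1 + n * q = n * (s + q) + 1 by lia.
  rewrite sE mulnDr -addnA dvdn_add //; first by rewrite mulnA dvdn_mull.
  by rewrite addnC mulnC.
have s0 : 0 < s by rewrite /s; lia.
pose b := (n * s + 1) %/ q; have bE : b * q = n * s + 1 by rewrite divnK.
have bs : b <= s.
  rewrite -(leq_pmul2r d0) bE; have : n.+1 * s <= q * s by rewrite leq_mul2r ad orbT.
  by rewrite mulSn (mulnC s); lia.
have Qs : Q < q + s by rewrite /s; lia.
have sQ : 0 < s <= Q by rewrite s0 leq_subr.
have [_ -> ->] := enum_next_det iF' erefl erefl sQ bs bE Qs.
by [].
Qed.

Lemma enum_nbr i : i.+1 < size F -> nbr Q (d i) (d i.+1).
Proof.
move=> iF; have iF' : i < size F by exact: ltnW.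
have [E Qd] := enum_step iF.
have [d0 dQ _ _] := enum_spec iF'; have [d1 dQ1 _ _] := enum_spec iF.
apply/and5P; split=> //; rewrite Qd /= /coprime -dvdn1.
rewrite -(@dvdn_addr (a i * d i.+1) _ 1) ?dvdn_mull ?dvdn_gcdr //.
by rewrite -E dvdn_mull // dvdn_gcdl.
Qed.

Lemma enum_nxt i : i.+2 < size F -> nxt Q (d i) (d i.+1) = d i.+2.
Proof.
move=> iF; have iF' : i.+1 < size F by exact: ltnW.
have [E Qd] := enum_step iF'; have [E' Qd'] := enum_step iF.
have /nbrP[_ _ _ cop] := enum_nbr iF'.
have [d1 dQ1 _ cop1] := enum_spec iF'; have [d2 dQ2 _ _] := enum_spec iF.
have : d i.+1 %| d i + d i.+2.
  rewrite -(Gauss_dvdr (n := a i.+1)) 1?coprime_sym //.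
  have -> : a i.+1 * (d i + d i.+2) = (a i + a i.+2) * d i.+1 by lia.
  by rewrite dvdn_mull.
case/dvdnP=> k kE; exact: (nxtE d1 kE).
Qed.

(** The determinant relation says that the numerator times the next denominator is -1 mod the
    denominator, which determines the numerator. *)
Lemma enum_pair_inj i j : i.+1 < size F -> j.+1 < size F ->
  d i = d j -> d i.+1 = d j.+1 -> i = j.
Proof.
move=> iF jF e e1; have iF' : i < size F by exact: ltnW.
have jF' : j < size F by exact: ltnW.
have [E _] := enum_step iF; have [E' _] := enum_step jF.
have ai := enum_last iF; have aj := enum_last jF.
have /nbrP[_ _ _ cop] := enum_nbr iF.
rewrite -e -e1 in E'; rewrite -e in aj.
have H : a i * d i.+1 = a j * d i.+1 %[mod d i].
  apply/eqP; rewrite -(eqn_modDr 1) -E -E' !modnMl //.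
have : a i = a j.
  by apply: (modn_cancel cop) => //; rewrite !(mulnC (d i.+1)).
move=> ea; have := enum_lt iF' jF'; have := enum_lt jF' iF'.
by rewrite ea e ltnn => /esym/negbT h1 /esym/negbT h2; lia.
Qed.

Lemma enum_pair_surj x y : nbr Q x y ->
  exists i, [/\ i.+1 < size F, d i = x & d i.+1 = y].
Proof.
case/nbrP=> /andP[x0 xQ] /andP[y0 yQ] xy cop.
have [u ux] := Bezoutl y x0; rewrite (eqP cop) => xu.
pose b := (1 + u * y) %/ x; have bE : b * x = u * y + 1 by rewrite divnK // addnC.
have byy : b <= y.
  rewrite -(leq_pmul2r x0) bE; have : u.+1 * y <= x * y by rewrite leq_mul2r ux orbT.
  by rewrite mulSn (mulnC y); lia.
have cu : coprime u x.
  rewrite /coprime -dvdn1 -(@dvdn_addr (u * y) _ 1) ?dvdn_mulr ?dvdn_gcdl //.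
  by rewrite -bE dvdn_mull // dvdn_gcdr.
have [|i [iF ai di]] := @enum_surj u x _ (ltnW ux) cu; first by rewrite x0.
have [|iF' _ di'] := enum_next_det iF ai di _ byy bE xy; first by rewrite y0.
by exists i.
Qed.

End FareyEnum.

Lemma sum_bool_le1 n (P : pred 'I_n) :
  (forall i j : 'I_n, P i -> P j -> i = j) -> \sum_(i < n) (P i : nat) <= 1.
Proof.
move=> H; case: (pickP P) => [i Pi|P0]; last by rewrite big1 // => i _; rewrite P0.
rewrite (bigD1 i) //= Pi big1 // => j /negP ji.
by case: (boolP (P j)) => // Pj; case: ji; apply/eqP/H.
Qed.

Lemma sum_ord_split k n (f : nat -> nat) : k <= n ->
  \sum_(i < n) f i = \sum_(i < k) f i + \sum_(i < n - k) f (k + i).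
Proof. by move=> kn; rewrite -[in LHS](subnKC kn) big_split_ord. Qed.

(** * From windows of fractions to pairs of denominators *)

Section FareyCount.
Variable Q : nat.
Hypothesis Q0 : 0 < Q.

Let d i := nth 0 (farey_denoms Q) i.
Let m := (size (farey Q)).-1.

Lemma size_farey_gt0 : 0 < size (farey Q).
Proof.
by have [i [iF _ _]] := @enum_surj Q Q0 0 1 Q0 (leq0n 1) (coprimen1 0); apply: leq_ltn_trans iF.
Qed.

Lemma enum_count (P : nat -> nat -> bool) :
  pair_count Q (fun x y => nbr Q x y && P x y) = \sum_(i < m) (P (d i) (d i.+1) : nat).
Proof.
have mF (i : 'I_m) : i.+1 < size (farey Q) by have := ltn_ord i; rewrite /m; lia.
pose f (i : 'I_m) : 'I_Q.+1 * 'I_Q.+1 := (inord (d i), inord (d i.+1)).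
have fE i : (nat_of_ord (f i).1 = d i) /\ (nat_of_ord (f i).2 = d i.+1).
  have /nbrP[/andP[_ h1] /andP[_ h2] _ _] := enum_nbr Q0 (mF i).
  by rewrite !inordK ?ltnS.
have finj : injective f.
  move=> i j e; have [e1 e2] := fE i; have [e3 e4] := fE j; apply: val_inj => /=.
  by apply: (@enum_pair_inj Q Q0) => //; [rewrite -[LHS]e1 -[RHS]e3 e|rewrite -[LHS]e2 -[RHS]e4 e].
rewrite pair_count_card.
have -> : \sum_(i < m) (P (d i) (d i.+1) : nat) = #|[pred i : 'I_m | P (d i) (d i.+1)]|.
  by rewrite -sum1_card [RHS]big_mkcond.
rewrite -(card_imset _ finj); apply: eq_card => -[x y]; rewrite !inE /=.
apply/andP/imsetP.
  case=> n Pxy; have [i [iF di di1]] := enum_pair_surj Q0 n.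
  have im : i < m by rewrite /m; lia.
  have [e1 e2] := fE (Ordinal im); exists (Ordinal im); first by rewrite inE /= /d di di1.
  by rewrite [f _]surjective_pairing; congr pair; apply: val_inj; rewrite /= ?(etrans e1 di) ?(etrans e2 di1).
case=> i; rewrite inE /= => Pi E; have [e1 e2] := fE i.
have -> : x = (f i).1 by rewrite -E.
have -> : y = (f i).2 by rewrite -E.
by rewrite e1 e2 Pi; split=> //; exact: (enum_nbr Q0).
Qed.

Lemma enum_run c r i : i + r.+1 < size (farey Q) ->
  run Q c r (d i) (d i.+1) =
  (d (i + r.+1) %% 3 == c) && [forall j : 'I_r, d (i + j.+1) %% 3 != c].
Proof.
elim: r i => [|r IH] i iF.
  rewrite /= addn1; rewrite [X in _ && X](_ : _ = true) ?andbT //.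
  by apply/forallP => -[].
rewrite [LHS]/= (enum_nxt Q0); last by lia.
rewrite IH ?addSnnS // andbCA; congr (_ && _).
apply/andP/forallP => [[h1 /forallP h2] [[|j] jr]|H].
- by rewrite /= addn1.
- by have := h2 (Ordinal (jr : j < r)); rewrite /= addSnnS.
- split; first by have := H ord0; rewrite /= addn1.
  apply/forallP => -[j jr]; have := H (Ordinal (jr : j.+1 < r.+1)).
  by rewrite /= addSnnS.
Qed.

Lemma enum_run_avoid c r i t : run Q c r (d i) (d i.+1) ->
  0 < t <= r -> i + t < size (farey Q) -> (d (i + t) %% 3 == c) = false.
Proof.
elim: r i t => [|r IH] i [|[|t]] //= /andP[h1 h2] tr iF.
  by rewrite addn1; apply: negbTE.
rewrite (enum_nxt Q0) in h2; last by lia.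
by rewrite -addSnnS; apply: (IH i.+1) => //; rewrite ?addSnnS.
Qed.

(** The recursion behind [run] continues beyond the fraction 1/1, so some counted windows may
    overrun the series. They start at one of the last r pairs, and two of them would overlap: the
    later would start inside the earlier at a denominator of class c. Hence there is at most one. *)
Lemma gap_count_le c r : c = 1 \/ c = 2 ->
  farey_gap_count Q r 3 c <= window_count Q c r <= (farey_gap_count Q r 3 c).+1.
Proof.
move=> c12; have c3 : c %% 3 = c by case: c12 => ->.
have F0 := size_farey_gt0.
pose P i := (d i %% 3 == c) && run Q c r (d i) (d i.+1).
have -> : window_count Q c r = \sum_(i < m) (P i : nat).
  exact: (enum_count (fun x y => (x %% 3 == c) && run Q c r x y)).
have -> : farey_gap_count Q r 3 c = \sum_(i < m - r) (P i : nat).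
  have -> : m - r = size (farey Q) - r.+1 by rewrite /m; lia.
  rewrite /farey_gap_count -sum1_card big_mkcond /=.
  apply: eq_bigr => i _; rewrite inE c3 /P.
  by rewrite enum_run; last by have := ltn_ord i; lia.
have -> : \sum_(i < m) (P i : nat) =
    \sum_(i < m - r) (P i : nat) + \sum_(i < m - (m - r)) (P (m - r + i) : nat).
  exact: (sum_ord_split (fun i => P i) (leq_subr r m)).
rewrite leq_addr /= -addn1 leq_add2l; apply: sum_bool_le1 => i j Pi Pj.
have W (i1 j1 : 'I_(m - (m - r))) : P (m - r + i1) -> P (m - r + j1) -> i1 < j1 -> False.
  move=> /andP[_ h1] /andP[h2 _] ij.
  have := enum_run_avoid (t := j1 - i1) h1.
  have -> : m - r + i1 + (j1 - i1) = m - r + j1 by lia.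
  rewrite h2 => H; have := ltn_ord j1; have := ltn_ord i1 => l1 l2.
  have mE : size (farey Q) = m.+1 by rewrite /m prednK.
  have : true = false by apply: H; lia.
  by [].
case: (ltngtP (nat_of_ord i) (nat_of_ord j)) => [ij|ij|/val_inj //].
  by case: (W _ _ Pi Pj ij).
by case: (W _ _ Pj Pi ij).
Qed.

(** Only the last fraction is missed, since it begins no pair. *)
Lemma class_count_le c : c = 1 \/ c = 2 ->
  pair_count Q (fun x y => nbr Q x y && (x %% 3 == c)) <= farey_class_count Q 3 c
   <= (pair_count Q (fun x y => nbr Q x y && (x %% 3 == c))).+1.
Proof.
move=> c12; have c3 : c %% 3 = c by case: c12 => ->.
have F0 := size_farey_gt0.
rewrite (enum_count (fun x y => x %% 3 == c)).
have sz : size (farey_denoms Q) = m.+1 by rewrite size_map /m prednK.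
have -> : farey_class_count Q 3 c =
    \sum_(i < m) (d i %% 3 == c : nat) + (d m %% 3 == c : nat).
  rewrite /farey_class_count c3 -sum1_count (big_nth 0) sz big_mkord.
  by rewrite big_mkcond big_ord_recr.
by rewrite leq_addr /=; case: (d m %% 3 == c); rewrite ?addn1 ?addn0.
Qed.

End FareyCount.

(** * Asymptotics of the lattice counts *)

Definition res3 v := if v == 0 then 3 else v.

Lemma sum3_AP N v f : v < 3 -> (forall y, N < y -> f y = 0) ->
  sum3 N v f = \sum_(i < N.+1) f (3 * i + res3 v).
Proof.
move=> v3 f0; pose h y := if (0 < y) && (y %% 3 == v) then f y else 0.
have S n : \sum_(0 <= y < (3 * n).+1) h y = \sum_(i < n) f (3 * i + res3 v).
  elim: n => [|n IH]; first by rewrite muln0 big_nat1 big_ord0.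
  have -> : 3 * n.+1 = (3 * n).+3 by lia.
  do 3 rewrite big_nat_recr //=; rewrite IH big_ord_recr /= -!addnA; congr (_ + _).
  rewrite /h /= /res3.
  have -> : (3 * n).+1 %% 3 = 1 by lia.
  have -> : (3 * n).+2 %% 3 = 2 by lia.
  have -> : (3 * n).+3 %% 3 = 0 by lia.
  by case: v v3 {h IH} => [|[|[|?]]] //= _; rewrite ?addn0 ?add0n; congr f; lia.
rewrite -S (@big_cat_nat _ _ _ N.+1) //=; last by lia.
rewrite [X in _ + X]big_nat [X in _ + X]big1 ?addn0; last first.
  by move=> y /andP[Ny _]; rewrite /h f0 ?if_same.
by rewrite big_mkord.
Qed.

Local Open Scope ring_scope.

Section RampCount.
Variable R : realFieldType.

Lemma ramp_defect (c A : R) : 0 < c -> - (3 * c) <= A -> A <= 0 ->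
  0 <= - (A ^+ 2 / (6 * c) + A / 2) <= 3 / 8 * c.
Proof.
move=> c0 A1 A2.
have -> : - (A ^+ 2 / (6 * c) + A / 2) = ((- A) * (A + 3 * c)) / (6 * c) by field; lra.
have p1 : 0 <= (- A) * (A + 3 * c) by apply: mulr_ge0; lra.
have p2 := sqr_ge0 (A + 3 / 2 * c).
apply/andP; split; first by apply: divr_ge0; lra.
by rewrite ler_pdivrMr; [nra|lra].
Qed.

(** F(A) = A^2 / (6 c) + A / 2 satisfies F(A) - F(A - 3 c) = A, so removing the first term
    reproduces the claim. The only error is -F on [-3 c, 0], which is at most 3 c / 8. *)
Lemma ramp_sum (c A : R) n : 0 < c -> - (3 * c) <= A -> A <= 3 * c * n%:R ->
  0 <= \sum_(i < n) Num.max 0 (A - 3 * c * i%:R) - (A ^+ 2 / (6 * c) + A / 2) <= 3 / 8 * c.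
Proof.
move=> c0; elim: n A => [|n IH] A A1 A2.
  by rewrite big_ord0 sub0r; apply: ramp_defect => //; rewrite mulr0 in A2.
case: (lerP A 0) => A0.
  rewrite big1; last first.
    move=> i _; apply/max_idPl; have : 0 <= 3 * c * i%:R by rewrite !mulr_ge0 // ltW.
    lra.
  by rewrite sub0r; exact: ramp_defect.
rewrite big_ord_recl /= mulr0 subr0 (max_idPr (ltW A0)).
have -> : \sum_(i < n) Num.max 0 (A - 3 * c * (bump 0 i)%:R) =
          \sum_(i < n) Num.max 0 (A - 3 * c - 3 * c * i%:R).
  apply: eq_bigr => i _; congr (Num.max _ _); rewrite /bump /= natrD; ring.
have := IH (A - 3 * c); set S := \sum_(i < n) _.
have -> : (A - 3 * c) ^+ 2 / (6 * c) + (A - 3 * c) / 2 = A ^+ 2 / (6 * c) + A / 2 - A.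
  by field; lra.
rewrite -natr1 in A2; move=> H; have : 0 <= S - (A ^+ 2 / (6 * c) + A / 2 - A) <= 3 / 8 * c.
  by apply: H; lra.
lra.
Qed.

Definition ramp_main (B c w : R) : R := (B - c * w) ^+ 2 / (6 * c) + (B - c * w) / 2.

Lemma ramp_count_bound N v B c : (v < 3)%N -> (0 < c)%N -> (B <= c * N.+1)%N ->
  0 <= (ramp_count N v B c)%:R - ramp_main B%:R c%:R (res3 v)%:R <= 3 / 8 * c%:R.
Proof.
move=> v3 c0 Bc; rewrite /ramp_count sum3_AP //; last first.
  move=> y Ny; have : (c * N.+1 <= c * y)%N by rewrite leq_mul2l Ny orbT.
  lia.
have w1 : (0 < res3 v <= 3)%N by case: v v3 => [|[|[|?]]].
rewrite raddf_sum /=.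
have -> : \sum_(i < N.+1) (B - c * (3 * i + res3 v))%:R =
   \sum_(i < N.+1) Num.max 0 (B%:R - c%:R * (res3 v)%:R - 3 * c%:R * i%:R) :> R.
  apply: eq_bigr => i _.
  have E : B%:R - c%:R * (res3 v)%:R - 3 * c%:R * i%:R =
    B%:R - (c * (3 * i + res3 v))%:R :> R by rewrite natrM natrD natrM; ring.
  rewrite E; case: (leqP (c * (3 * i + res3 v)) B) => h.
    by rewrite natrB //; apply/esym/max_idPr; rewrite subr_ge0 ler_nat.
  rewrite (_ : (B - c * (3 * i + res3 v) = 0)%N); last by lia.
  by apply/esym/max_idPl; rewrite subr_le0 ler_nat ltnW.
have c0R : 0 < c%:R :> R by rewrite ltr0n.
apply: ramp_sum => //.
  have : (c * res3 v <= c * 3)%N by rewrite leq_mul2l; case/andP: w1 => _ ->; rewrite orbT.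
  rewrite -(ler_nat R) !natrM; have : 0 <= B%:R :> R by []; lra.
have h1 : B%:R <= c%:R * N.+1%:R :> R by rewrite -natrM ler_nat.
have : 0 <= c%:R * (res3 v)%:R :> R by rewrite -natrM.
have : 0 <= c%:R * N.+1%:R :> R by rewrite -natrM.
lra.
Qed.

Lemma ramp_count_crude N v B c : (v < 3)%N -> (0 < c)%N -> (B <= c * N.+1)%N ->
  `|(ramp_count N v B c)%:R - B%:R ^+ 2 / (6 * c%:R)| <= B%:R / 2 + c%:R :> R.
Proof.
move=> v3 c0 Bc; have := ramp_count_bound v3 c0 Bc; rewrite /ramp_main.
have c0R : 0 < c%:R :> R by rewrite ltr0n.
have B0 : 0 <= B%:R :> R by [].
have -> : (B%:R - c%:R * (res3 v)%:R) ^+ 2 / (6 * c%:R) + (B%:R - c%:R * (res3 v)%:R) / 2 =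
  B%:R ^+ 2 / (6 * c%:R) - B%:R * (res3 v)%:R / 3 + c%:R * (res3 v)%:R ^+ 2 / 6
  + B%:R / 2 - c%:R * (res3 v)%:R / 2 :> R.
  by field; lra.
rewrite ler_norml /res3; case: v v3 => [|[|[|?]]] //= _; lra.
Qed.

(** For k >= 2 the tent ends at 2 N / k <= N, inside the range of summation. The remaining error
    grows linearly in k, which is affordable for k up to about sqrt N. *)
Lemma tentsum_bound N v k : (v < 3)%N -> (2 <= k)%N ->
  `|(tentsum N v k)%:R - N%:R ^+ 2 / 3 * (4 / (k%:R * (k%:R + 1) * (k%:R + 2)))| <= 3 * k%:R :> R.
Proof.
move=> v3 k2; have := congr1 (fun n => n%:R : R) (tentsum_ramp N v k).
rewrite /= 2!natrD natrM => E.
have k0 : (2 : R) <= k%:R by rewrite ler_nat.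
have h c : (2 <= c)%N -> (2 * N <= c * N.+1)%N.
  by move=> c2; apply: (@leq_trans (2 * N.+1)%N); [lia|rewrite leq_mul2r c2 orbT].
have b c : (2 <= c)%N -> 0 <= (ramp_count N v (2 * N) c)%:R -
    ramp_main (2 * N%:R) c%:R (res3 v)%:R <= 3 / 8 * c%:R.
  by move=> c2; have := ramp_count_bound v3 (ltnW c2) (h c c2); rewrite natrM.
have b1 := b k k2; have b2 := b (k + 1)%N (leq_trans k2 (leq_addr _ _)).
have b3 := b (k + 2)%N (leq_trans k2 (leq_addr _ _)).
rewrite !natrD in b2 b3; move: b1 b2 b3; set w := (res3 v)%:R => b1 b2 b3.
have D : ramp_main (2 * N%:R) k%:R w + ramp_main (2 * N%:R) (k%:R + 2) w -
  2 * ramp_main (2 * N%:R) (k%:R + 1) w = N%:R ^+ 2 / 3 * (4 / (k%:R * (k%:R + 1) * (k%:R + 2))).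
  by rewrite /ramp_main; field; lra.
rewrite -D ler_norml; lra.
Qed.

End RampCount.

Lemma lattice_count0 u v H : lattice_count 0 u v H = 0%N.
Proof.
by rewrite lattice_slice2 /sum3 big_ord_recl big_ord0.
Qed.

Section Asymp.
Variable R : realFieldType.

(** Uniform in the residues, because Moebius inversion permutes them. *)
Definition lat_asymp (H : nat -> nat -> nat -> bool) (alpha C : R) : Prop :=
  forall N u v, (u < 3)%N -> (v < 3)%N ->
    `|9 * (lattice_count N u v H)%:R - alpha * N%:R ^+ 2| <= C * N%:R.

Lemma natr_le m n : (m <= n)%N -> m%:R <= n%:R :> R.
Proof. by rewrite ler_nat. Qed.

Lemma lat_asymp_triangle : lat_asymp reg_triangle (1 / 2) 20.
Proof.
move=> N u v u3 v3; case: N => [|N]; first by rewrite lattice_count0 !mulr0 expr0n /= mulr0 subr0 normr0.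
have [h1 h2] := lattice_triangle N.+1 u3 v3; have n1 : 1 <= N.+1%:R :> R by rewrite ler1n.
move: (N.+1) n1 h1 h2 => n n1 h1 h2.
(* The sum of y over the class becomes n times the size of the class minus a ramp of slope 1. *)
have E : (sum3 n v id + ramp_count n v n 1 = n * sum3 n v (fun _ => 1))%N.
  rewrite -sum3M /ramp_count -sum3D; apply: eq_bigr => y _; case: ifP => // _.
  by have := ltn_ord y; rewrite /=; lia.
have [|c1 c2] := slice_bound (P := xpredT) v3 (leqnn n) (l := 0).
  by move=> x ->.
have E1 : (\sum_(x < n.+1) ([&& 0 < x, x %% 3 == v & true]%N : nat) = sum3 n v (fun _ => 1))%N.
  by apply: eq_bigr => x _; rewrite andbT; case: ifP.
rewrite E1 subn0 in c1 c2; set s := sum3 n v (fun _ => 1%N) in E c1 c2.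
have P1 := @ramp_count_crude R n v n 1 v3 isT _; rewrite mul1n leqnSn in P1; have {P1} := P1 isT.
move: h1 h2 E c1 c2 => /natr_le h1 /natr_le h2 /(congr1 (fun n => n%:R : R)) /= E.
move=> /natr_le c1 /natr_le c2; move: c1 c2 => /(ler_wpM2l (ler0n R n)) c1 /(ler_wpM2l (ler0n R n)) c2.
rewrite !ler_norml expr2; lra.
Qed.

Lemma lat_asymp_wedge : lat_asymp reg_wedge (1 / 30) 50.
Proof.
move=> N u v u3 v3; case: N => [|N]; first by rewrite lattice_count0 !mulr0 expr0n /= mulr0 subr0 normr0.
have [h1 h2] := lattice_wedge N.+1 u3 v3; have n1 : 1 <= N.+1%:R :> R by rewrite ler1n.
move: (N.+1) n1 h1 h2 => n n1 h1 h2.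
have := @ramp_count_crude R n u n 3 u3 isT (ltac:(lia)).
have := @ramp_count_crude R n u n 5 u3 isT (ltac:(lia)).
move: h1 h2 => /natr_le h1 /natr_le h2; rewrite !ler_norml expr2; lra.
Qed.

Lemma lat_asymp_corner : lat_asymp reg_corner (1 / 210) 100.
Proof.
move=> N u v u3 v3; case: N => [|N]; first by rewrite lattice_count0 !mulr0 expr0n /= mulr0 subr0 normr0.
have [h1 h2] := lattice_corner N.+1 u3 v3; have n1 : 1 <= N.+1%:R :> R by rewrite ler1n.
move: (N.+1) n1 h1 h2 => n n1 h1 h2.
have := @ramp_count_crude R n u n 3 u3 isT (ltac:(lia)).
have := @ramp_count_crude R n u n 5 u3 isT (ltac:(lia)).
have := @ramp_count_crude R n u (2 * n) 7 u3 isT (ltac:(lia)).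
move: h1 h2 => /natr_le h1 /natr_le h2; rewrite !ler_norml !expr2; lra.
Qed.

Definition kite_area (j : nat) : R :=
  2 / ((2 * j%:R - 1) * (2 * j%:R + 1) * (2 * j%:R + 3)).

Lemma lattice_kite0 N u v j : (N < j)%N -> lattice_count N u v (reg_kite j) = 0%N.
Proof.
move=> Nj; rewrite lattice_slice1; apply: big1 => x _; case: ifP => // /andP[x0 _].
rewrite big1 // => y _; apply/eqP; rewrite eqb0; apply/negP => /and3P[_ _ /and4P[h _ _ _]].
have : (j <= j * x)%N by rewrite leq_pmulr.
lia.
Qed.

(** The constant does not depend on j. For j > N there are no points and the main term is itself at
    most 50 N; for j <= N each ramp has error at most N / 2 + 2 j + 3. *)
Lemma lat_asymp_kite j : (0 < j)%N -> lat_asymp (reg_kite j) (kite_area j) 50.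
Proof.
move=> j0 N u v u3 v3; case: N => [|N]; first by rewrite lattice_count0 !mulr0 expr0n /= mulr0 subr0 normr0.
set n := N.+1.
have n1 : 1 <= n%:R :> R by rewrite ler1n.
have j1 : 1 <= j%:R :> R by rewrite ler1n.
case: (ltnP n j) => nj.
  rewrite lattice_kite0 // mulr0 sub0r normrN /kite_area.
  have nj' : n%:R <= j%:R :> R by rewrite ler_nat ltnW.
  have d0 : 0 < (2 * j%:R - 1) * (2 * j%:R + 1) * (2 * j%:R + 3) :> R.
    by rewrite !mulr_gt0 //; lra.
  rewrite ger0_norm; last by rewrite !mulr_ge0 // ?invr_ge0 ?exprn_ge0 //; lra.
  rewrite mulrAC ler_pdivrMr //.
  apply: (@le_trans _ _ (50 * n%:R * j%:R)); first by rewrite expr2; nra.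
  rewrite ler_pM2l; last lra.
  apply: (@le_trans _ _ (2 * j%:R - 1)); first lra.
  by rewrite -mulrA ler_peMr; [|lra|nra].
have [h1 h2] := lattice_kite n u3 v3 j0.
have nj' : j%:R <= n%:R :> R by rewrite ler_nat.
have cr c : (0 < c)%N -> `|(ramp_count n u n c)%:R - n%:R ^+ 2 / (6 * c%:R)| <= n%:R / 2 + c%:R :> R.
  move=> c0; apply: ramp_count_crude => //; apply: leq_trans (leqnSn n) _.
  by rewrite leq_pmull.
have [i1 [i2 i3]] : (0 < 2 * j - 1 /\ 0 < 2 * j + 1 /\ 0 < 2 * j + 3)%N by lia.
have E1 : (2 * j - 1)%:R = 2 * j%:R - 1 :> R by rewrite natrB ?natrM //; lia.
have E2 : (2 * j + 1)%:R = 2 * j%:R + 1 :> R by rewrite natrD natrM.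
have E3 : (2 * j + 3)%:R = 2 * j%:R + 3 :> R by rewrite natrD natrM.
have := cr _ i1; have := cr _ i2; have := cr _ i3; rewrite E1 E2 E3.
move: h1 h2 => /natr_le h1 /natr_le h2; move: h1 h2.
move: (ramp_count _ _ _ _) (ramp_count _ _ _ _) (ramp_count _ _ _ _) => p q r.
have D : n%:R ^+ 2 / (6 * (2 * j%:R - 1)) - 2 * (n%:R ^+ 2 / (6 * (2 * j%:R + 1)))
  + n%:R ^+ 2 / (6 * (2 * j%:R + 3)) = 2 / 3 * (kite_area j * n%:R ^+ 2).
  by rewrite /kite_area; field; rewrite ?mulf_neq0 //; do ?[apply/andP; split]; lra.
move: D; set d1 := _ / _; set d2 := n%:R ^+ 2 / _; set d3 := n%:R ^+ 2 / _.
set ka := kite_area j * _; rewrite !ler_norml; lra.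
Qed.

Lemma ex_sqrt_nat N : exists K, (K ^ 2 <= N < K.+1 ^ 2)%N.
Proof.
elim: N => [|N [K /andP[h1 h2]]]; first by exists 0%N.
case: (ltnP N.+1 (K.+1 ^ 2)) => h; first by exists K; rewrite h (leq_trans h1).
by exists K.+1; rewrite h /= !expnS expn0; rewrite !expnS expn0 in h2; lia.
Qed.

Definition index_area_sum a m K : R :=
  \sum_(k < K.+1 | (m <= k)%N && (k %% 3 == a)%N) 4 / (k%:R * (k%:R + 1) * (k%:R + 2)).

(** The sum over k is cut at K, the integer part of sqrt N. Below K the errors O(k) add up to
    O(K^2); above K both the tents and the missing area times N^2 are O(N). The number alpha enters
    only through its tail bound, so the series is evaluated separately. *)
Lemma lat_asymp_index a m alpha : (2 <= m)%N ->
  (forall K, 0 <= alpha - index_area_sum a m K <= 2 / (K.+1%:R * K.+2%:R)) ->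
  lat_asymp (reg_index a m) alpha 80.
Proof.
move=> m2 ha N u v u3 v3; case: N => [|N]; first by rewrite lattice_count0 !mulr0 expr0n /= mulr0 subr0 normr0.
set n := N.+1.
have n1 : 1 <= n%:R :> R by rewrite ler1n.
have [K /andP[Kn nK]] := ex_sqrt_nat n.
have [h1 h2] := lattice_index n v a u3 (ltnW m2).
set T := (\sum_(k < _ | _) _)%N in h1 h2.
pose T1 := (\sum_(k < K.+1 | (m <= k) && (k %% 3 == a)) tentsum n v k)%N.
have KK : (K <= n)%N by apply: leq_trans Kn; case: (K) => // k; rewrite expnS leq_pmulr.
have TE : (T = T1 + \sum_(k < 2 * n + 1 | ((m <= k) && (k %% 3 == a)) && (K < k)) tentsum n v k)%N.
  rewrite /T (bigID (fun k : 'I_(2 * n + 1) => K < k)%N) /= addnC; congr (_ + _)%N.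
  have KK' : (K.+1 <= 2 * n + 1)%N by lia.
  rewrite /T1 (big_ord_widen_cond _ (fun k => (m <= k) && (k %% 3 == a))%N (tentsum n v) KK').
  by apply: eq_bigl => k; rewrite -leqNgt ltnS.
have tl := @tentsum_tail n v K (fun k => (m <= k) && (k %% 3 == a))%N (ltnW nK).
have T1E : `|T1%:R - n%:R ^+ 2 / 3 * index_area_sum a m K| <= 6 * n%:R.
  rewrite /T1 natr_sum /index_area_sum mulr_sumr -sumrB.
  apply: le_trans (ler_norm_sum _ _ _) _.
  apply: (@le_trans _ _ (\sum_(k < K.+1) 3 * K%:R)); last first.
    rewrite sumr_const card_ord -mulr_natr -natr1.
    have : K%:R ^+ 2 <= n%:R :> R by rewrite -natrX ler_nat.
    have : K%:R <= n%:R :> R by rewrite ler_nat.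
    rewrite expr2; lra.
  rewrite [X in _ <= X](bigID (fun k : 'I_K.+1 => (m <= k) && (k %% 3 == a))%N) /=.
  rewrite -[X in X <= _]addr0 lerD //; last by apply: sumr_ge0 => k _; rewrite mulr_ge0.
  apply: ler_sum => k /andP[mk _].
  apply: le_trans (tentsum_bound R n v3 (leq_trans m2 mk)) _.
  by rewrite ler_pM2l // ler_nat -ltnS ltn_ord.
have AE : `|alpha * n%:R ^+ 2 - n%:R ^+ 2 * index_area_sum a m K| <= 2 * n%:R.
  have /andP[a0 a1] := ha K.
  rewrite mulrC -mulrBr ger0_norm; last by rewrite mulr_ge0 // exprn_ge0.
  apply: (@le_trans _ _ (n%:R ^+ 2 * (2 / (K.+1%:R * K.+2%:R)))).
    by rewrite ler_wpM2l // exprn_ge0.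
  have nK' : n%:R <= K.+1%:R * K.+2%:R :> R.
    rewrite -natrM ler_nat; apply: leq_trans (ltnW nK) _.
    by rewrite !expnS expn0 muln1 leq_mul2l leqnSn orbT.
  have k0 : 0 < K.+1%:R * K.+2%:R :> R by rewrite mulr_gt0 // ltr0n.
  rewrite mulrA ler_pdivrMr // expr2; nra.
move: h1 h2 tl => /natr_le h1 /natr_le h2 /natr_le tl.
move: h1 h2 tl T1E AE; rewrite TE !ler_norml.
set tt := (\sum_(k < _ | _) _)%N.
have : 0 <= tt%:R :> R by [].
lra.
Qed.

End Asymp.

(** * Moebius inversion *)

Section Mobius.
Variable R : realFieldType.

Definition mobius (n : nat) : R :=
  if all (fun p => logn p n == 1%N) (primes n) then (-1) ^+ size (primes n) else 0.

Lemma mobius_norm n : `|mobius n| <= 1.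
Proof.
by rewrite /mobius; case: ifP => _; rewrite ?normrX ?normrN1 ?expr1n ?normr0 ?ler01.
Qed.

Lemma mobius1 : mobius 1 = 1.
Proof. by []. Qed.

Lemma mobius_sq p d : prime p -> (0 < d)%N -> (p ^ 2 %| d)%N -> mobius d = 0.
Proof.
move=> pp d0; rewrite pfactor_dvdn // => l2; rewrite /mobius; case: ifP => // /allP H.
have : p \in primes d by rewrite -logn_gt0; lia.
by move/H/eqP => e; rewrite e in l2.
Qed.

Lemma mobius_mulp p d : prime p -> (0 < d)%N -> ~~ (p %| d)%N ->
  mobius (p * d) = - mobius d.
Proof.
move=> pp d0 pd; have p0 := prime_gt0 pp.
have np : p \notin primes d by rewrite mem_primes pp d0.
have pe : perm_eq (primes (p * d)) (p :: primes d).
  apply: uniq_perm; rewrite ?primes_uniq //= ?np ?primes_uniq // => q.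
  by rewrite primesM // primes_prime // !inE.
rewrite /mobius (perm_size pe) (perm_all _ pe) /= exprS mulN1r.
have -> : logn p (p * d) == 1%N.
  by rewrite lognM // logn_prime // eqxx lognE pp d0 (negPf pd).
rewrite /= (@eq_in_all _ _ (fun q => logn q d == 1%N)); first by case: ifP; rewrite ?oppr0.
move=> q qd /=; rewrite lognM // logn_prime //.
by case: (q =P p) => // e; rewrite -e qd in np.
Qed.

(** Let p be the least prime factor. Divisors divisible by p^2 contribute 0, and d -> p d pairs the
    divisors prime to p with the remaining ones, with opposite signs. *)
Lemma sum_mobius_divisors g : (0 < g)%N ->
  \sum_(d <- divisors g) mobius d = (g == 1%N)%:R.
Proof.
move=> g0; case: (eqVneq g 1%N) => [->|g1]; first by rewrite big_seq1.
have pp : prime (pdiv g) by apply: pdiv_prime; lia.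
have pg := pdiv_dvd g; set p := pdiv g in pp pg.
rewrite (bigID (fun d => p %| d)%N) /= (bigID (fun d => p ^ 2 %| d)%N) /=.
rewrite big1_seq ?add0r; last first.
  move=> d /andP[/andP[_ h]]; rewrite -dvdn_divisors // => dg.
  by apply: mobius_sq h => //; apply: dvdn_gt0 dg.
have -> : \sum_(d <- divisors g | (p %| d)%N && ~~ (p ^ 2 %| d)%N) mobius d =
   \sum_(d <- divisors g | ~~ (p %| d)%N) mobius (p * d).
  rewrite -big_filter -[RHS]big_filter -(big_map (muln p) xpredT mobius).
  apply: perm_big; apply: uniq_perm.
  - by rewrite filter_uniq // divisors_uniq.
  - rewrite map_inj_uniq ?filter_uniq ?divisors_uniq // => x y /eqP.
    by rewrite eqn_pmul2l ?prime_gt0 // => /eqP.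
  move=> d; rewrite mem_filter -dvdn_divisors //; apply/idP/mapP.
    case/andP=> /andP[/dvdnP[k ->]] h dg; exists k; last by rewrite mulnC.
    rewrite mem_filter -dvdn_divisors // (dvdn_trans (dvdn_mulr _ (dvdnn k)) dg) andbT.
    by apply: contra h => pk; rewrite expnS expn1 dvdn_mul.
  case=> k; rewrite mem_filter -dvdn_divisors // => /andP[pk kg] ->.
  rewrite dvdn_mulr //= expnS expn1 dvdn_pmul2l ?prime_gt0 // pk /=.
  by rewrite Gauss_dvd ?pg ?kg // prime_coprime.
have -> : \sum_(d <- divisors g | ~~ (p %| d)%N) mobius (p * d) =
   - \sum_(d <- divisors g | ~~ (p %| d)%N) mobius d.
  rewrite -sumrN big_seq_cond [RHS]big_seq_cond; apply: eq_bigr => d /andP[dg pd].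
  by rewrite mobius_mulp //; rewrite -dvdn_divisors // in dg; apply: dvdn_gt0 dg.
by rewrite addNr.
Qed.

Lemma coprime_mobius Q x y : (0 < x <= Q)%N ->
  (coprime x y)%:R = \sum_(e < Q.+1 | [&& (0 < e)%N, (e %| x)%N & (e %| y)%N]) mobius e.
Proof.
move=> /andP[x0 xQ]; have g0 : (0 < gcdn x y)%N by rewrite gcdn_gt0 x0.
rewrite /coprime -sum_mobius_divisors //.
rewrite -(big_mkord (fun e => [&& (0 < e)%N, (e %| x)%N & (e %| y)%N]) mobius).
rewrite -[RHS]big_filter; apply: perm_big; apply: uniq_perm.
- exact: divisors_uniq.
- by rewrite filter_uniq // iota_uniq.
move=> e; rewrite mem_filter -dvdn_divisors // mem_index_iota dvdn_gcd ltnS /=.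
case: (boolP (e %| x)%N) => //=; last by rewrite andbF.
move=> ex; have e0 := dvdn_gt0 x0 ex; have eQ := leq_trans (dvdn_leq x0 ex) xQ.
by rewrite e0 eQ andbT.
Qed.

(** Exact with the integer quotient Q / e, since e A <= Q + e B is equivalent to A <= Q %/ e + B for
    integers. *)
Definition homogeneous (H : nat -> nat -> nat -> bool) :=
  forall Q e x y, (0 < e)%N -> (0 < x)%N -> (0 < y)%N ->
    H Q (e * x)%N (e * y)%N = H (Q %/ e)%N x y.

End Mobius.

Lemma leq_scale e Q A B : (0 < e)%N -> (e * A <= Q + e * B)%N = (A <= Q %/ e + B)%N.
Proof. by move=> e0; rewrite -divnDMl // leq_divRL // ![(_ * e)%N]mulnC. Qed.

Lemma leq_scale0 e Q A : (0 < e)%N -> (e * A <= Q)%N = (A <= Q %/ e)%N.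
Proof. by move=> e0; rewrite leq_divRL // mulnC. Qed.

Lemma homogeneous_triangle : homogeneous reg_triangle.
Proof.
by move=> Q e x y e0 x0 y0; rewrite /reg_triangle -mulnDr !ltnNge !leq_scale0.
Qed.

Lemma homogeneous_index a m : homogeneous (reg_index a m).
Proof.
move=> Q e x y e0 x0 y0; rewrite /reg_index homogeneous_triangle // mulnCA leq_scale //.
by rewrite divnMA (mulnC e x) divnDMl.
Qed.

Lemma homogeneous_kite j : homogeneous (reg_kite j).
Proof.
move=> Q e x y e0 x0 y0; rewrite /reg_kite !ltnNge ![(_ * (e * _))%N]mulnCA -!mulnDr.
by rewrite !leq_scale // !leq_scale0.
Qed.

Lemma homogeneous_wedge : homogeneous reg_wedge.
Proof.
move=> Q e x y e0 x0 y0; rewrite /reg_wedge !ltnNge ![(_ * (e * _))%N]mulnCA -!mulnDr.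
by rewrite !leq_scale // !leq_scale0.
Qed.

Lemma homogeneous_corner : homogeneous reg_corner.
Proof.
move=> Q e x y e0 x0 y0; rewrite /reg_corner !ltnNge ![(_ * (e * _))%N]mulnCA -!mulnDr.
by rewrite !leq_scale // !leq_scale0.
Qed.

Section Inversion.
Variable R : realFieldType.

Definition mult_count Q u v (H : nat -> nat -> nat -> bool) e :=
  pair_count Q (fun x y => [&& 0 < x, 0 < y, x %% 3 == u, y %% 3 == v & H Q x y]%N
                    && ((e %| x) && (e %| y))%N).

Lemma mobius_inversion Q u v H :
  (reg_count Q u v H)%:R =
  \sum_(e < Q.+1 | (0 < e)%N) mobius R e * (mult_count Q u v H e)%:R.
Proof.
rewrite /reg_count /mult_count /pair_count natr_sum.
under [RHS]eq_bigr => e _ do rewrite natr_sum mulr_sumr.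
rewrite exchange_big; apply: eq_bigr => -[x y] _ /=.
case: (posnP x) => x0 /=; first by rewrite big1 // => e _; rewrite mulr0.
have := @coprime_mobius R Q x y; rewrite x0 -ltnS ltn_ord => /(_ isT) E.
case C : [&& 0 < y, x %% 3 == u, y %% 3 == v & H Q x y]%N; last first.
  rewrite big1; last by move=> e _; rewrite /= mulr0.
  move: C; case: (0 < y)%N; case: (_ == u); case: (_ == v); case: (H _ _ _); case: (coprime _ _) => //=.
have -> : [&& 0 < y, coprime x y, x %% 3 == u, y %% 3 == v & H Q x y]%N = coprime x y.
  by move: C; case: (0 < y)%N; case: (_ == u); case: (_ == v); case: (H _ _ _); case: (coprime _ _) => //=.
rewrite E big_mkcondr; apply: eq_bigr => e e0 /=.
by case: ifP; rewrite ?mulr1 ?mulr0.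
Qed.

Lemma mult_count3 Q u v H e : (u < 3)%N -> (v < 3)%N -> (0 < u + v)%N -> (3 %| e)%N ->
  mult_count Q u v H e = 0%N.
Proof.
move=> u3 v3 uv e3; apply: pair_count0 => x y; apply/negP => /andP[/and5P[_ _ /eqP xu /eqP yv _] /andP[ex ey]].
have := dvdn_trans e3 ex; have := dvdn_trans e3 ey; lia.
Qed.

(** Dividing both coordinates by e multiplies residues by the inverse of e mod 3, which is e
    itself. *)
Lemma mult_count_lat Q u v H e : (u < 3)%N -> (v < 3)%N -> (0 < e)%N -> ~~ (3 %| e)%N ->
  homogeneous H ->
  mult_count Q u v H e = lattice_count (Q %/ e)%N ((e * u) %% 3)%N ((e * v) %% 3)%N H.
Proof.
move=> u3 v3 e0 e3 hH.
have er : (e %% 3 = 1 \/ e %% 3 = 2)%N by lia.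
have M x w : (w < 3)%N -> ((e * x) %% 3 == w)%N = (x %% 3 == (e * w) %% 3)%N.
  move=> w3; rewrite -modnMm -[X in _ = (_ == X)]modnMm (modn_small w3).
  have : (x %% 3 < 3)%N by rewrite ltn_mod.
  by case: er => ->; case: (x %% 3)%N => [|[|[|?]]] //; case: w w3 => [|[|[|?]]].
apply: (@pair_count_bij_le _ _ _ _ (fun x y => (x %/ e, y %/ e)%N) (fun x y => (e * x, e * y)%N)
  (fun x y => (e * x, e * y)%N) (fun x y => (x %/ e, y %/ e)%N)) => x y /=.
- case/andP=> /and5P[x0 y0 xu yv HQ] /andP[/dvdnP[x' xE] /dvdnP[y' yE]] xQ yQ.
  rewrite xE yE !(mulnC _ e) in x0 y0 xu yv HQ xQ yQ *.
  rewrite !mulKn //.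
  have x'0 : (0 < x')%N by move: x0; rewrite muln_gt0 => /andP[].
  have y'0 : (0 < y')%N by move: y0; rewrite muln_gt0 => /andP[].
  rewrite !M // in xu yv; rewrite hH // in HQ; rewrite x'0 y'0 xu yv HQ.
  by rewrite -!leq_scale0.
- case/and5P=> x0 y0 xu yv HQ xQ yQ.
  rewrite -!leq_scale0 // in xQ yQ.
  by rewrite !muln_gt0 e0 x0 y0 !M // xu yv hH // HQ !dvdn_mulr // xQ yQ !mulKn.
Qed.
End Inversion.

Section RegAsymp.
Variable R : realFieldType.

Definition mobius_sum Q : R :=
  \sum_(e < Q.+1 | (0 < e)%N && ~~ (3 %| e)%N) mobius R e / e%:R ^+ 2.

Definition harmonic_sum Q : R := \sum_(e < Q.+1 | (0 < e)%N) e%:R^-1.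

(** The term e = 1 equals 1. The others amount to at most 1/4 for e = 2 plus the telescoping sum of
    1 / (e - 1) - 1 / e from e = 3 on, hence 3/4. *)
Lemma mobius_sum_ge Q : (0 < Q)%N -> 1 / 4 <= mobius_sum Q.
Proof.
move=> Q0.
have sq n : \sum_(e < n.+1 | (1 < e)%N) (e%:R ^+ 2)^-1 <= 3 / 4 - (if (1 < n)%N then n%:R^-1 else 0) :> R.
  elim: n => [|n IH]; first by rewrite big_mkcond big_ord_recr big_ord0 /=; lra.
  rewrite big_mkcond big_ord_recr -big_mkcond /=.
  case: n IH => [|[|n]] IH.
  - rewrite big_mkcond big_ord_recr big_ord0 /=; lra.
  - rewrite big_mkcond !big_ord_recr big_ord0 /= expr2; lra.
  - apply: (le_trans (lerD IH (lexx _))) => /=; set m := n.+2%:R.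
    have m0 : 2 <= m by rewrite ler_nat.
    have -> : n.+3%:R = m + 1 :> R by rewrite natr1.
    have h : (m + 1) ^- 2 <= m^-1 - (m + 1)^-1.
      have -> : m^-1 - (m + 1)^-1 = (m * (m + 1))^-1 by field; lra.
      by rewrite lef_pV2 ?posrE; nra.
    move: h; move: ((m + 1) ^- 2) (m^-1) ((m + 1)^-1) => p q1 q2; lra.
have one : (1 < Q.+1)%N by lia.
rewrite /mobius_sum (bigD1 (Ordinal one)) //= mobius1 expr1n divr1.
have : `|\sum_(e < Q.+1 | ((0 < e)%N && ~~ (3 %| e)%N) && (e != Ordinal one)) mobius R e / e%:R ^+ 2| <= 3 / 4.
  apply: le_trans (ler_norm_sum _ _ _) _.
  apply: le_trans (_ : \sum_(e < Q.+1 | (1 < e)%N) (e%:R ^+ 2)^-1 <= _); last first.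
    apply: le_trans (sq Q) _; case: ifP => _; last lra.
    have : 0 <= Q%:R^-1 :> R by rewrite invr_ge0.
    lra.
  rewrite big_mkcond [X in _ <= X]big_mkcond; apply: ler_sum => e _.
  have -> : (e != Ordinal one) = ((e : nat) != 1)%N by [].
  case: ifP => [/andP[/andP[e0 _] e1]|_]; last first.
    by case: ifP => // _; rewrite invr_ge0 exprn_ge0.
  have -> : (1 < e)%N by lia.
  rewrite normrM [`|_^-1|]ger0_norm ?invr_ge0 ?exprn_ge0 //.
  by rewrite ler_piMl ?mobius_norm // invr_ge0 exprn_ge0.
by rewrite ler_norml; lra.
Qed.

(** With q = Q / e and N its integer part, q^2 - N^2 <= 2 q, which explains the term 2 |alpha|.
    Residues that are not both 0 exclude every e divisible by 3. *)
Lemma reg_asymp Q u v H alpha C : (u < 3)%N -> (v < 3)%N -> (0 < u + v)%N ->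
  homogeneous H -> lat_asymp H alpha C -> 0 <= C ->
  `|9 * (reg_count Q u v H)%:R - alpha * mobius_sum Q * Q%:R ^+ 2|
   <= (C + 2 * `|alpha|) * Q%:R * harmonic_sum Q.
Proof.
move=> u3 v3 uv hH hl C0.
rewrite mobius_inversion mulr_sumr /mobius_sum -mulrA mulrC mulr_suml mulr_suml /harmonic_sum mulr_sumr.
rewrite [X in _ - X]big_mkcondr -sumrB; apply: le_trans (ler_norm_sum _ _ _) _.
apply: ler_sum => e e0; have e0R : 0 < e%:R :> R by rewrite ltr0n.
case: ifP => e3; last first.
  rewrite mult_count3 // ?mulr0 ?subr0 ?normr0; last by move/negbT: e3; rewrite negbK.
  by rewrite !mulr_ge0 ?invr_ge0 ?addr_ge0 ?mulr_ge0.
rewrite mult_count_lat //.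
set N := (Q %/ e)%N; set l := (lattice_count _ _ _ _)%:R; set q := Q%:R / e%:R : R.
have -> : 9 * (mobius R e * l) - mobius R e / e%:R ^+ 2 * Q%:R ^+ 2 * alpha =
   mobius R e * (9 * l - alpha * q ^+ 2) by rewrite /q; field; lra.
rewrite normrM; apply: le_trans (ler_piMl _ (mobius_norm R e)) _ => //.
have Nq : N%:R <= q by rewrite /q ler_pdivlMr // -natrM ler_nat leq_trunc_div.
have qN : q <= N%:R + 1.
  rewrite /q ler_pdivrMr // natr1 -natrM ler_nat; apply: ltnW.
  by rewrite /N; have := ltn_ceil Q e0.
have N0 : 0 <= N%:R :> R by [].
have -> : (C + 2 * `|alpha|) * Q%:R * e%:R^-1 = C * q + 2 * `|alpha| * q by rewrite /q; ring.
have -> : 9 * l - alpha * q ^+ 2 = (9 * l - alpha * N%:R ^+ 2) - alpha * (q ^+ 2 - N%:R ^+ 2) by ring.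
apply: le_trans (ler_normB _ _) _; apply: lerD.
  by apply: le_trans (hl N _ _ _ _) _; rewrite ?ltn_mod ?ler_wpM2l.
rewrite normrM [2 * _]mulrC -mulrA ler_wpM2l // ger0_norm; last by rewrite !expr2; nra.
rewrite !expr2; nra.
Qed.

End RegAsymp.

(** * Asymptotics of the window counts *)

Section GAsymp.
Variables (R : realFieldType) (a0 a1 a2 a5 : R).

(** Makes alpha the sum of the whole series, with remainder after K at most that over all k > K
    without the congruence, which telescopes to the right-hand side. *)
Definition tail_limit a m (alpha : R) :=
  forall K, 0 <= alpha - index_area_sum R a m K <= 2 / (K.+1%:R * K.+2%:R).

Hypotheses (h0 : tail_limit 0 2 a0) (h1 : tail_limit 1 2 a1)
  (h2 : tail_limit 2 2 a2) (h5 : tail_limit 2 5 a5).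

Lemma tail_limit_le1 a m alpha : (2 <= m)%N -> tail_limit a m alpha -> `|alpha| <= 1.
Proof.
move=> m2 /(_ 0%N); have -> : index_area_sum R a m 0 = 0.
  by rewrite /index_area_sum big1 // => k /andP[mk _]; have := ltn_ord k; lia.
by rewrite subr0 mul1r divff ?pnatr_eq0 // => /andP[p q]; rewrite ger0_norm.
Qed.

Lemma kite_area_le1 j : (0 < j)%N -> `|kite_area R j| <= 1.
Proof.
move=> j0; have j1 : 1 <= j%:R :> R by rewrite ler1n.
have ab : 3 <= (2 * j%:R - 1) * (2 * j%:R + 1) :> R by nra.
rewrite /kite_area; move: (_ * _) ab => x ab.
have : 2 <= x * (2 * j%:R + 3) by nra.
move: (x * _) => y x2.
rewrite ger0_norm; last by rewrite divr_ge0; lra.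
by rewrite ler_pdivrMr; lra.
Qed.

(* 1/2, 1/30 and 1/210 are the areas of the triangle, the wedge and the corner; a0,
   a1, a2, a5 are those of reg_index 0 2, reg_index 1 2, reg_index 2 2, reg_index 2 5. *)
Definition gap_area r : R := match r with
  | 0 => 1 / 2
  | 1 => 1 / 2 - a0 - a2
  | 2 => 2 * a2
  | 3 => 3 * a0 - 2 / 30 + 2 / 210
  | 4 => 2 * kite_area R 2 + 2 * a1 - 4 / 210
  | 5 => 2 * kite_area R 3 + a5 + 2 / 210
  | _ => 2 * kite_area R (r - 2)
  end.

Lemma reg_asymp_le102 Q u v H (alpha C : R) : (u < 3)%N -> (v < 3)%N -> (0 < u + v)%N ->
  homogeneous H -> lat_asymp H alpha C -> 0 <= C <= 100 -> `|alpha| <= 1 ->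
  `|9 * (reg_count Q u v H)%:R - alpha * mobius_sum R Q * Q%:R ^+ 2|
   <= 102 * (Q%:R * harmonic_sum R Q).
Proof.
move=> u3 v3 uv hH hl /andP[C0 C1] al; apply: le_trans (reg_asymp Q u3 v3 uv hH hl C0) _.
rewrite -mulrA ler_wpM2r; [by []| |lra].
by rewrite mulr_ge0 //; apply: sumr_ge0 => e _; rewrite invr_ge0.
Qed.

(** Each window count is a combination of at most eight region counts with multiplicity, each with
    error constant 102, so 1000 is enough. *)
Lemma window_count_asymp Q c r : c = 1%N \/ c = 2%N ->
  `|9 * (window_count Q c r)%:R - gap_area r * mobius_sum R Q * Q%:R ^+ 2|
   <= 1000 * (Q%:R * harmonic_sum R Q).
Proof.
move=> c12.
have cc : (c < 3 /\ 3 - c < 3 /\ 0 < c /\ 0 < 3 - c)%N by lia.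
have [u3 [v3 [c0 c'0]]] := cc.
have b1 : `|1 / 30 : R| <= 1 by rewrite ger0_norm; lra.
have b2 : `|1 / 210 : R| <= 1 by rewrite ger0_norm; lra.
have b3 : `|1 / 2 : R| <= 1 by rewrite ger0_norm; lra.
have i1 : 0 <= (50 : R) <= 100 by lra.
have i2 : 0 <= (100 : R) <= 100 by lra.
have i3 : 0 <= (20 : R) <= 100 by lra.
have i4 : 0 <= (80 : R) <= 100 by lra.
have cc0 : (0 < c + c)%N by rewrite addn_gt0 c0.
have cc1 : (0 < c + (3 - c))%N by rewrite addn_gt0 c0.
have cc2 : (0 < (3 - c) + (3 - c))%N by rewrite addn_gt0 c'0.
have K0 : 0 <= Q%:R * harmonic_sum R Q.
  by rewrite mulr_ge0 //; apply: sumr_ge0 => e _; rewrite invr_ge0.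
have bT u v (hu : (u < 3)%N) (hv : (v < 3)%N) (huv : (0 < u + v)%N) :=
  @reg_asymp_le102 Q u v _ _ _ hu hv huv homogeneous_triangle (@lat_asymp_triangle R).
have bW := @reg_asymp_le102 Q 0 (3 - c) _ _ _ isT v3 c'0 homogeneous_wedge (@lat_asymp_wedge R).
have bR := @reg_asymp_le102 Q 0 (3 - c) _ _ _ isT v3 c'0 homogeneous_corner (@lat_asymp_corner R).
have bk j (j0 : (0 < j)%N) := @reg_asymp_le102 Q 0 (3 - c) _ _ _ isT v3 c'0 (@homogeneous_kite j) (lat_asymp_kite R j0).
have bK a m u v alpha (m2 : (2 <= m)%N) (hu : (u < 3)%N) (hv : (v < 3)%N) (huv : (0 < u + v)%N)
   (ha : tail_limit a m alpha) :=
  @reg_asymp_le102 Q u v _ _ _ hu hv huv (@homogeneous_index a m) (lat_asymp_index m2 ha).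
have t0 := tail_limit_le1 (m := 2) isT h0; have t1 := tail_limit_le1 (m := 2) isT h1.
have t2 := tail_limit_le1 (m := 2) isT h2; have t5 := tail_limit_le1 (m := 5) isT h5.
have bk' j : (0 < j)%N -> `|9 * (reg_count Q 0 (3 - c)%N (reg_kite j))%:R - kite_area R j * mobius_sum R Q * Q%:R ^+ 2|
   <= 102 * (Q%:R * harmonic_sum R Q).
  by move=> j0; apply: bk => //; exact: kite_area_le1.
have {}bW := bW i1 b1; have {}bR := bR i2 b2.
have {}bT u v hu hv huv := bT u v hu hv huv i3 b3.
have {}bK a m u v alpha m2 hu hv huv ha al := bK a m u v alpha m2 hu hv huv ha i4 al.
clear b1 b2 b3 i1 i2 i3 i4 bk cc.
set K := Q%:R * harmonic_sum R Q in K0 bW bR bT bK bk' *.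
set Z := mobius_sum R Q in bW bR bT bK bk' *.
case: r => [|[|[|[|[|[|r]]]]]].
- have := bT _ _ u3 u3 cc0; rewrite window_count_r0 // /= !ler_norml; lra.
- have := congr1 (fun n => n%:R : R) (window_count_r1 Q c12); rewrite /=.
  have := bT _ _ u3 v3 cc1; have := bK _ 2%N _ _ _ isT u3 v3 cc1 h0 t0.
  have := bK _ 2%N _ _ _ isT u3 v3 cc1 h2 t2; rewrite !ler_norml; lra.
- have := congr1 (fun n => n%:R : R) (window_count_r2 Q c12); rewrite /=.
  have := bK _ 2%N 0%N _ _ isT isT v3 c'0 h2 t2.
  have := bK _ 2%N _ _ _ isT u3 v3 cc1 h2 t2; rewrite !ler_norml; lra.
- have := congr1 (fun n => n%:R : R) (window_count_r3 Q c12); rewrite /=.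
  have := bK _ 2%N 0%N _ _ isT isT v3 c'0 h0 t0.
  have := bK _ 2%N _ _ _ isT u3 v3 cc1 h0 t0; move: bW bR; rewrite !ler_norml; lra.
- have := congr1 (fun n => n%:R : R) (window_count_r4 Q c12); rewrite /=.
  have := bK _ 2%N 0%N _ _ isT isT v3 c'0 h1 t1.
  have := bk' 2 isT; move: bR; rewrite !ler_norml; lra.
- have := congr1 (fun n => n%:R : R) (window_count_r5 Q c12); rewrite /=.
  have := bK _ 5%N _ _ _ isT v3 v3 cc2 h5 t5.
  have := bk' 3 isT; move: bR; rewrite !ler_norml; lra.
- have := congr1 (fun n => n%:R : R) (window_count_ge6 Q c12 (isT : 6 <= r.+4.+2)%N).
  rewrite /gap_area; have := bk' (r.+4.+2 - 2)%N isT.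
  move: (r.+4.+2 - 2)%N => j; rewrite /= !ler_norml; lra.
Qed.

(** The second denominator runs over three classes, each giving a triangle of area 1/2. *)
Lemma class_asymp Q c : c = 1%N \/ c = 2%N ->
  `|9 * (pair_count Q (fun x y => nbr Q x y && (x %% 3 == c)%N))%:R - 3 / 2 * mobius_sum R Q * Q%:R ^+ 2|
   <= 306 * (Q%:R * harmonic_sum R Q).
Proof.
move=> c12; have [u3 c0] : (c < 3 /\ 0 < c)%N by lia.
have -> : pair_count Q (fun x y => nbr Q x y && (x %% 3 == c)%N) =
   (reg_count Q c 0 reg_triangle + reg_count Q c 1 reg_triangle + reg_count Q c 2 reg_triangle)%N.
  rewrite -!nbr_count_triangle /nbr_count /pair_count -!big_split; apply: eq_bigr => -[x y] _ /=.
  case: (nbr _ _ _) => //=; case: (_ == c) => //=; have := @ltn_pmod y 3 isT.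
  by case: (y %% 3)%N => [|[|[|?]]].
have b3 : `|1 / 2 : R| <= 1 by rewrite ger0_norm; lra.
have i3 : 0 <= (20 : R) <= 100 by lra.
have bT v (hv : (v < 3)%N) :=
  @reg_asymp_le102 Q c v _ _ _ u3 hv (ltn_addr v c0) homogeneous_triangle (@lat_asymp_triangle R) i3 b3.
have := bT 0%N isT; have := bT 1%N isT; have := bT 2%N isT; rewrite !ler_norml; lra.
Qed.

End GAsymp.

(** * The limit frequencies *)

Section Calculus.
Variable R : realType.
Implicit Types (f g : R -> R) (x a b c : R).

Lemma is_derive_addf f g x a b : is_derive x 1 f a -> is_derive x 1 g b ->
  is_derive x 1 (fun y => f y + g y) (a + b).
Proof. by move=> *; exact: is_deriveD. Qed.

Lemma is_derive_subf f g x a b : is_derive x 1 f a -> is_derive x 1 g b ->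
  is_derive x 1 (fun y => f y - g y) (a - b).
Proof. by move=> *; exact: is_deriveB. Qed.

Lemma is_derive_scalef c f x a : is_derive x 1 f a ->
  is_derive x 1 (fun y => c * f y) (c * a).
Proof. by move=> *; exact: (is_deriveZ c). Qed.

Lemma is_derive_constf c x : is_derive x 1 (fun=> c) (0 : R).
Proof. exact: is_derive_cst. Qed.

Lemma is_derive_idf x : is_derive x 1 (fun y : R => y) 1.
Proof. exact: is_derive_id. Qed.

Lemma is_derive_monomial c k x :
  is_derive x 1 (fun y => c * y ^+ k.+1 / k.+1%:R) (c * x ^+ k).
Proof.
have := @is_deriveX R R^o id k.+1 x 1 1 _.
have -> : (id : R -> R) ^+ k.+1 = (fun y : R => y ^+ k.+1) by apply/funext => y; rewrite fctE.
move=> /(_ (is_derive_id _ _)) /(is_derive_scalef (c / k.+1%:R)) H.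
have E : (fun y => c * y ^+ k.+1 / k.+1%:R) = (fun y => c / k.+1%:R * y ^+ k.+1).
  by apply/funext => y; rewrite mulrAC.
rewrite E; apply: is_derive_eq H _.
have -> : (k.+1%:R * x ^+ k.+1.-1)%:A = k.+1%:R * x ^+ k :> R by rewrite /GRing.scale /= mulr1.
by rewrite mulrA divfK // pnatr_eq0.
Qed.

(** The remainder estimate for every series below, without integration: a function minus its partial
    sum has as derivative the remainder of a geometric series, which lies between 0 and a
    monomial. *)
Lemma mean_value_bound f (f' : R -> R) m c b : 0 <= b ->
  (forall x, 0 <= x <= b -> is_derive x 1 f (f' x)) ->
  (forall x, 0 <= x <= b -> 0 <= f' x <= c * x ^+ m) ->
  0 <= f b - f 0 <= c * b ^+ m.+1 / m.+1%:R.
Proof.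
move=> b0 df bf.
have mono g (g' : R -> R) : (forall x, 0 <= x <= b -> is_derive x 1 g (g' x)) ->
    (forall x, 0 <= x <= b -> 0 <= g' x) -> 0 <= g b - g 0.
  move=> dg pg; have [||y] := @MVT_segment R g g' 0 b b0.
  - by move=> x; rewrite in_itv /= => /andP[x0 xb]; apply: dg; rewrite !ltW.
  - apply: derivable_within_continuous => x; rewrite in_itv /= => xb.
    by have [] := dg x xb.
  by rewrite in_itv /= subr0 => yb ->; rewrite mulr_ge0 // pg.
apply/andP; split.
  by apply: mono df _ => x /bf /andP[].
have := mono (fun y => c * y ^+ m.+1 / m.+1%:R - f y) (fun x => c * x ^+ m - f' x).
rewrite expr0n /= mulr0 mul0r => H.
have : 0 <= c * b ^+ m.+1 / m.+1%:R - f b - (0 - f 0).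
  apply: H => x xb; last by rewrite subr_ge0; case/andP: (bf x xb).
  by apply: is_derive_subf; [exact: is_derive_monomial|exact: df].
by move: (c * b ^+ m.+1 / m.+1%:R) => t; lra.
Qed.

Lemma is_derive_sum_ord n (h h' : nat -> R -> R) x :
  (forall j, is_derive x 1 (h j) (h' j x)) ->
  is_derive x 1 (fun y => \sum_(j < n) h j y) (\sum_(j < n) h' j x).
Proof.
move=> H; elim: n => [|n IH].
  have -> : (fun y => \sum_(j < 0) h j y) = cst 0 by apply/funext => y; rewrite big_ord0.
  by rewrite big_ord0; exact: is_derive_cst.
have -> : (fun y => \sum_(j < n.+1) h j y) = (fun y => \sum_(j < n) h j y + h n y).
  by apply/funext => y; rewrite big_ord_recr.
by rewrite big_ord_recr /=; exact: is_derive_addf.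
Qed.

Lemma is_derive_comp_affine f (p q x a : R) : is_derive (p * x + q) 1 f a ->
  is_derive x 1 (fun y => f (p * y + q)) (a * p).
Proof.
move=> H; have H2 : is_derive x 1 (fun y : R => p * y + q) p.
  apply: is_derive_eq (is_derive_addf (is_derive_scalef p (is_derive_id x 1))
    (is_derive_cst q x 1)) _.
  by rewrite addr0 mulr1.
exact: (@is_derive1_comp R f (fun y => p * y + q) x a p H H2).
Qed.

(* ln (1 + x + x^2), of derivative (1 + 2 x) / (1 + x + x^2) *)
Lemma ln3_partial n :
  0 <= ln (3 : R) - \sum_(j < n) ((3 * j + 1)%:R^-1 + (3 * j + 2)%:R^-1 - 2 / (3 * j + 3)%:R)
    <= 3 / (3 * n + 1)%:R.
Proof.
pose h j y : R := 1 * y ^+ (3 * j).+1 / (3 * j).+1%:R + 1 * y ^+ (3 * j).+2 / (3 * j).+2%:R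
   - 2 * y ^+ (3 * j).+3 / (3 * j).+3%:R.
pose h' j y : R := 1 * y ^+ (3 * j) + 1 * y ^+ (3 * j).+1 - 2 * y ^+ (3 * j).+2.
pose f y : R := ln (1 + y + y ^+ 2) - \sum_(j < n) h j y.
pose q y : R := 1 + y + y ^+ 2.
have f0 : f 0 = 0.
  rewrite /f expr0n /= !addr0 ln1 big1 ?subr0 // => j _.
  by rewrite /h !exprS !mul0r !mulr0 !mul0r; ring.
have f1 : f 1 = ln 3 - \sum_(j < n) ((3 * j + 1)%:R^-1 + (3 * j + 2)%:R^-1 - 2 / (3 * j + 3)%:R).
  rewrite /f expr1n; congr (ln _ - _); first by ring.
  by apply: eq_bigr => j _; rewrite /h !expr1n !addn1 !addn2 !addn3 !mul1r mulr1.
have E : 3 / (3 * n + 1)%:R = 3 * 1 ^+ (3 * n).+1 / (3 * n).+1%:R :> R.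
  by rewrite expr1n mulr1 addn1.
suff: 0 <= f 1 - f 0 <= 3 * 1 ^+ (3 * n).+1 / (3 * n).+1%:R by rewrite f0 subr0 f1 -E.
apply: (@mean_value_bound f (fun y => (1 + 2 * y) * y ^+ (3 * n) / q y) (3 * n) 3 1 ler01).
- move=> x /andP[x0 x1]; have q0 : 0 < q x by rewrite /q; nra.
  apply: is_derive_eq.
    apply: is_derive_subf.
      apply: (@is_derive1_comp _ (@ln R) q x (q x)^-1 (1 + 2 * x)).
        exact: is_derive1_ln.
      have := is_derive_addf (is_derive_addf (is_derive_constf 1 x) (is_derive_idf x)) (is_derive_monomial 2 1 x).
      have -> : (fun y => 1 + y + 2 * y ^+ 2 / 2) = q.
        by apply/funext => y; rewrite /q; field.
      by rewrite add0r expr1.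
    apply: (@is_derive_sum_ord n h h' x) => j.
    by apply: is_derive_subf; [apply: is_derive_addf|]; exact: is_derive_monomial.
  have -> : \sum_(j < n) h' j x = (1 + 2 * x) * (1 - x ^+ (3 * n)) / q x.
    clear -q0; elim: n => [|n IH]; first by rewrite big_ord0 muln0 expr0 subrr mulr0 mul0r.
    rewrite big_ord_recr /= IH /h' mulnS addnC !addn3 !exprS.
    by move: (x ^+ (3 * n)) => t; rewrite /q in q0 *; field; lra.
  by field; lra.
- move=> x /andP[x0 x1]; have q0 : 0 < q x by rewrite /q; nra.
  have t0 : 0 <= x ^+ (3 * n) by rewrite exprn_ge0.
  rewrite -mulrA mulrCA; apply/andP; split.
    by rewrite mulr_ge0 // divr_ge0 // ?ltW //; lra.
  rewrite [X in _ <= X]mulrC ler_wpM2l // ler_pdivrMr // /q; nra.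
Qed.

(** Duplication gives b = 2 a for the two arctangents a and b, reflection gives b = pi / 2 - a, and
    these equations determine both. *)
Lemma atan_sqrt3 : atan (Num.sqrt 3)^-1 = pi / 6 :> R /\ atan (Num.sqrt 3) = pi / 3 :> R.
Proof.
have s0 : 0 < Num.sqrt 3 :> R by rewrite sqrtr_gt0.
have ss : Num.sqrt 3 * Num.sqrt 3 = 3 :> R by rewrite -expr2 sqr_sqrtr.
move: (Num.sqrt 3) s0 ss => s s0 ss; set a := atan s^-1; set b := atan s.
have s1 : 1 < s by rewrite -(ltr_pM2l s0) mulr1 ss; nra.
have a0 : 0 < a by rewrite /a -(@atan0 R) lt_atan // invr_gt0.
have a1 : a < pi / 4 by rewrite /a -atan1 lt_atan // invf_lt1.
have pi0 := @pi_gt0 R.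
have cosa : cos a != 0 by rewrite gt_eqF // cos_gt0_pihalf //; apply/andP; split; lra.
have ta : tan a = s^-1 by exact: atanK.
have b2 : b = a *+ 2.
  have : tan (a *+ 2) = s.
    rewrite (tan_mulr2n cosa) ta exprVn expr2 ss (mulr2n s^-1); have -> : s^-1 = s / 3.
      by rewrite -ss; field; lra.
    by field.
  by move=> e; rewrite /b -e tanK // in_itv /= (mulr2n a); apply/andP; split; lra.
have ab : b = pi / 2 - a.
  have : tan (pi / 2 - a) = s.
    have -> : pi / 2 - a = - (a - pi / 2) by ring.
    rewrite tanN /tan sinBpihalf cosBpihalf -mulNr opprK.
    by rewrite -[RHS]invrK -ta /tan invf_div.
  by move=> e; rewrite /b -e tanK // in_itv /=; apply/andP; split; lra.
by rewrite (mulr2n a) in b2; split; lra.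
Qed.

(* (2 / sqrt 3) atan ((2 x + 1) / sqrt 3), of derivative 1 / (1 + x + x^2) *)
Lemma pi_sqrt3_partial n :
  0 <= pi / Num.sqrt (3 : R) - 3 * \sum_(j < n) ((3 * j + 1)%:R^-1 - (3 * j + 2)%:R^-1)
    <= 3 / (3 * n + 1)%:R.
Proof.
have s0 : 0 < Num.sqrt 3 :> R by rewrite sqrtr_gt0.
have ss : Num.sqrt 3 * Num.sqrt 3 = 3 :> R by rewrite -expr2 sqr_sqrtr.
have [A1 A2] := atan_sqrt3.
move: (Num.sqrt 3) s0 ss A1 A2 => s s0 ss A1 A2.
have si : s^-1 = s / 3 by rewrite -ss; field; lra.
pose h j y : R := 1 * y ^+ (3 * j).+1 / (3 * j).+1%:R - 1 * y ^+ (3 * j).+2 / (3 * j).+2%:R.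
pose h' j y : R := 1 * y ^+ (3 * j) - 1 * y ^+ (3 * j).+1.
pose f y : R := 2 / s * atan (2 / s * y + s^-1) - \sum_(j < n) h j y.
pose q y : R := 1 + y + y ^+ 2.
have f0 : f 0 = pi / (3 * s).
  rewrite /f mulr0 add0r A1 big1 ?subr0; first by field; lra.
  by move=> j _; rewrite /h !exprS !mul0r !mulr0 !mul0r; ring.
have f1 : f 1 = 2 * pi / (3 * s) - \sum_(j < n) ((3 * j + 1)%:R^-1 - (3 * j + 2)%:R^-1).
  rewrite /f mulr1; have -> : 2 / s + s^-1 = s by rewrite si; lra.
  rewrite A2; congr (_ - _); first by field; lra.
  by apply: eq_bigr => j _; rewrite /h !expr1n !addn1 !addn2 !mul1r.
suff : 0 <= f 1 - f 0 <= 1 * 1 ^+ (3 * n).+1 / (3 * n).+1%:R.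
  rewrite f0 f1 expr1n mulr1 addn1.
  have -> : 2 * pi / (3 * s) = 2 / 3 * (pi / s) by field; lra.
  have -> : pi / (3 * s) = 1 / 3 * (pi / s) by field; lra.
  rewrite [3 / _]mulrC [1 / (3 * n).+1%:R]mul1r.
  move: ((3 * n).+1%:R^-1) => t; lra.
apply: (@mean_value_bound f (fun y => y ^+ (3 * n) / q y) (3 * n) 1 1 ler01).
- move=> x /andP[x0 x1]; have q0 : 0 < q x by rewrite /q; nra.
  have D1 := is_derive_scalef (2 / s)
    (is_derive_comp_affine (is_derive1_atan (2 / s * x + s^-1))).
  have D2 : is_derive x 1 (fun y => \sum_(j < n) h j y) (\sum_(j < n) h' j x).
    apply: is_derive_sum_ord => j.
    by apply: is_derive_subf; exact: is_derive_monomial.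
  apply: (is_derive_eq (is_derive_subf D1 D2)).
  have -> : \sum_(j < n) h' j x = (1 - x ^+ (3 * n)) / q x.
    clear -q0; elim: n => [|n IH]; first by rewrite big_ord0 muln0 expr0 subrr mul0r.
    rewrite big_ord_recr /= IH /h' mulnS addnC !addn3 !exprS.
    by move: (x ^+ (3 * n)) => t; rewrite /q in q0 *; field; lra.
  have -> : 2 / s * ((1 + (2 / s * x + s^-1) ^+ 2)^-1 * (2 / s)) = (q x)^-1.
    have -> : (2 / s * x + s^-1) ^+ 2 = (2 * x + 1) ^+ 2 / 3.
      by rewrite -ss; field; lra.
    have -> : 2 / s * ((1 + (2 * x + 1) ^+ 2 / 3)^-1 * (2 / s)) =
      4 / 3 * (1 + (2 * x + 1) ^+ 2 / 3)^-1.
      have -> : 4 / 3 = 2 / s * (2 / s) by rewrite -ss; field; lra.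
      ring.
    by rewrite /q in q0 *; field; apply/andP; split; nra.
  by field; lra.
- move=> x /andP[x0 x1]; have q0 : 0 < q x by rewrite /q; nra.
  have t0 : 0 <= x ^+ (3 * n) by rewrite exprn_ge0.
  rewrite mul1r divr_ge0 //= ?ler_pdivrMr //; last exact: ltW.
  rewrite /q; nra.
Qed.

End Calculus.

(** * Rapidly convergent series for the decimals *)

Section Numerics.
Variable R : realType.

Lemma atan_partial p (b : R) : 0 <= b ->
  0 <= atan b - \sum_(k < 2 * p) (-1) ^+ k * b ^+ (2 * k).+1 / (2 * k).+1%:R
    <= 1 * b ^+ (4 * p).+1 / (4 * p).+1%:R.
Proof.
move=> b0.
pose h k y : R := (-1) ^+ k * y ^+ (2 * k).+1 / (2 * k).+1%:R.
pose h' k y : R := (-1) ^+ k * y ^+ (2 * k).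
pose f y : R := atan y - \sum_(k < 2 * p) h k y.
have f0 : f 0 = 0.
  rewrite /f atan0 sub0r big1 ?oppr0 // => k _.
  by rewrite /h exprS mul0r mulr0 mul0r.
suff : 0 <= f b - f 0 <= 1 * b ^+ (4 * p).+1 / (4 * p).+1%:R by rewrite f0 subr0.
apply: (@mean_value_bound R f (fun y => y ^+ (4 * p) / (1 + y ^+ 2)) (4 * p) 1 b b0).
- move=> x _; have q0 : 0 < 1 + x ^+ 2 by have := sqr_ge0 x; lra.
  have D2 : is_derive x 1 (fun y => \sum_(k < 2 * p) h k y) (\sum_(k < 2 * p) h' k x).
    by apply: is_derive_sum_ord => k; exact: is_derive_monomial.
  apply: (is_derive_eq (is_derive_subf (is_derive1_atan x) D2)).
  have G n : \sum_(k < n) h' k x = (1 - (- x ^+ 2) ^+ n) / (1 + x ^+ 2).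
    elim: n => [|n IH]; first by rewrite big_ord0 expr0 subrr mul0r.
    rewrite big_ord_recr /= IH /h' exprM -exprMn mulN1r [_ ^+ n.+1]exprS.
    by move: ((- x ^+ 2) ^+ n) => t; field; lra.
  rewrite G exprM sqrrN -exprM -exprM mulnA.
  by field; lra.
- move=> x /andP[x0 _]; have q0 : 1 <= 1 + x ^+ 2 by have := sqr_ge0 x; lra.
  have t0 : 0 <= x ^+ (4 * p) by rewrite exprn_ge0.
  rewrite mul1r divr_ge0 //=; last lra.
  by rewrite ler_pdivrMr ?ler_peMr //; lra.
Qed.

(** The arctangent series at 1 / sqrt 3, multiplied by 6 / sqrt 3. It converges geometrically,
    unlike [pi_sqrt3_partial], whose purpose is to identify sums over a residue class. *)
Lemma pi_sqrt3_series p :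
  0 <= pi / Num.sqrt (3 : R) - 2 * \sum_(k < 2 * p) (- 3^-1) ^+ k / (2 * k).+1%:R
    <= 2 * 3^-1 ^+ (2 * p) / (4 * p).+1%:R.
Proof.
have s0 : 0 < Num.sqrt 3 :> R by rewrite sqrtr_gt0.
have ss : Num.sqrt 3 * Num.sqrt 3 = 3 :> R by rewrite -expr2 sqr_sqrtr.
have [A1 _] := atan_sqrt3 R.
move: (Num.sqrt 3) s0 ss A1 => s s0 ss A1.
have si0 : 0 < s^-1 by rewrite invr_gt0.
have si2 : s^-1 ^+ 2 = 3^-1 by rewrite exprVn expr2 ss.
have := atan_partial p (ltW si0); rewrite A1.
have -> : \sum_(k < 2 * p) (-1) ^+ k * s^-1 ^+ (2 * k).+1 / (2 * k).+1%:R =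
   s^-1 * \sum_(k < 2 * p) (- 3^-1) ^+ k / (2 * k).+1%:R.
  rewrite mulr_sumr; apply: eq_bigr => k _.
  by rewrite exprS exprM si2 -[- 3^-1]mulN1r exprMn; ring.
rewrite exprS (_ : (4 * p = 2 * (2 * p))%N); last by lia.
rewrite [s^-1 ^+ (_ * _)]exprM si2.
move: (\sum_(k < _) _) (3^-1 ^+ (2 * p)) ((2 * (2 * p)).+1%:R^-1) => S t v.
have k0 : 0 < 6 * s^-1 by rewrite mulr_gt0.
move=> /andP[/(ler_wpM2l (ltW k0)) h1 /(ler_wpM2l (ltW k0)) h2]; move: h1 h2.
have -> : 6 * s^-1 * (pi / 6 - s^-1 * S) = pi / s - 6 * s^-1 ^+ 2 * S by field; lra.
have -> : 6 * s^-1 * (1 * (s^-1 * t) * v) = 6 * s^-1 ^+ 2 * t * v by ring.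
rewrite si2; lra.
Qed.

(** The series of ln ((1 + y) / (1 - y)) at y = 1/2; on [0, 1/2] the factor 2 / (1 - y^2) is at most
    8/3. *)
Lemma ln3_series n :
  0 <= ln (3 : R) - \sum_(k < n) 4^-1 ^+ k / (2 * k).+1%:R
    <= 4 / 3 * 4^-1 ^+ n / (2 * n).+1%:R.
Proof.
pose h k y : R := 2 * y ^+ (2 * k).+1 / (2 * k).+1%:R.
pose h' k y : R := 2 * y ^+ (2 * k).
pose f y : R := ln (1 * y + 1) - ln (-1 * y + 1) - \sum_(k < n) h k y.
have f0 : f 0 = 0.
  rewrite /f !mulr0 !add0r ln1 subrr sub0r big1 ?oppr0 // => k _.
  by rewrite /h exprS mul0r mulr0 mul0r.
have b0 : 0 <= 2^-1 :> R by lra.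
have f1 : f 2^-1 = ln 3 - \sum_(k < n) 4^-1 ^+ k / (2 * k).+1%:R.
  rewrite /f; congr (_ - _).
    by rewrite -ln_div ?posrE; [congr ln; field|lra..].
  apply: eq_bigr => k _; rewrite /h exprS mulrA divff ?mul1r // exprM.
  by have -> : 2^-1 ^+ 2 = 4^-1 :> R by field.
suff : 0 <= f 2^-1 - f 0 <= 8 / 3 * 2^-1 ^+ (2 * n).+1 / (2 * n).+1%:R.
  rewrite f0 f1 subr0 exprS exprM; have -> : 2^-1 ^+ 2 = 4^-1 :> R by field.
  by have -> : 8 / 3 * (2^-1 * 4^-1 ^+ n) = 4 / 3 * 4^-1 ^+ n :> R by field.
apply: (@mean_value_bound R f (fun y => 2 * y ^+ (2 * n) / (1 - y ^+ 2)) (2 * n) (8 / 3) _ b0).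
- move=> x /andP[x0 x1].
  have q1 : 0 < 1 * x + 1 by lra.
  have q2 : 0 < -1 * x + 1 by lra.
  have D2 : is_derive x 1 (fun y => \sum_(k < n) h k y) (\sum_(k < n) h' k x).
    by apply: is_derive_sum_ord => k; exact: is_derive_monomial.
  have D1 := is_derive_comp_affine (is_derive1_ln q1).
  have D3 := is_derive_comp_affine (is_derive1_ln q2).
  apply: (is_derive_eq (is_derive_subf (is_derive_subf D1 D3) D2)).
  have -> : \sum_(k < n) h' k x = 2 * (1 - (x ^+ 2) ^+ n) / (1 - x ^+ 2).
    clear -q1 q2 x0; elim: n => [|n IH]; first by rewrite big_ord0 expr0 subrr mulr0 mul0r.
    rewrite big_ord_recr /= IH /h' exprM [_ ^+ n.+1]exprS.
    by move: ((x ^+ 2) ^+ n) => t; field; nra.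
  rewrite exprM; move: ((x ^+ 2) ^+ n) => t; field.
  by apply/and3P; split; nra.
- move=> x /andP[x0 x1]; have q0 : 3 / 4 <= 1 - x ^+ 2 by rewrite expr2; nra.
  have t0 : 0 <= x ^+ (2 * n) by rewrite exprn_ge0.
  rewrite divr_ge0 ?mulr_ge0 //=; last lra.
  rewrite ler_pdivrMr; [nra|lra].
Qed.

End Numerics.

Section Constants.
Variable R : realType.

Lemma pi_sqrt3_approx :
  1 + 813 / 10 ^+ 3 + 799 / 10 ^+ 6 + 364 / 10 ^+ 9 + 230 / 10 ^+ 12
    <= pi / Num.sqrt (3 : R)
    <= 1 + 813 / 10 ^+ 3 + 799 / 10 ^+ 6 + 364 / 10 ^+ 9 + 240 / 10 ^+ 12.
Proof.
(* These 22 terms leave a remainder below 2 / 10^12. *)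
have := pi_sqrt3_series R 11; rewrite !big_ord_recr big_ord0 /= /muln /=.
move: (pi / _) => A; lra.
Qed.

Lemma ln3_approx : 1 + 98 / 10 ^+ 3 + 612 / 10 ^+ 6 + 288 / 10 ^+ 9 + 660 / 10 ^+ 12
    <= ln (3 : R)
    <= 1 + 98 / 10 ^+ 3 + 612 / 10 ^+ 6 + 288 / 10 ^+ 9 + 675 / 10 ^+ 12.
Proof.
have := ln3_series R 17; rewrite !big_ord_recr big_ord0 /= /muln /=.
move: (ln _) => A; lra.
Qed.

Lemma gap_freq_lim3_decimals :
   [/\ has_decimals (gap_freq_lim3 R 0) [:: 3; 3; 3; 3; 3; 3; 3; 3; 3; 3]%N,
         has_decimals (gap_freq_lim3 R 1) [:: 1; 4; 3; 4; 5; 8; 0; 5; 0; 4]%N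
       & has_decimals (gap_freq_lim3 R 2) [:: 2; 6; 2; 9; 6; 6; 1; 0; 3; 1]%N]
  /\ [/\ has_decimals (gap_freq_lim3 R 3) [:: 1; 3; 7; 0; 8; 1; 4; 5; 6; 1]%N,
         has_decimals (gap_freq_lim3 R 4) [:: 0; 7; 7; 3; 9; 2; 2; 9; 1; 2]%N
       & has_decimals (gap_freq_lim3 R 5) [:: 0; 3; 5; 1; 8; 6; 7; 5; 5; 2]%N].
Proof.
have := pi_sqrt3_approx; have := ln3_approx.
rewrite /has_decimals /decimal !big_ord_recr !big_ord0 /gap_freq_lim3 /=.
rewrite -[2 * pi / _]mulrA.
move: (pi / _) (ln _) => A L h1 h2; rewrite !ltr_norml.
split; split; apply/andP; split; lra.
Qed.

(** * Evaluation of the sums over the index *)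

Definition index_area k : R := 4 / (k%:R * (k%:R + 1) * (k%:R + 2)).

Lemma index_area_sumS a m K : index_area_sum R a m K.+1 =
  index_area_sum R a m K + (if (m <= K.+1)%N && (K.+1 %% 3 == a)%N then index_area K.+1 else 0).
Proof. by rewrite /index_area_sum big_mkcond big_ord_recr -big_mkcond. Qed.

Lemma index_area_ge0 k : 0 <= index_area k.
Proof. by rewrite /index_area divr_ge0 // !mulr_ge0 // addr_ge0. Qed.

(** The area of index k is 2 / (k (k + 1)) - 2 / ((k + 1) (k + 2)), so the sum over all k
    telescopes; omitting the other classes only lowers it. *)
Lemma index_area_sum_tail a m K n : 0 <= index_area_sum R a m (K + n) - index_area_sum R a m K <=
   2 / (K.+1%:R * K.+2%:R) - 2 / ((K + n).+1%:R * (K + n).+2%:R).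
Proof.
elim: n => [|n IH]; first by rewrite addn0 !subrr lexx.
rewrite addnS index_area_sumS; move: (K + n)%N IH => M IH.
have T : index_area M.+1 = 2 / (M.+1%:R * M.+2%:R) - 2 / (M.+2%:R * M.+3%:R).
  have E2 : M.+2%:R = M.+1%:R + 1 :> R by rewrite natr1.
  have E3 : M.+3%:R = M.+1%:R + 2 :> R by rewrite -[M.+3%:R]natr1 E2; ring.
  have m0 : 0 < M.+1%:R :> R by rewrite ltr0n.
  by rewrite /index_area E2 E3; move: (M.+1%:R) m0 => x x0; field; apply/and3P; split; lra.
have := index_area_ge0 M.+1; rewrite T.
pose p : R := 2 / (M.+1%:R * M.+2%:R); pose q : R := 2 / (M.+2%:R * M.+3%:R).
rewrite -/p -/q => t0; move: IH; rewrite -/p; clearbody p q; clear T.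
pose X : R := 2 / (K.+1%:R * K.+2%:R); rewrite -/X; clearbody X.
move: (index_area_sum R a m M) (index_area_sum R a m K) => c d.
by case: ifP => _; lra.
Qed.

Lemma le_of_le_inv (x y c : R) : (forall n, x <= y + c / n.+1%:R) -> x <= y.
Proof.
move=> H; rewrite leNgt; apply/negP => yx.
have d0 : 0 < x - y by lra.
have [n nn] : exists n : nat, c / (x - y) < n.+1%:R.
  exists (Num.truncn `|c / (x - y)|).
  by apply: le_lt_trans (ler_norm _) _; exact: truncnS_gt.
have n0 : 0 < n.+1%:R :> R by rewrite ltr0n.
rewrite ltr_pdivrMr // in nn; have := H n.
have : c / n.+1%:R < x - y by rewrite ltr_pdivrMr // mulrC.
by move: (c / n.+1%:R) => t; lra.
Qed.

(** Closed forms exist along 3 n + 1 only. For given K the tail estimate from K to 3 (K + n) + 1 is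
    used and n tends to infinity. *)
Lemma tail_limit_of_partial a m alpha (c : R) :
  (forall n, `|alpha - index_area_sum R a m (3 * n + 1)| <= c / n.+1%:R) -> tail_limit a m alpha.
Proof.
move=> H K; apply/andP; split.
  apply: (@le_of_le_inv _ _ c) => n.
  have := H (K + n)%N; have := index_area_sum_tail a m K (3 * (K + n) + 1 - K).
  rewrite subnKC; last by lia.
  have : c / (K + n).+1%:R <= c / n.+1%:R.
    have c0 : 0 <= c by have := H 0%N; rewrite divr1; apply: le_trans.
    by rewrite ler_wpM2l // lef_pV2 ?posrE ?ltr0n // ler_nat ltnS leq_addl.
  move: (2 / (_ * _)) (2 / (_ * _)) (c / _) (c / _) => p q r t.
  by move: (index_area_sum _ _ _ _) (index_area_sum _ _ _ _) => e f; rewrite ler_norml; lra.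
apply: (@le_of_le_inv _ _ c) => n.
have := H (K + n)%N; have := index_area_sum_tail a m K (3 * (K + n) + 1 - K).
rewrite subnKC; last by lia.
have : c / (K + n).+1%:R <= c / n.+1%:R.
  have c0 : 0 <= c by have := H 0%N; rewrite divr1; apply: le_trans.
  by rewrite ler_wpM2l // lef_pV2 ?posrE ?ltr0n // ler_nat ltnS leq_addl.
have : 0 <= 2 / ((3 * (K + n) + 1).+1%:R * (3 * (K + n) + 1).+2%:R) :> R.
  by rewrite divr_ge0 // mulr_ge0.
move: (2 / (_ * _)) (2 / (_ * _)) (c / _) (c / _) => p q r t.
by move: (index_area_sum _ _ _ _) (index_area_sum _ _ _ _) => e f; rewrite ler_norml; lra.
Qed.

(** [S n] tends to ln 3 and [D n] to pi / (3 sqrt 3). *)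
Let S n : R := \sum_(j < n) ((3 * j + 1)%:R^-1 + (3 * j + 2)%:R^-1 - 2 / (3 * j + 3)%:R).
Let D n : R := \sum_(j < n) ((3 * j + 1)%:R^-1 - (3 * j + 2)%:R^-1).

Lemma index_area_sum3 a m n : index_area_sum R a m (3 * n.+1 + 1) = index_area_sum R a m (3 * n + 1) +
  (if (m <= 3 * n + 2)%N && (a == 2)%N then index_area (3 * n + 2) else 0) +
  (if (m <= 3 * n + 3)%N && (a == 0)%N then index_area (3 * n + 3) else 0) +
  (if (m <= 3 * n + 4)%N && (a == 1)%N then index_area (3 * n + 4) else 0).
Proof.
have -> : (3 * n.+1 + 1 = (3 * n + 1).+3)%N by lia.
rewrite !index_area_sumS.
have -> : ((3 * n + 1).+1 = 3 * n + 2)%N by lia.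
have -> : ((3 * n + 2).+1 = 3 * n + 3)%N by lia.
have -> : ((3 * n + 3).+1 = 3 * n + 4)%N by lia.
have -> : ((3 * n + 2) %% 3 = 2)%N by lia.
have -> : ((3 * n + 3) %% 3 = 0)%N by lia.
have -> : ((3 * n + 4) %% 3 = 1)%N by lia.
by rewrite ![(_ == a)]eq_sym.
Qed.

Let ifF (b : bool) (x y : R) : (if b && false then x else y) = y.
Proof. by rewrite andbF. Qed.

Lemma natr3 n i : (3 * n + i)%:R = 3 * n%:R + i%:R :> R.
Proof. by rewrite natrD natrM. Qed.

(** Partial fractions 2 / k - 4 / (k + 1) + 2 / (k + 2) with k = 3 j + 2 involve all three classes
    mod 3; shifting the last fraction by one period leaves the boundary terms. *)
Lemma index_area_sum_res2 n : index_area_sum R 2 2 (3 * n + 1) = 2 * S n - 2 + 2 / (3 * n + 1)%:R.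
Proof.
elim: n => [|n IH].
  rewrite muln0 add0n /S big_ord0 /index_area_sum big_mkcond !big_ord_recr big_ord0 /=; lra.
rewrite index_area_sum3 IH /S big_ord_recr (_ : (2 == 2)%N = true) // (_ : (2 == 0)%N = false) // (_ : (2 == 1)%N = false) // !ifF andbT !addr0 /=.
have -> : (2 <= 3 * n + 2)%N by lia.
have n0 : 0 <= n%:R :> R by [].
rewrite /index_area !natr3 -[n.+1%:R]natr1; field.
by do ?[apply/andP; split]; lra.
Qed.

Lemma index_area_sum_res0 n : index_area_sum R 0 2 (3 * n + 1) = 3 - 3 * D n - S n
  - 4 / (3 * n + 1)%:R + 2 / (3 * n + 2)%:R.
Proof.
elim: n => [|n IH].
  rewrite muln0 !add0n /S /D !big_ord0 /index_area_sum big_mkcond !big_ord_recr big_ord0 /=; lra.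
rewrite index_area_sum3 IH /S /D !big_ord_recr (_ : (0 == 2)%N = false) // (_ : (0 == 0)%N = true) // (_ : (0 == 1)%N = false) // !ifF andbT !addr0 /=.
have -> : (2 <= 3 * n + 3)%N by lia.
have n0 : 0 <= n%:R :> R by [].
rewrite /index_area !natr3 -[n.+1%:R]natr1; field.
by do ?[apply/andP; split]; lra.
Qed.

(** The partial fractions over k = 3 j + 1 sum to 3 D - S without any shift; 2/3 is the excluded
    term k = 1. *)
Lemma index_area_sum_res1 n : index_area_sum R 1 2 (3 * n + 1) = 3 * D n - S n - 2 / 3 + index_area (3 * n + 1).
Proof.
elim: n => [|n IH].
  have t1 : index_area 1 = 2 / 3 by rewrite /index_area; field.
  rewrite muln0 !add0n t1 /S /D !big_ord0 /index_area_sum big_mkcond !big_ord_recr big_ord0 /=; lra.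
rewrite index_area_sum3 IH /S /D !big_ord_recr (_ : (1 == 2)%N = false) // (_ : (1 == 0)%N = false) // (_ : (1 == 1)%N = true) // !ifF andbT !addr0 /=.
have -> : (2 <= 3 * n + 4)%N by lia.
have n0 : 0 <= n%:R :> R by [].
rewrite /index_area !natr3 -[n.+1%:R]natr1; field.
by do ?[apply/andP; split]; lra.
Qed.

Lemma inv3_le n i : (0 < i)%N -> (3 * n + i)%:R^-1 <= n.+1%:R^-1 :> R.
Proof. by move=> i0; rewrite lef_pV2 ?posrE ?ltr0n ?ler_nat; lia. Qed.

Lemma tail_limit_2 : tail_limit 2 2 (2 * (ln (3 : R) - 1)).
Proof.
apply: (@tail_limit_of_partial _ _ _ 8) => n; rewrite index_area_sum_res2.
have := ln3_partial R n; rewrite -/(S n); have := @inv3_le n 1 isT.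
have : 0 <= (3 * n + 1)%:R^-1 :> R by rewrite invr_ge0.
by move: (_^-1) (_^-1) => p q; rewrite ler_norml; lra.
Qed.

Lemma tail_limit_0 : tail_limit 0 2 (3 - pi / Num.sqrt 3 - ln (3 : R)).
Proof.
apply: (@tail_limit_of_partial _ _ _ 10) => n; rewrite index_area_sum_res0.
have := ln3_partial R n; have := pi_sqrt3_partial R n; rewrite -/(S n) -/(D n).
have := @inv3_le n 1 isT; have := @inv3_le n 2 isT.
have : 0 <= (3 * n + 1)%:R^-1 :> R by rewrite invr_ge0.
have : 0 <= (3 * n + 2)%:R^-1 :> R by rewrite invr_ge0.
move: ((3 * n + 1)%:R^-1) ((3 * n + 2)%:R^-1) (n.+1%:R^-1) (pi / _) => p q r A.
by rewrite ler_norml; lra.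
Qed.

Lemma tail_limit_1 : tail_limit 1 2 (pi / Num.sqrt 3 - ln (3 : R) - 2 / 3).
Proof.
apply: (@tail_limit_of_partial _ _ _ 10) => n; rewrite index_area_sum_res1.
have := ln3_partial R n; have := pi_sqrt3_partial R n; rewrite -/(S n) -/(D n).
have := @inv3_le n 1 isT.
have : 0 <= (3 * n + 1)%:R^-1 :> R by rewrite invr_ge0.
have : index_area (3 * n + 1) <= 4 * (3 * n + 1)%:R^-1.
  rewrite /index_area -mulrA invfM ler_pM2l // ler_piMr ?invr_ge0 //.
  have n1 : 1 <= (3 * n + 1)%:R :> R by rewrite ler1n addn1.
  by rewrite invf_le1; nra.
have := index_area_ge0 (3 * n + 1).
move: (index_area _) ((3 * n + 1)%:R^-1) (n.+1%:R^-1) (pi / _) => t p r A.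
by rewrite ler_norml; lra.
Qed.

Lemma index_area_sum_small a m K : (K < m)%N -> index_area_sum R a m K = 0.
Proof. by move=> Km; rewrite /index_area_sum big1 // => k /andP[]; have := ltn_ord k; lia. Qed.

(** Starting at 5 drops the single term k = 2, which is 1/6. For K < 2 the lower bound is taken from
    K = 2. *)
Lemma tail_limit_25 : tail_limit 2 5 (2 * (ln (3 : R) - 1) - 1 / 6).
Proof.
have t2 : index_area_sum R 2 2 2 = 1 / 6.
  by rewrite index_area_sumS index_area_sum_small // add0r /= /index_area; field.
have E K : (2 <= K)%N -> index_area_sum R 2 5 K = index_area_sum R 2 2 K - 1 / 6.
  elim: K => // K IH; rewrite leq_eqVlt => /orP[/eqP <-|K2].
    by rewrite index_area_sum_small // t2 subrr.
  rewrite !index_area_sumS IH //.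
  have -> : (5 <= K.+1)%N && (K.+1 %% 3 == 2)%N = (2 <= K.+1)%N && (K.+1 %% 3 == 2)%N.
    by apply/andP/andP => -[*]; split=> //; lia.
  by rewrite -addrA -addrA [_ + - _]addrC.
move=> K; have := tail_limit_2 K; case: (leqP 2 K) => K1; first by rewrite E //; move: (index_area_sum _ _ _ _) (2 / _) (ln _) => t X l; lra.
have := tail_limit_2 2; rewrite t2 !index_area_sum_small //; last by lia.
rewrite !subr0; move: (2 / (K.+1%:R * K.+2%:R)) (2 / _) (ln _) => t X l; lra.
Qed.

End Constants.

(** * The quotient of the two counts *)

Section Final.
Variable R : realType.

Lemma harmonic_sum_le_ln n : harmonic_sum R n.+1 <= 1 + ln n.+1%:R.
Proof.
elim: n => [|n IH].
  by rewrite /harmonic_sum big_mkcond !big_ord_recr big_ord0 /= ln1; lra.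
have -> : harmonic_sum R n.+2 = harmonic_sum R n.+1 + n.+2%:R^-1.
  by rewrite /harmonic_sum big_mkcond big_ord_recr -big_mkcond.
have n0 : 0 < n.+1%:R :> R by rewrite ltr0n.
have n1 : 0 < n.+2%:R :> R by rewrite ltr0n.
have i1 : n.+2%:R^-1 < 1 :> R by rewrite invf_lt1 // ltr1n.
have i0 : 0 < n.+2%:R^-1 :> R by rewrite invr_gt0.
have E : n.+1%:R = n.+2%:R * (1 + - n.+2%:R^-1) :> R.
  by rewrite mulrDr mulr1 mulrN divff ?gt_eqF // -[n.+2%:R]natr1 addrK.
(* The inequality ln (1 + x) <= x at x = -1 / (n + 2) gives 1 / (n + 2) <= ln (n + 2) - ln (n +
   1). *)
have := @le_ln1Dx R (- n.+2%:R^-1).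
have : ln n.+1%:R = ln n.+2%:R + ln (1 + - n.+2%:R^-1) :> R.
  by rewrite [in LHS]E lnM // posrE subr_gt0.
clear E; move: IH i0 i1; move: (n.+2%:R^-1) (ln _) (ln _) (ln _) => p a b c; lra.
Qed.

Let A := pi / Num.sqrt (3 : R).
Let L := ln (3 : R).
Let area := gap_area (3 - A - L) (A - L - 2 / 3) (2 * (L - 1)) (2 * (L - 1) - 1 / 6).

Lemma gap_area_lim3 r : area r = 3 / 2 * gap_freq_lim3 R r.
Proof.
rewrite /area /A /L; case: r => [|[|[|[|[|[|r]]]]]]; rewrite /gap_area /gap_freq_lim3 /kite_area.
- lra.
- lra.
- lra.
- rewrite -[2 * pi / _]mulrA; lra.
- have -> : 2 / ((2 * 2%:R - 1) * (2 * 2%:R + 1) * (2 * 2%:R + 3)) = 2 / 105 :> R by field.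
  lra.
- have -> : 2 / ((2 * 3%:R - 1) * (2 * 3%:R + 1) * (2 * 3%:R + 3)) = 2 / 315 :> R by field.
  lra.
- have -> : (r.+4.+2 - 2)%:R = r.+4.+2%:R - 2 :> R by rewrite natrB.
  have r6 : 6 <= r.+4.+2%:R :> R by rewrite ler_nat.
  move: (r.+4.+2%:R) r6 => x x6; field.
  by do ?[apply/andP; split]; lra.
Qed.

Lemma gap_area_le (a b c d : R) r : `|a| <= 1 -> `|b| <= 1 -> `|c| <= 1 -> `|d| <= 1 ->
  `|gap_area a b c d r| <= 6.
Proof.
have k j : (0 < j)%N -> `|kite_area R j| <= 1 by exact: kite_area_le1.
case: r => [|[|[|[|[|[|r]]]]]]; rewrite /gap_area.
- rewrite !ler_norml; lra.
- rewrite !ler_norml; lra.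
- rewrite !ler_norml; lra.
- rewrite !ler_norml; lra.
- have := k 2%N isT; rewrite !ler_norml; lra.
- have := k 3%N isT; rewrite !ler_norml; lra.
- have := k (r.+4.+2 - 2)%N isT; rewrite !ler_norml; lra.
Qed.

Lemma gap_freq_lim3_le r : `|gap_freq_lim3 R r| <= 4.
Proof.
have t0 := tail_limit_le1 (m := 2) isT (tail_limit_0 R).
have t1 := tail_limit_le1 (m := 2) isT (tail_limit_1 R).
have t2 := tail_limit_le1 (m := 2) isT (tail_limit_2 R).
have t5 := tail_limit_le1 (m := 5) isT (tail_limit_25 R).
have := gap_area_le r t0 t1 t2 t5; rewrite -/A -/L -/area.
by rewrite gap_area_lim3 !ler_norml; lra.
Qed.

(** In 9 g - nu (9 f) the terms with Z cancel, leaving 1000 K + 9 + 4 (306 K + 9) = 2224 K + 45. The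
    denominator 9 f is at least (3/2) (1/4) q^2 - q^2 / 8 = q^2 / 4. *)
Lemma ratio_bound (g f nu Z q K l : R) : `|nu| <= 4 -> 1 / 4 <= Z -> 1 <= q -> 0 <= f ->
  `|9 * g - 3 / 2 * nu * Z * q ^+ 2| <= 1000 * K + 9 ->
  `|9 * f - 3 / 2 * Z * q ^+ 2| <= 306 * K + 9 ->
  K <= 2 * (q * l) -> 45 <= q * l -> 306 * K + 9 <= q ^+ 2 / 8 ->
  `|g / f - nu| <= 200 * 100 * (l / q).
Proof.
move=> nu4 Z4 q1 f0 hg hf Kl ql big.
have q20 : 1 <= q ^+ 2 by rewrite expr2; nra.
have K0 : 0 <= 306 * K + 9 by apply: le_trans hf.
have f1 : q ^+ 2 / 4 <= 9 * f.
  have : 1 / 4 * q ^+ 2 <= Z * q ^+ 2 by rewrite ler_wpM2r //; lra.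
  by move: hf; rewrite ler_norml -[3 / 2 * Z * _]mulrA; lra.
have fp : 0 < f by lra.
have -> : g / f - nu = (9 * g - nu * (9 * f)) / (9 * f) by field; lra.
rewrite normrM [`|_^-1|]ger0_norm ?invr_ge0; last lra.
rewrite ler_pdivrMr; last lra.
have d1 : `|9 * g - nu * (9 * f)| <= 2224 * K + 45.
  have -> : 9 * g - nu * (9 * f) = (9 * g - 3 / 2 * nu * Z * q ^+ 2)
     - nu * (9 * f - 3 / 2 * Z * q ^+ 2) by ring.
  apply: le_trans (ler_normB _ _) _; rewrite normrM.
  have : `|nu| * `|9 * f - 3 / 2 * Z * q ^+ 2| <= 4 * (306 * K + 9) by apply: ler_pM.
  lra.
apply: le_trans d1 _.
have l0 : 0 <= l by nra.
apply: (@le_trans _ _ (200 * 100 * (l / q) * (q ^+ 2 / 4))); last first.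
  by rewrite ler_wpM2l // mulr_ge0 // divr_ge0 //; lra.
have -> : 200 * 100 * (l / q) * (q ^+ 2 / 4) = 50 * 100 * (q * l) by field; lra.
lra.
Qed.

(** The threshold serves 306 K + 9 <= Q^2 / 8: with s = sqrt Q one has K <= 2 Q ln Q <= 4 Q s, so s
    slightly above 8 times 306 times 4 = 9792 is enough, and s >= 10^4 holds. *)
Lemma gap_freq_asymp c0 (Q r : nat) : c0 = 1%N \/ c0 = 2%N -> 10 ^+ 8 <= Q%:R :> R ->
  `|gap_freq R Q r 3 c0 - gap_freq_lim3 R r| <= 200 * 100 * (ln Q%:R / Q%:R).
Proof.
move=> c12 hQ.
have big8 : 1 <= 10 ^+ 8 :> R by rewrite exprn_ege1 //; lra.
have q1 : 1 <= Q%:R :> R by lra.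
have Q0 : (0 < Q)%N by rewrite -(ltr0n R); lra.
have /andP[g1 g2] := gap_count_le Q0 r c12.
have /andP[f1 f2] := class_count_le Q0 c12.
have Gb := window_count_asymp (tail_limit_0 R) (tail_limit_1 R) (tail_limit_2 R) (tail_limit_25 R) Q r c12.
have Fb := class_asymp R Q c12.
have Zb := @mobius_sum_ge R Q Q0.
rewrite -/A -/L -/area gap_area_lim3 in Gb.
set K := Q%:R * harmonic_sum R Q in Gb Fb.
set M := pair_count Q _ in f1 f2 Fb.
have s0 : 0 <= Num.sqrt (Q%:R : R) by rewrite sqrtr_ge0.
have ss : Num.sqrt (Q%:R : R) ^+ 2 = Q%:R by rewrite sqr_sqrtr.
set s := Num.sqrt _ in s0 ss.
have s4 : 10 ^+ 4 <= s.
  rewrite leNgt; apply/negP => h.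
  have : s ^+ 2 < 10 ^+ 8.
    rewrite (_ : 10 ^+ 8 = (10 ^+ 4) ^+ 2); last by rewrite -exprM.
    by rewrite ltr_pXn2r // nnegrE exprn_ge0.
  by rewrite ss; lra.
have s10 : 100 * 100 <= s by apply: le_trans s4; rewrite !exprS expr0; lra.
have sp : 0 < s by lra.
have ln_s : ln Q%:R <= 2 * s.
  by rewrite -ss lnXn // mulr2n; have := ln_sublinear sp; lra.
have ln1' : 1 <= ln (Q%:R : R).
  have l3 := ln3_approx R.
  have : ln 3 <= ln (Q%:R : R) by rewrite ler_ln ?posrE; rewrite -?ss ?expr2; nra.
  lra.
have Kl : K <= 2 * (Q%:R * ln Q%:R).
  have : harmonic_sum R Q <= 1 + ln Q%:R by case: (Q) Q0 => // n _; exact: harmonic_sum_le_ln.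
  rewrite /K => h; have : Q%:R * harmonic_sum R Q <= Q%:R * (1 + ln Q%:R) by rewrite ler_wpM2l.
  nra.
apply: (@ratio_bound _ _ _ (mobius_sum R Q) _ K) => //.
- exact: gap_freq_lim3_le.
- move: Gb; rewrite !ler_norml.
  have : (farey_gap_count Q r 3 c0)%:R <= (window_count Q c0 r)%:R :> R by rewrite ler_nat.
  have : (window_count Q c0 r)%:R <= (farey_gap_count Q r 3 c0)%:R + 1 :> R by rewrite natr1 ler_nat.
  lra.
- move: Fb; rewrite !ler_norml.
  have : M%:R <= (farey_class_count Q 3 c0)%:R :> R by rewrite ler_nat.
  have : (farey_class_count Q 3 c0)%:R <= M%:R + 1 :> R by rewrite natr1 ler_nat.
  lra.
- have : 45 * 1 <= Q%:R * ln (Q%:R : R).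
    by apply: ler_pM => //; rewrite -ss expr2; nra.
  lra.
- have : Q%:R * ln (Q%:R : R) <= Q%:R * (2 * s) by rewrite ler_wpM2l.
  rewrite -ss in Kl *; nra.
Qed.

End Final.

Local Open Scope classical_set_scope.

Theorem mainTheorem1 (R : realType) :
  (exists C : R, forall (c0 : nat) (r : nat -> nat),
     c0 = 1%N \/ c0 = 2%N ->
     (fun Q : nat => (r Q)%:R : R^o) =o_\oo
       (fun Q : nat => (Q%:R / ln Q%:R) `^ (1 / 3) : R^o) ->
     \forall Q \near \oo,
       `|gap_freq R Q (r Q) 3 c0 - gap_freq_lim3 R (r Q)|
         <= C * (ln Q%:R / Q%:R))
  /\ [/\ has_decimals (gap_freq_lim3 R 0) [:: 3; 3; 3; 3; 3; 3; 3; 3; 3; 3]%N,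
         has_decimals (gap_freq_lim3 R 1) [:: 1; 4; 3; 4; 5; 8; 0; 5; 0; 4]%N
       & has_decimals (gap_freq_lim3 R 2) [:: 2; 6; 2; 9; 6; 6; 1; 0; 3; 1]%N]
  /\ [/\ has_decimals (gap_freq_lim3 R 3) [:: 1; 3; 7; 0; 8; 1; 4; 5; 6; 1]%N,
         has_decimals (gap_freq_lim3 R 4) [:: 0; 7; 7; 3; 9; 2; 2; 9; 1; 2]%N
       & has_decimals (gap_freq_lim3 R 5) [:: 0; 3; 5; 1; 8; 6; 7; 5; 5; 2]%N].
Proof.
split; last exact: gap_freq_lim3_decimals.
exists (200 * 100) => c0 r c12 _; near=> Q.
apply: gap_freq_asymp => //.
by near: Q; exact: nbhs_infty_ger.
Unshelve. all: by end_near.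
Qed.
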